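(* Let $p>3$ be a prime. If $p\equiv1\pmod3$ and $p=x^2+3y^2$ with $x,y\in\mathbb Z$, then $$\sum_{k=0}^{p-2}\frac{\binom{2k}k^2\binom{3k}k}{108^k(k+1)}\equiv4x^2-2p\pmod{p^3}.$$ If $p\equiv2\pmod3$, then $$\sum_{k=0}^{p-2}\frac{\binom{2k}k^2\binom{3k}k}{108^k(k+1)}\equiv-2\binom{(p-1)/2}{(p-5)/6}^2\Big(1+p\Big(2+\frac43q_p(2)-\frac32q_p(3)\Big)+p^2\Big(1+\frac83q_p(2)+\frac29q_p(2)^2-3q_p(3)-2q_p(2)q_p(3)+\frac{15}8q_p(3)^2+\frac34U_{p-3}\Big)\Big)-\frac12p^2\binom{(p-1)/2}{(p-5)/6}^{-2}\pmod{p^3}.$$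
   Context: Congruences modulo $p^3$ are between rational numbers whose denominators are not divisible by $p$. For $a$ not divisible by $p$, $q_p(a)=(a^{p-1}-1)/p$. The sequence $\{U_n\}$ is given by $U_{2n-1}=0$, $U_0=1$, $U_{2n}=-2\sum_{k=1}^n\binom{2n}{2k}U_{2n-2k}$ for $n=1,2,3,\ldots$. *)

(* Defs.v *)
From mathcomp Require Import all_boot all_order all_algebra.

Set Implicit Arguments.
Unset Strict Implicit.
Unset Printing Implicit Defensive.

Import Order.TTheory GRing.Theory Num.Theory.

Local Open Scope ring_scope.

(* denq r is the denominator of r in lowest terms. *)
Definition p_integral (p : nat) (r : rat) : bool := ~~ (p%:Z %| denq r)%Z.

(* a = b (mod p^e) in the ring of p-integral rationals; the p-integrality of
   both a and b is part of the assertion. *)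
Definition rat_eqmod (p e : nat) (a b : rat) : bool :=
  [&& p_integral p a, p_integral p b & p_integral p ((a - b) / p%:R ^+ e)].

Definition fermat_quotient (p : nat) (a : int) : rat :=
  (a%:~R ^+ (p - 1) - 1) / p%:R.

(* [:: U_0; U_2; ...; U_(2n)] *)
Fixpoint U_even_seq (n : nat) : seq int :=
  if n is m.+1 then
    let s := U_even_seq m in
    rcons s (- 2 * \sum_(1 <= k < n.+1) ('C(2 * n, 2 * k))%:Z * s`_(n - k))
  else [:: 1].

Definition U (n : nat) : int := if odd n then 0 else (U_even_seq n./2)`_n./2.

Lemma size_U_even_seq n : size (U_even_seq n) = n.+1.
Proof. by elim: n => //= n IHn; rewrite size_rcons IHn. Qed.

Lemma nth_U_even_seq n m : (m <= n)%N -> (U_even_seq n)`_m = U (2 * m).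
Proof.
rewrite /U mul2n odd_double doubleK.
elim: n => [|n IHn]; first by rewrite leqn0 => /eqP->.
rewrite leq_eqVlt => /predU1P[-> //|]; rewrite ltnS => le_mn.
by rewrite /= nth_rcons size_U_even_seq ltnS le_mn IHn.
Qed.

Lemma U_0 : U 0 = 1.
Proof. by []. Qed.

Lemma U_odd n : (0 < n)%N -> U (2 * n - 1) = 0.
Proof. by case: n => // n _; rewrite /U mul2n doubleS subn1 /= odd_double. Qed.

Lemma U_even n : (0 < n)%N ->
  U (2 * n) =
    - 2 * \sum_(1 <= k < n.+1) ('C(2 * n, 2 * k))%:Z * U (2 * n - 2 * k).
Proof.
case: n => // n _; rewrite -(@nth_U_even_seq n.+1) // [U_even_seq _]/=.
rewrite nth_rcons size_U_even_seq ltnn eqxx; congr (_ * _).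
rewrite big_nat_cond [RHS]big_nat_cond; apply: eq_bigr => k /andP[/andP[k_gt0 _] _].
by rewrite -mulnBr nth_U_even_seq // leq_subLR -addn1 addnC leq_add2r.
Qed.

(* Main.v *)
(** Let R = Z/p^3, and for a in R let S(a) be the sum over k < p of
    C(2k,k)/4^k C(a,k) C(-1-a,k). The sum of the theorem is the sum of the terms of
    S(-1/3) divided by k + 1, and a contiguity relation reduces it to values of S at
    points 2r + pt and 2r + 1 + pt, where r = p/6 rounded down. A three-term recurrence
    from a - 2 to a expresses S(2r + pt) through S(pt), which is elementary modulo p^3,
    and products expanded by harmonic sums; S(2r + 1 + pt) is divisible by p^2.

    If p = 2 (mod 3), the harmonic sums are Fermat quotients, apart from the sum of i^-2 over
    i <= p/3, which the Appell polynomials of U evaluate as a multiple of U_(p-3).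

    If p = 1 (mod 3), the result is J^2 + p^2/J^2 for an explicit J. Interpolating the
    exponents of the Teichmüller characters shows that -J is a Jacobi sum of a cubic and a
    quadratic character, so that J and its conjugate p/J have sum 2a with
    p = a^2 + 3b^2; then J^2 + p^2/J^2 = 4a^2 - 2p, and a^2 = x^2 by uniqueness. *)

Require Import Defs.
From mathcomp Require Import all_boot all_order all_algebra.
From mathcomp Require Import finfield.
From mathcomp Require Import zify ring.

Set Implicit Arguments.
Unset Strict Implicit.
Unset Printing Implicit Defensive.

Import Order.TTheory GRing.Theory Num.Theory.

Local Open Scope ring_scope.

(** Precision p^3 shapes everything. The boundary term of a telescoping identity drops only when it
    carries three factors p: one comes from C(2k,k)/4^k at k = p - 1, two from C(a,k) C(-1-a,k).
    Expansions in p run to second order, with halves and thirds as coefficients. The ring is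
    therefore an abstract R in which p^3 = 0, integers prime to p are units, and only multiples of
    p^3 vanish among the integers. Once p is an integer multiple of a nilpotent variable, a
    congruence becomes a polynomial identity for [ring].

    For p = 1 (mod 3) the harmonic sums up to p/3 are never evaluated. They occur in the square root
    J of S(2r - p/3) and in the binomials that express the Jacobi sum, and the two expressions agree
    with these sums as free variables.

    Teichmüller characters take values in Z/p^3 itself, so neither complex numbers nor a cyclotomic
    ring is involved. Integers return through the coordinates of the Jacobi sum on the cube roots of
    unity of Z/p^3: its norm form is too small for a congruence modulo p^3 to be anything but an
    equality. *)

Section BigSplit.

Variables (V : Type) (idx : V) (op : Monoid.com_law idx) (f : nat -> V).

Lemma big_split_rev N m :
  \big[op/idx]_(i < N + m) f i =
  op (\big[op/idx]_(i < N) f i) (\big[op/idx]_(i < m) f (N + m - i.+1)%N).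
Proof.
rewrite big_split_ord /=; congr (op _ _); rewrite (reindex_inj rev_ord_inj) /=.
by apply: eq_bigr => i _; congr f; have := ltn_ord i; lia.
Qed.

Lemma big_even_odd n :
  \big[op/idx]_(i < n + n) f i =
  op (\big[op/idx]_(i < n) f (2 * i)%N) (\big[op/idx]_(i < n) f (2 * i + 1)%N).
Proof.
elim: n => [|n IHn]; first by rewrite !big_ord0 Monoid.mulm1.
rewrite addnS addSn !big_ord_recr /= IHn -Monoid.mulmA Monoid.mulmACA.
by rewrite mul2n -addnn addn1.
Qed.

End BigSplit.

(* The c_i certify that a - b lies in the ideal generated by the l_i - r_i. *)
Lemma lincomb1 (R : pzRingType) (a b c1 l1 r1 : R) :
  l1 = r1 -> a - b = c1 * (l1 - r1) -> a = b.
Proof. by move=> -> h; apply/eqP; rewrite -subr_eq0 h subrr mulr0. Qed.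

Lemma lincomb2 (R : pzRingType) (a b c1 c2 l1 r1 l2 r2 : R) :
  l1 = r1 -> l2 = r2 -> a - b = c1 * (l1 - r1) + c2 * (l2 - r2) -> a = b.
Proof. by move=> e1 -> h; apply: (lincomb1 e1); rewrite h subrr mulr0 addr0. Qed.

Lemma lincomb3 (R : pzRingType) (a b c1 c2 c3 l1 r1 l2 r2 l3 r3 : R) :
  l1 = r1 -> l2 = r2 -> l3 = r3 ->
  a - b = c1 * (l1 - r1) + c2 * (l2 - r2) + c3 * (l3 - r3) -> a = b.
Proof. by move=> e1 e2 -> h; apply: (lincomb2 e1 e2); rewrite h subrr mulr0 addr0. Qed.

Lemma eq_divr (R : comUnitRingType) (x y u v : R) :
  u \is a GRing.unit -> v \is a GRing.unit -> x * v = y * u -> x / u = y / v.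
Proof.
move=> uu uv xv; apply: (mulIr uu); apply: (mulIr uv).
by rewrite divrK // mulrAC divrK.
Qed.

(** * Truncated Legendre-type sums *)

Section Hypergeometric.

Variable R : comUnitRingType.
Implicit Types (a x y : R) (k N : nat).

(* C(2k,k) / 4^k. *)
Definition cbin4 k : R := \prod_(i < k) ((2 * i%:R + 1) / (2 * i.+1%:R)).

(* C(a,k) C(-1-a,k). At a = -1/3 it is C(2k,k) C(3k,k) / 27^k. *)
Definition legc a k : R :=
  \prod_(i < k) ((i%:R * (i%:R + 1) - a * (a + 1)) / i.+1%:R ^+ 2).

Definition legs N a : R := \sum_(k < N) cbin4 k * legc a k.

Lemma cbin4S k : cbin4 k.+1 = cbin4 k * ((2 * k%:R + 1) / (2 * k.+1%:R)).
Proof. by rewrite /cbin4 big_ord_recr. Qed.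

Lemma cbin40 : cbin4 0 = 1. Proof. exact: big_ord0. Qed.

Lemma cbin4SE k : (2 : R) \is a GRing.unit -> (k.+1%:R : R) \is a GRing.unit ->
  cbin4 k.+1 * (2 * k.+1%:R) = cbin4 k * (2 * k%:R + 1).
Proof. by move=> u2 uk; rewrite cbin4S -mulrA divrK // unitrM u2. Qed.

Lemma legc0 a : legc a 0 = 1. Proof. exact: big_ord0. Qed.

Lemma legcS a k :
  legc a k.+1 = - legc a k * (a - k%:R) * (a + k%:R + 1) * k.+1%:R ^- 2.
Proof. by rewrite {1}/legc big_ord_recr -/(legc a k) /=; ring. Qed.

Lemma legcN a k : legc (- 1 - a) k = legc a k.
Proof. by apply: eq_bigr => i _; congr (_ / _); ring. Qed.

Lemma legsN N a : legs N (- 1 - a) = legs N a.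
Proof. by apply: eq_bigr => k _; rewrite legcN. Qed.

Lemma legsS N a : legs N.+1 a = legs N a + cbin4 N * legc a N.
Proof. exact: big_ord_recr. Qed.

(** Up to sign, [legc a k] is (a-k+1)...(a+k) / k!^2, so passing from a to a - 1 drops the factor a
    + k and gains a - k. Cross-multiplied, since neither factor need be a unit. *)
Lemma legc_shift a k : legc a k * (a - k%:R) = legc (a - 1) k * (a + k%:R).
Proof.
elim: k => [|k IHk]; first by rewrite !legc0; ring.
rewrite !legcS; transitivity (- (legc a k * (a - k%:R))
  * (a + k%:R + 1) * (a - k%:R - 1) * k.+1%:R ^- 2); first by ring.
by rewrite IHk; ring.
Qed.

Lemma legcS_pred a k :
  legc a k.+1 =
  - legc (a - 1) k * (a + k%:R) * (a + k%:R + 1) * k.+1%:R ^- 2.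
Proof.
rewrite legcS; transitivity (- (legc a k * (a - k%:R))
  * (a + k%:R + 1) * k.+1%:R ^- 2); first by ring.
by rewrite legc_shift; ring.
Qed.

Lemma legcS_succ a k :
  legc a k.+1 =
  - legc (a + 1) k * (a - k%:R) * (a - k%:R + 1) * k.+1%:R ^- 2.
Proof.
rewrite -legcN legcS_pred -[legc (- 1 - a - 1) k]legcN.
by rewrite (_ : - 1 - (- 1 - a - 1) = a + 1); ring.
Qed.

(** Creative telescoping: the right-hand side is the certificate, whose increment in [N] is the
    left-hand combination of the new summands. *)
Lemma legs_rec N a : (forall k, (k < N)%N -> (k.+1%:R : R) \is a GRing.unit) ->
    (2 : R) \is a GRing.unit ->
  a ^+ 2 * legs N.+1 a - (a - 1) ^+ 2 * legs N.+1 (a - 2) =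
  (2 * a - 1) * (2 * N%:R + 1) * cbin4 N * legc (a - 1) N.
Proof.
move=> uN u2; elim: N uN => [|N IHN] uN.
  by rewrite /legs !big_ord_recr !big_ord0 /= !cbin40 !legc0; ring.
rewrite !(legsS N.+1) !mulrDr opprD addrACA IHN; last first.
  by move=> k /leqW; apply: uN.
have -> : (2 * a - 1) * (2 * N%:R + 1) * cbin4 N =
          (2 * a - 1) * (cbin4 N.+1 * (2 * N.+1%:R)).
  by rewrite cbin4SE //; [ring|exact: uN].
rewrite [legc (a - 2) _]legcS_succ [legc a _]legcS_pred legcS.
rewrite (_ : a - 2 + 1 = a - 1); last by ring.
(* This relation is all that [ring] needs about the inverse of N + 1, which then becomes a free
   variable. *)
have hv : N%:R * N.+1%:R^-1 = 1 - N.+1%:R^-1 :> R.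
  by rewrite -[X in X * _](addrK 1) natr1 mulrBl mulrV ?(uN N (ltnSn N)) ?mul1r.
by rewrite -!exprVn; move: (_^-1) hv => v hv; ring: hv.
Qed.

Lemma cbin4S_sub k : (2 : R) \is a GRing.unit -> (k.+1%:R : R) \is a GRing.unit ->
  2 * cbin4 k.+1 = 2 * cbin4 k - cbin4 k / k.+1%:R.
Proof.
move=> u2 uk; apply: (mulIr uk); rewrite mulrBl divrK // [2 * _]mulrC -mulrA.
by rewrite cbin4SE // -[k.+1%:R]natr1; ring.
Qed.

(** The weight 1/(k+1) is removed here, again by telescoping: the weighted sum at a is a combination
    of unweighted ones at a - 1, a and a + 1, up to a boundary term. *)
Lemma legs_contiguous N a :
    (forall k, (k < N)%N -> (k.+1%:R : R) \is a GRing.unit) ->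
    (2 : R) \is a GRing.unit ->
  (a + 1) * legs N.+1 (a + 1) + a * legs N.+1 (a - 1) =
  (2 * a + 1) * (\sum_(k < N) cbin4 k * legc a k / k.+1%:R
                 - legs N.+1 a + 2 * (cbin4 N * legc a N)).
Proof.
move=> uN u2; elim: N uN => [|N IHN] uN.
  by rewrite /legs !big_ord_recr !big_ord0 /= !cbin40 !legc0; ring.
rewrite !(legsS N.+1) 2!mulrDr addrACA IHN; last first.
  by move=> k /leqW; apply: uN.
rewrite [in RHS]big_ord_recr /= [legc (a - 1) _]legcS_succ [legc (a + 1) _]legcS_pred.
rewrite subrK addrK.
have hv : N%:R * N.+1%:R^-1 = 1 - N.+1%:R^-1 :> R.
  by rewrite -[X in X * _](addrK 1) natr1 mulrBl mulrV ?(uN N (ltnSn N)) ?mul1r.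
have hC : cbin4 N = cbin4 N.+1 + 2^-1 * (cbin4 N / N.+1%:R).
  apply: (mulrI u2); rewrite mulrDr mulVKr // cbin4S_sub ?(uN N (ltnSn N)) //.
  by rewrite subrK.
rewrite legcS.
have -> : 2 * (cbin4 N * legc a N) = 2 * cbin4 N.+1 * legc a N
     + cbin4 N * legc a N / N.+1%:R.
  rewrite cbin4S_sub ?(uN N (ltnSn N)) //; ring.
by rewrite -!exprVn; move: (_^-1) hv => v hv; ring: hv.
Qed.

End Hypergeometric.

(** * The Appell polynomials of the sequence U *)

(** Umbrally, (U+1)^k + (U-1)^k = U^k + 0^k: odd indices contribute nothing, and the even ones give
    the factor 2 of the defining recurrence. *)
Lemma U_rec k :
  \sum_(j < k.+1) ('C(k, j))%:Z * U j * (1 + (-1) ^+ (k - j)) =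
  U k + (k == 0%N)%:Z.
Proof.
case: (posnP k) => [->|k0]; first by rewrite big_ord1.
rewrite addr0.
have [ok|ek] := boolP (odd k).
  rewrite {2}/U ok big1 // => j _.
  have [oj|ej] := boolP (odd j); first by rewrite /U oj mulr0 mul0r.
  by rewrite -signr_odd oddB ?ok ?(negPf ej) ?subrr ?mulr0 // -ltnS.
have {ek} [n hn] : exists n, k = (2 * n)%N.
  by exists k./2; rewrite -[LHS]odd_double_half (negPf ek) mul2n.
have n0 : (0 < n)%N by lia.
have -> : \sum_(j < k.+1) ('C(k, j))%:Z * U j * (1 + (-1) ^+ (k - j)) =
   \sum_(0 <= i < n.+1) ('C(k, 2 * i))%:Z * U (2 * i) * 2.
  rewrite -(big_mkord xpredT
    (fun j => ('C(k, j))%:Z * U j * (1 + (-1) ^+ (k - j)))) [in LHS]hn.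
  suff h i : (i <= n)%N -> \sum_(0 <= j < (2 * i).+1)
         ('C(k, j))%:Z * U j * (1 + (-1) ^+ (2 * n - j)) =
       \sum_(0 <= i0 < i.+1) ('C(k, 2 * i0))%:Z * U (2 * i0) * 2.
    by rewrite -h // hn.
  elim: i => [|i IHi] ilt.
    by rewrite muln0 !big_nat1 -signr_odd oddB // muln0 /= mul2n odd_double.
  rewrite (_ : (2 * i.+1).+1 = (2 * i).+3)%N; last by lia.
  rewrite [LHS]big_nat_recr //= [X in X + _ = _]big_nat_recr //= IHi; last by lia.
  rewrite [RHS]big_nat_recr //= -addrA; congr (_ + _).
  rewrite {1}/U /= mul2n odd_double /= mulr0 mul0r add0r -mul2n.
  rewrite (_ : (2 * i).+2 = (2 * i.+1)%N); last by lia.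
  by rewrite -signr_odd -mulnBr oddM.
have hU := U_even n0; rewrite -hn big_add1 /= in hU.
rewrite big_nat_recr //= -hn binn big_nat_rev /= add0n.
suff -> : \sum_(0 <= i < n) ('C(k, 2 * (n - i.+1)))%:Z * U (2 * (n - i.+1)) * 2 = - U k.
  by ring.
rewrite hU mulNr opprK mulr_sumr; apply: eq_big_nat => i /andP[_ ilt].
rewrite [RHS]mulrC; congr (_%:Z * U _ * _); last by lia.
by rewrite -[RHS]bin_sub; [congr 'C(_, _); lia|lia].
Qed.

Section Appell.

Variable R : comPzRingType.
Implicit Types x e : R.

(** The Appell sequence with generating function e^(xt) / (e^t + e^(-t) - 1). *)
Definition Upoly n x : R := \sum_(j < n.+1) 'C(n, j)%:R * (U j)%:~R * x ^+ (n - j).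

Lemma bin_exprD n j x e : (j <= n)%N ->
  'C(n, j)%:R * (x + e) ^+ (n - j) =
  \sum_(k < n.+1) 'C(n, k)%:R * 'C(k, j)%:R * x ^+ (n - k) * e ^+ (k - j).
Proof.
move=> jn; have -> : n.+1 = (j + (n - j).+1)%N by lia.
rewrite big_split_ord /= big1 ?add0r => [|i _]; last first.
  by rewrite (@bin_small i j) // mulr0n mulr0 !mul0r.
rewrite exprDn mulr_sumr; apply: eq_bigr => i _; have ilt := ltn_ord i.
have -> : (n - (j + i) = n - j - i)%N by lia.
rewrite addKn -mulr_natr.
transitivity (('C(n, j) * 'C(n - j, i))%:R * (x ^+ (n - j - i) * e ^+ i)).
  by rewrite natrM; ring.
rewrite -natrM -[RHS]mulrA; congr (_%:R * _).
have h1 := bin_fact jn.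
have h2 : (i <= n - j)%N by lia.
have {}h2 := bin_fact h2.
have h3 : (j + i <= n)%N by lia.
have {}h3 := bin_fact h3.
have h4 := bin_fact (leq_addr i j).
rewrite addKn in h4; rewrite subnDA in h3.
have f0 := fact_gt0; apply/eqP.
rewrite -(eqn_pmul2r (_ : 0 < j`! * i`! * (n - j - i)`!)%N) ?muln_gt0 ?f0 //.
have -> : ('C(n, j) * 'C(n - j, i) * (j`! * i`! * (n - j - i)`!) = n`!)%N.
  by rewrite -h1 -h2; ring.
have -> : ('C(n, j + i) * 'C(j + i, j) * (j`! * i`! * (n - j - i)`!) = n`!)%N.
  by rewrite -h3 -h4; ring.
by [].
Qed.

Lemma Upoly_shift n x e :
  Upoly n (x + e) = \sum_(k < n.+1) 'C(n, k)%:R * x ^+ (n - k) *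
     \sum_(j < n.+1) 'C(k, j)%:R * (U j)%:~R * e ^+ (k - j).
Proof.
transitivity (\sum_(j < n.+1) \sum_(k < n.+1) 'C(n, k)%:R * x ^+ (n - k) *
     ('C(k, j)%:R * (U j)%:~R * e ^+ (k - j)) : R).
  apply: eq_bigr => j _; rewrite mulrAC bin_exprD; last by rewrite -ltnS.
  by rewrite mulr_suml; apply: eq_bigr => k _; ring.
by rewrite exchange_big /=; apply: eq_bigr => k _; rewrite mulr_sumr.
Qed.

Lemma U_rec_ring n k : (k <= n)%N ->
  \sum_(j < n.+1) 'C(k, j)%:R * (U j)%:~R * 1 ^+ (k - j) +
  \sum_(j < n.+1) 'C(k, j)%:R * (U j)%:~R * (-1) ^+ (k - j) =
  (U k)%:~R + (k == 0%N)%:R :> R.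
Proof.
move=> kn; have := congr1 (fun z : int => z%:~R : R) (U_rec k).
rewrite rmorphD /= => <-; rewrite rmorph_sum /= -big_split /=.
have -> : n.+1 = (k.+1 + (n - k))%N by lia.
rewrite big_split_ord /= [X in _ + X]big1 ?addr0 => [|j _]; last first.
  by rewrite bin_small ?mulr0n ?mul0r ?addr0 //; lia.
apply: eq_bigr => j _.
by rewrite !rmorphM rmorphD rmorphXn /= rmorphN1 rmorph1 expr1n -mulrDr.
Qed.

Lemma UpolyP n x : Upoly n (x + 1) + Upoly n (x - 1) - Upoly n x = x ^+ n.
Proof.
rewrite !Upoly_shift -big_split /= /Upoly -sumrB.
transitivity (\sum_(k < n.+1) 'C(n, k)%:R * x ^+ (n - k) * (val k == 0%N)%:R).
  apply: eq_bigr => k _; rewrite -mulrDr U_rec_ring; last by rewrite -ltnS.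
  by ring.
rewrite big_ord_recl /= [X in _ + X]big1 => [|i _]; last by rewrite mulr0.
by rewrite bin0 subn0; ring.
Qed.

Lemma Upoly0 n : Upoly n 0 = (U n)%:~R.
Proof.
rewrite /Upoly big_ord_recr /= big1 => [|j _].
  by rewrite subnn binn; ring.
by rewrite expr0n subn_eq0 leqNgt ltn_ord /= mulr0.
Qed.

Lemma UpolyN n x : ~~ odd n -> Upoly n (- x) = Upoly n x.
Proof.
move=> en; apply: eq_bigr => j _; have jn : (j <= n)%N by rewrite -ltnS.
have [oj|ej] := boolP (odd j); first by rewrite /U oj mulr0 !mul0r.
by rewrite exprNn -signr_odd oddB // (negPf en) (negPf ej) mul1r.
Qed.

(* Telescoping [UpolyP] with period 6: the roots of T^2 - T + 1 have order 6. *)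
Lemma Upoly_add6 n x : Upoly n (x + 6) - Upoly n x =
  (x + 4) ^+ n + (x + 5) ^+ n - (x + 1) ^+ n - (x + 2) ^+ n.
Proof.
rewrite -!UpolyP; move: (Upoly n) => f.
have e k l (e : l = k + 1 :> R) : f (x + k + 1) = f (x + l) by rewrite -addrA e.
have e' k l (e' : k = l + 1 :> R) : f (x + k - 1) = f (x + l) by rewrite e' addrA addrK.
rewrite (e 1 2) ?(e 2 3) ?(e 4 5) ?(e 5 6); [|ring..].
rewrite (e' 1 0) ?(e' 2 1) ?(e' 4 3) ?(e' 5 4); [|ring..].
rewrite addr0; ring.
Qed.

(** The base point is -1 because p = 6r + 5 equals -1 + 6(r + 1). *)
Lemma Upoly_mul6 n K : Upoly n (- 1 + 6 * K%:R) = Upoly n (- 1) +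
  \sum_(i < K) ((6 * i + 3)%:R ^+ n + (6 * i + 4)%:R ^+ n
                 - (6 * i)%:R ^+ n - (6 * i + 1)%:R ^+ n).
Proof.
elim: K => [|K IHK]; first by rewrite big_ord0 mulr0 !addr0.
rewrite big_ord_recr /= addrA -IHK.
have -> : - 1 + 6 * K.+1%:R = - 1 + 6 * K%:R + 6 :> R by ring.
rewrite -[LHS](subrK (Upoly n (- 1 + 6 * K%:R))) Upoly_add6 addrC; congr (_ + _).
by congr (_ ^+ _ + _ ^+ _ - _ ^+ _ - _ ^+ _); ring.
Qed.

End Appell.

(** * Factorials, binomials and the form x^2 + 3y^2 *)

Definition asc N s := (\prod_(i < s) (N + i.+1))%N.

Lemma fact_asc N s : ((N + s)`! = N`! * asc N s)%N.
Proof.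
elim: s => [|s IHs]; first by rewrite /asc big_ord0 addn0 muln1.
by rewrite addnS factS IHs /asc big_ord_recr /= [RHS]mulnA [RHS]mulnC addnS.
Qed.

(** For [K] a multiple of p: M! and (M+c)! are both measured from K!, and [s] is the gap by which M
    falls short of K + a. Clearing denominators keeps the identity in the natural numbers. *)
Lemma bin_asc M c s K a : (M + s = K + a)%N ->
  ('C(M + c, c) * c`! * asc K a * asc (M + c) s = asc K (a + c) * asc M s)%N.
Proof.
move=> hM; have hb := bin_fact (leq_addl M c); rewrite addnK in hb.
have e1 := fact_asc M s; rewrite hM fact_asc in e1.
have e2 : (K`! * asc K (a + c) = (M + c)`! * asc (M + c) s)%N.
  by rewrite -!fact_asc; congr _`!; lia.
apply/eqP; rewrite -(eqn_pmul2l (fact_gt0 K)); apply/eqP.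
rewrite [RHS]mulnA e2 -hb.
transitivity ('C(M + c, c) * c`! * (K`! * asc K a) * asc (M + c) s)%N; first by ring.
by rewrite e1; ring.
Qed.

Lemma asc1 N : asc N 1 = N.+1. Proof. by rewrite /asc big_ord1 addn1. Qed.

Lemma asc2 N : asc N 2 = (N.+1 * N.+2)%N.
Proof. by rewrite /asc !big_ord_recr big_ord0 /= mul1n addn1 addn2. Qed.

(** p divides (ay - bx)(ay + bx), hence one factor. In p^2 = (ax + 3by)^2 + 3(ay - bx)^2, or its
    companion with opposite signs, a nonzero square of a multiple of p would make the right side at
    least 3p^2; so that factor is 0, and a^2 y^2 = b^2 x^2. *)
Lemma sum_sq_3sq_unique (p : nat) (a b x y : int) : prime p ->
  p%:Z = a ^+ 2 + 3 * b ^+ 2 -> p%:Z = x ^+ 2 + 3 * y ^+ 2 -> a ^+ 2 = x ^+ 2.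
Proof.
move=> p_prime hab hxy.
have p_gt0 : 0 < p%:Z by rewrite ltz_nat prime_gt0.
have small (c d : int) : p%:Z ^+ 2 = c ^+ 2 + 3 * d ^+ 2 -> (p%:Z %| d)%Z -> d = 0.
  move=> hcd /dvdzP[k hk]; rewrite hk in hcd *.
  have [->|k0] := eqVneq k 0; first by rewrite mul0r.
  have k1 : 1 <= k ^+ 2 by rewrite -gtz0_ge1 exprn_even_gt0.
  have := sqr_ge0 c; have := ler_wpM2r (sqr_ge0 p%:Z) k1; have := exprn_gt0 2 p_gt0.
  have -> : c ^+ 2 = p%:Z ^+ 2 - 3 * (k ^+ 2 * p%:Z ^+ 2)
    by apply: (lincomb1 (c1 := -1) hcd); ring.
  by move: (p%:Z ^+ 2) (k ^+ 2 * _) => u v; lia.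
have hprod : (a * y - b * x) * (a * y + b * x) = p%:Z * (y ^+ 2 - b ^+ 2).
  by rewrite mulrBr {1}hab hxy; ring.
have hz : (a * y - b * x) * (a * y + b * x) = 0.
  have : (p%:Z %| (a * y - b * x) * (a * y + b * x))%Z by rewrite hprod dvdz_mulr.
  rewrite dvdzE abszM Euclid_dvdM // -!dvdzE => /orP[] h.
    rewrite (small (a * x + 3 * b * y) _ _ h) ?mul0r //.
    by rewrite expr2 {1}hab hxy; ring.
  rewrite (small (a * x - 3 * b * y) _ _ h) ?mulr0 //.
  by rewrite expr2 {1}hab hxy; ring.
apply: (mulfI (lt0r_neq0 p_gt0)).
rewrite [in LHS]hxy [in RHS]hab.
apply: (lincomb1 (c1 := 3) hz); ring.
Qed.

(** * Harmonic sums modulo the cube of a prime *)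

Section ModPrimeCube.

Variables (R : comUnitRingType) (p : nat).
Hypotheses (p_prime : prime p) (p_gt3 : (3 < p)%N).
Hypothesis P3 : (p%:R : R) ^+ 3 = 0.
Hypothesis unitN : forall k, ~~ (p %| k)%N -> (k%:R : R) \is a GRing.unit.
Hypothesis injR : forall z : int, z%:~R = 0 :> R -> (p%:Z ^+ 3 %| z)%Z.

Local Notation P := (p%:R : R).

Lemma unit_lt k : (0 < k < p)%N -> (k%:R : R) \is a GRing.unit.
Proof. by case/andP=> k0 kp; rewrite unitN // gtnNdvd. Qed.

Lemma unitS_lt k : (k.+1 < p)%N -> (k.+1%:R : R) \is a GRing.unit.
Proof. by move=> kp; rewrite unit_lt. Qed.

Lemma unit2 : (2 : R) \is a GRing.unit.
Proof. by rewrite unit_lt //; lia. Qed.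

Lemma unit3 : (3 : R) \is a GRing.unit.
Proof. by rewrite unit_lt //; lia. Qed.

Lemma unit36 : (36 : R) \is a GRing.unit.
Proof. by rewrite (_ : 36 = (2 * 3) * (2 * 3)) ?unitrM ?unit2 ?unit3 //; ring. Qed.

(* P = 36 w, and P = 72 v below, keep integral coefficients in all expansions. *)
Definition w : R := p%:R / 36.

Lemma Pw : P = 36 * w. Proof. by rewrite mulrC divrK // unit36. Qed.

Lemma w3 : w ^+ 3 = 0. Proof. by rewrite expr_div_n P3 mul0r. Qed.

Lemma w2_eq0 x : P ^+ 2 * x = 0 -> w ^+ 2 * x = 0.
Proof.
move=> h; apply: (mulrI (unitrX 2 unit36)); rewrite mulr0 mulrA -exprMn -Pw.
exact: h.
Qed.

(** The second elementary symmetric function is half of the squared sum minus the sum of squares,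
    and 648 = 36^2 / 2. *)
Lemma prod_expand n (f : nat -> R) :
  \prod_(i < n) (1 + 36 * w * f i) =
  1 + 36 * w * \sum_(i < n) f i +
    648 * w ^+ 2 * ((\sum_(i < n) f i) ^+ 2 - \sum_(i < n) f i ^+ 2).
Proof.
elim: n => [|n IHn]; first by rewrite !big_ord0; ring.
rewrite !big_ord_recr /= {}IHn; move: (\sum_(i < n) f i) (\sum_(i < n) _ ^+ _) => s1 s2.
ring: w3.
Qed.

Lemma P2P : P ^+ 2 * P = 0. Proof. by rewrite -exprSr P3. Qed.

Lemma P2_invDp k : (0 < k < p)%N ->
  P ^+ 2 * ((p + k)%:R : R)^-1 = P ^+ 2 * k%:R^-1.
Proof.
move=> kp; have uk := unit_lt kp.
have upk : ((p + k)%:R : R) \is a GRing.unit.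
  by rewrite unitN // dvdn_addr // gtnNdvd; lia.
by apply: eq_divr; rewrite // natrD mulrDr P2P add0r.
Qed.

Lemma subP_inv k : (0 < k < p)%N ->
  ((p - k)%:R : R)^-1 =
  - (k%:R^-1 + P * k%:R ^- 2 + P ^+ 2 * k%:R ^- 3).
Proof.
move=> kp; have uk := unit_lt kp.
have upk : ((p - k)%:R : R) \is a GRing.unit by rewrite unit_lt //; lia.
apply: (mulrI upk); rewrite mulrV // natrB; last by lia.
rewrite -!exprVn; have := mulrV uk; move: (_^-1) => v hv.
by ring: hv P3.
Qed.

Definition H n : R := \sum_(i < n) i.+1%:R^-1.
Definition H2 n : R := \sum_(i < n) i.+1%:R ^- 2.

Lemma sum_inv_refl n : (n < p)%N ->
  \sum_(i < n) ((p - i.+1)%:R : R)^-1 =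
   - (H n + P * H2 n + P ^+ 2 * \sum_(i < n) i.+1%:R ^- 3).
Proof.
move=> np; rewrite /H /H2 !mulr_sumr -!big_split -sumrN /=.
by apply: eq_bigr => i _; rewrite subP_inv //; have := ltn_ord i; lia.
Qed.

Lemma sum_inv2_refl n : (n < p)%N ->
  P ^+ 2 * \sum_(i < n) ((p - i.+1)%:R : R) ^- 2 = P ^+ 2 * H2 n.
Proof.
move=> np; rewrite /H2 !mulr_sumr; apply: eq_bigr => i _.
rewrite -!exprVn subP_inv; last by have := ltn_ord i; lia.
rewrite -!exprVn; move: (_^-1) => v; ring: P3.
Qed.

Lemma H2_split_refl N m : (N + m)%N = p.-1 ->
  P ^+ 2 * H2 p.-1 = P ^+ 2 * H2 N + P ^+ 2 * H2 m.
Proof.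
move=> hNm; rewrite -[in RHS](@sum_inv2_refl m) ?[in LHS]/H2; last by lia.
rewrite -hNm (big_split_rev _ (fun i => i.+1%:R ^- 2)) mulrDr; congr (_ + _ * _).
apply: eq_bigr => i _; congr (_%:R ^- 2); have := ltn_ord i; lia.
Qed.

Lemma H_split_refl N m : (N + m)%N = p.-1 ->
  H p.-1 = H N - (H m + P * H2 m + P ^+ 2 * \sum_(i < m) i.+1%:R ^- 3).
Proof.
move=> hNm; rewrite -(@sum_inv_refl m) ?[in LHS]/H; last by lia.
rewrite -hNm (big_split_rev _ (fun i => i.+1%:R^-1)); congr (_ + _).
apply: eq_bigr => i _; congr (_%:R ^-1); have := ltn_ord i; lia.
Qed.

Local Notation b := (p./2).

Lemma p_odd : odd p.
Proof. by case: (even_prime p_prime) => // p2; move: p_gt3; rewrite p2. Qed.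

Lemma p_half : p = (2 * b + 1)%N.
Proof. by rewrite -[LHS]odd_double_half p_odd; lia. Qed.

Lemma pred_p_half : p.-1 = (b + b)%N.
Proof. by rewrite {1}p_half; lia. Qed.

(** Doubling permutes the nonzero residues, so the sum is 4 times itself modulo p: an even 2i + 2 is
    the double of i + 1, and an odd 2i + 1 is modulo p the double of b + i + 1. As p > 3, the
    resulting factor 3 cancels. *)
Lemma H2_full : P ^+ 2 * H2 p.-1 = 0.
Proof.
have hE : P ^+ 2 * H2 p.-1 = \sum_(i < b) P ^+ 2 * (2 * i).+1%:R ^- 2 +
                            \sum_(i < b) P ^+ 2 * (2 * i + 1).+1%:R ^- 2.
  by rewrite /H2 pred_p_half (big_even_odd _ (fun i => i.+1%:R ^- 2)) mulrDr !mulr_sumr.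
have h4 : P ^+ 2 * H2 p.-1 = 4 * (P ^+ 2 * H2 p.-1).
  rewrite [in RHS]hE /H2 mulr_sumr pred_p_half big_split_ord /= mulrDr addrC !mulr_sumr.
  have hb := p_half.
  congr (_ + _); apply: eq_bigr => i _; have ib := ltn_ord i; rewrite -!exprVn.
    have hx : P ^+ 2 * (b + i).+1%:R^-1 = 2 * P ^+ 2 * (2 * i).+1%:R^-1.
      have := P2_invDp (k := (2 * i).+1).
      rewrite (_ : (p + (2 * i).+1)%N = ((b + i).+1 * 2)%N); last by lia.
      rewrite natrM invrM; [|by rewrite unitS_lt; lia|exact: unit2].
      by move=> h; rewrite -[RHS]mulrA -h; [rewrite mulrCA mulVKr ?unit2|lia].
    by move: (_^-1) (_^-1) hx => x y hx; ring: hx.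
  have hx : i.+1%:R^-1 = 2 * (2 * i + 1).+1%:R^-1 :> R.
    rewrite (_ : (2 * i + 1).+1 = (i.+1 * 2)%N); last by lia.
    by rewrite natrM invrM ?mulVKr ?unit2 // unitS_lt; lia.
  by rewrite hx; ring.
have : 3 * (P ^+ 2 * H2 p.-1) = 4 * (P ^+ 2 * H2 p.-1) - P ^+ 2 * H2 p.-1 by ring.
rewrite -h4 subrr.
by move=> h; apply: (mulrI unit3); rewrite h mulr0.
Qed.

Lemma H2_refl N m : (N + m)%N = p.-1 -> P ^+ 2 * H2 N = - (P ^+ 2 * H2 m).
Proof. by move=> /H2_split_refl; rewrite H2_full => /esym/eqP; rewrite addr_eq0 => /eqP. Qed.

Lemma H2_half : P ^+ 2 * H2 b = 0.
Proof.
apply: (mulrI unit2); rewrite mulr0 mulr_natl mulr2n.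
by rewrite {1}(H2_refl (esym pred_p_half)) addNr.
Qed.

(** Wolstenholme: pairing i with p - i expresses twice the sum through p times the sum of inverse
    squares. *)
Lemma H_full : P * H p.-1 = 0.
Proof.
have h0 : (0 + p.-1)%N = p.-1 by [].
have := H_split_refl h0; rewrite {2}/H big_ord0 sub0r.
move: (\sum_(i < _) _) => S h; apply: (mulrI unit2).
have -> : 2 * (P * H p.-1) = P * (H p.-1 + H p.-1) by ring.
have := H2_full; rewrite [X in X + _]h; move: (H2 _) (H _) => h2 h1 h20.
by ring: P3 h20.
Qed.

Lemma H_refl N m : (N + m)%N = p.-1 -> P * H N = P * H m + P ^+ 2 * H2 m.
Proof.
move=> /H_split_refl; move: (\sum_(i < _) _) => S h.
have := H_full; rewrite h => h1.
by rewrite -[LHS]subr0 -h1; ring: P3.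
Qed.

(** * Fermat quotients of 2 and 3 as harmonic sums *)

Lemma prodS_unit n : (n < p)%N -> \prod_(i < n) i.+1%:R \is a (@GRing.unit R).
Proof.
elim: n => [|n IHn] np; first by rewrite big_ord0 unitr1.
by rewrite big_ord_recr /= unitrM unitS_lt // IHn // ltnW.
Qed.

(** Multiply by (p-1)! and compare with the product of the even numbers up to 2(p-1): those below p
    are the even factors of (p-1)!, and the others are p + (2i+1). *)
Lemma pow2_prod :
  (2 : R) ^+ p.-1 = \prod_(i < b) (1 + 36 * w * (2 * i + 1)%:R^-1).
Proof.
have hb := p_half; pose F : R := \prod_(i < b + b) i.+1%:R.
have uF : F \is a GRing.unit by rewrite prodS_unit //; lia.
apply: (mulIr uF); transitivity (\prod_(i < b + b) (2 * i.+1%:R) : R).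
  by rewrite big_split /= prodr_const card_ord [in LHS]pred_p_half.
rewrite big_split_ord /= /F.
rewrite (big_even_odd _ (fun i => i.+1%:R)) mulrA [RHS]mulrC.
congr (_ * _); last rewrite -big_split /=;
  apply: eq_bigr => i _; have ib := ltn_ord i.
  by rewrite -natrM; congr _%:R; lia.
have u : ((2 * i).+1%:R : R) \is a GRing.unit by rewrite unitS_lt; lia.
rewrite addn1 [RHS]mulrDl mulrVK // mul1r -Pw -natrM -natrD.
by congr _%:R; lia.
Qed.

Lemma H_double k : (k < p)%N -> H k = 2 * \sum_(i < k) (2 * i.+1)%:R^-1.
Proof.
move=> kp; rewrite /H mulr_sumr; apply: eq_bigr => i _; have ik := ltn_ord i.
by rewrite mulnC natrM invrM ?mulVKr ?unit2 // unitS_lt; lia.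
Qed.

Lemma H2_double k : (k < p)%N ->
  H2 k = 2 ^+ 2 * \sum_(i < k) (2 * i.+1)%:R ^- 2.
Proof.
move=> kp; rewrite /H2 mulr_sumr; apply: eq_bigr => i _; have ik := ltn_ord i.
rewrite -!exprVn -exprMn mulnC natrM invrM ?mulVKr ?unit2 // unitS_lt; lia.
Qed.

Lemma sum_odd_rev n r (F : nat -> R) : (n + r)%N = b ->
  \sum_(i < n) F (2 * i + 1)%N =
  \sum_(i < b) F (p - 2 * i.+1)%N - \sum_(i < r) F (p - 2 * i.+1)%N.
Proof.
have hb := p_half; move=> hn.
have <- : \sum_(i < r + n) F (p - 2 * i.+1)%N = \sum_(i < b) F (p - 2 * i.+1)%N.
  by rewrite addnC hn.
rewrite big_split_ord /= addrAC subrr add0r.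
rewrite (reindex_inj rev_ord_inj) /=; apply: eq_bigr => i _; congr F.
by have := ltn_ord i; lia.
Qed.

Lemma w2_sum_odd_inv2 : w ^+ 2 * \sum_(i < b) (2 * i + 1)%:R^-1 ^+ 2 = 0.
Proof.
have hb := p_half; apply: w2_eq0.
rewrite (sum_odd_rev (fun i => i%:R^-1 ^+ 2) (addn0 b)) big_ord0 subr0.
transitivity (P ^+ 2 * \sum_(i < b) (2 * i.+1)%:R ^- 2).
  rewrite !mulr_sumr; apply: eq_bigr => i _; have ib := ltn_ord i.
  rewrite subP_inv; last by lia.
  by rewrite -!exprVn; move: (_^-1) => v; ring: P3.
apply: (mulrI (unitrX 2 unit2)); rewrite mulr0 -[RHS]H2_half mulrCA.
by rewrite H2_double //; lia.
Qed.

(** [pow2_prod] writes 1 + Pq through odd reciprocals, which i -> p - i turns into even ones, that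
    is, into half of H b. Solving for H b to second order gives the claim. *)
Lemma P_H_half (q : R) : 2 ^+ p.-1 = 1 + P * q ->
  P * H b = - 2 * P * q + P ^+ 2 * q ^+ 2.
Proof.
have hb := p_half.
pose V : R := \sum_(i < b) (2 * i.+1)%:R^-1.
pose V2 : R := \sum_(i < b) (2 * i.+1)%:R ^- 2.
have hV : H b = 2 * V by rewrite H_double //; lia.
have hV2 : P ^+ 2 * V2 = 0.
  apply: (mulrI (unitrX 2 unit2)); rewrite mulr0 -[RHS]H2_half mulrCA.
  by rewrite H2_double //; lia.
pose O : R := \sum_(i < b) (2 * i + 1)%:R^-1.
have [S hO] : exists S, O = - (V + P * V2 + P ^+ 2 * S).
  exists (\sum_(i < b) (2 * i.+1)%:R ^- 3).
  rewrite /O (sum_odd_rev (fun i =>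
    i%:R^-1) (addn0 b)) big_ord0 subr0 /V /V2 !mulr_sumr -!big_split -sumrN /=.
  by apply: eq_bigr => i _; rewrite subP_inv //; have := ltn_ord i; lia.
rewrite pow2_prod (prod_expand _ (fun i => (2 * i + 1)%:R^-1)) -/O hV.
have := w2_sum_odd_inv2; move: hV2; set O2 := \sum_(i < b) _ => /w2_eq0 hV2 hO2.
have -> : 1 + 36 * w * O + 648 * w ^+ 2 * (O ^+ 2 - O2) =
          1 + (36 * w * O + 648 * w ^+ 2 * O ^+ 2) by ring: hO2.
move/addrI => h.
have {}h : w * q = - (w * V) + 18 * w ^+ 2 * V ^+ 2.
  apply: (mulrI unit36); rewrite mulrA -Pw -h hO Pw; ring: w3 hV2.
by rewrite Pw; ring: w3 h.
Qed.

(* Split H (m + b - r) by parity and reflect i |-> p - i, noting that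
   p - 1 - (m + b - r) = m. *)
Lemma H_third_sixth (m r : nat) :
  (p = 6 * r + 1 /\ m = 2 * r \/ p = 6 * r + 5 /\ m = 2 * r + 1)%N ->
  w ^+ 2 * H2 r = 5 * w ^+ 2 * H2 m /\
  w * H r = w * H m + w * H b - 18 * w ^+ 2 * H2 m.
Proof.
have hb := p_half; move=> hmr; pose n := (b - r)%N; pose N := (m + n)%N.
have splitN (F : nat -> R) : \sum_(i < N) F i.+1 =
    \sum_(i < m) F (2 * i.+1)%N + \sum_(i < n) F (2 * i + 1)%N.
  have even_odd k : \sum_(i < k + k) F i.+1 =
    \sum_(i < k) F (2 * i.+1)%N + \sum_(i < k) F (2 * i + 1)%N.
    rewrite (big_even_odd _ (fun i => F i.+1)) addrC; congr (_ + _);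
      by apply: eq_bigr => i _; congr F; lia.
  case: hmr => [] [hp hm]; rewrite /N (_ : n = (b - r)%N) //.
    by rewrite (_ : (b - r)%N = m) ?even_odd //; lia.
  rewrite (_ : (b - r)%N = m.+1); last by lia.
  by rewrite addnS !big_ord_recr /= even_odd -addrA; congr (_ + (_ + F _)); lia.
have hm : (m <= b)%N by case: hmr => [] [? ?]; lia.
have hr : (r <= b)%N by case: hmr => [] [? ?]; lia.
have hnr : (n + r)%N = b by rewrite /n; lia.
have hNm : (N + m)%N = p.-1 by rewrite /N /n; case: hmr => [] [? ?]; lia.
pose V k : R := \sum_(i < k) (2 * i.+1)%:R^-1.
pose V2 k : R := \sum_(i < k) (2 * i.+1)%:R ^- 2.
pose V3 k : R := \sum_(i < k) (2 * i.+1)%:R ^- 3.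
have invV k : (k <= b)%N -> \sum_(i < k) ((p - 2 * i.+1)%:R : R)^-1 =
    - (V k + P * V2 k + P ^+ 2 * V3 k).
  move=> kb; rewrite !mulr_sumr -!big_split -sumrN /=.
  by apply: eq_bigr => i _; rewrite subP_inv //; have := ltn_ord i; lia.
have invV2 k : (k <= b)%N ->
    P ^+ 2 * \sum_(i < k) ((p - 2 * i.+1)%:R : R) ^- 2 = P ^+ 2 * V2 k.
  move=> kb; rewrite !mulr_sumr; apply: eq_bigr => i _.
  rewrite -!exprVn subP_inv; last by have := ltn_ord i; lia.
  by rewrite -!exprVn; move: (_^-1) => v; ring: P3.
have := H_refl hNm; have := H2_refl hNm; have := H2_half.
have hN : H N = V m - (V b + P * V2 b + P ^+ 2 * V3 b)
                + (V r + P * V2 r + P ^+ 2 * V3 r).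
  rewrite [LHS](splitN (fun i => i%:R^-1)).
  by rewrite (sum_odd_rev (fun i => i%:R^-1) hnr) !invV // opprK addrA.
have hN2 : P ^+ 2 * H2 N = P ^+ 2 * (V2 m + V2 b - V2 r).
  rewrite [H2 N](splitN (fun i => i%:R ^- 2)).
  rewrite (sum_odd_rev (fun i => i%:R ^- 2) hnr) mulrDr mulrBr !invV2 //.
  by rewrite -mulrBr -mulrDr addrA.
rewrite hN hN2 !H_double ?H2_double; [|lia..].
rewrite -!/(V _) -!/(V2 _) !Pw.
move: (V m) (V b) (V r) (V2 m) (V2 b) (V2 r) => vm vb vr v2m v2b v2r.
have u36 := unit36; have u2 := unit2 => h1 h2 h3.
have {}h1 : w ^+ 2 * v2b = 0.
  have u : (36 ^+ 2 * 2 ^+ 2 : R) \is a GRing.unit by rewrite unitrM !unitrX.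
  by apply: (mulrI u); rewrite mulr0 -h1; ring.
have {}h2 : w ^+ 2 * v2r = 5 * w ^+ 2 * v2m.
  apply: (mulrI (unitrX 2 u36)); apply/eqP; rewrite -subr_eq0; apply/eqP.
  rewrite -[RHS](subrr (- ((36 * w) ^+ 2 * (2 ^+ 2 * v2m)))) -{2}h2.
  by ring: h1.
have {}h3 : w * vr = w * vm + w * vb + 36 * w ^+ 2 * (v2b - v2r) + 4 * 36 * w ^+ 2 * v2m.
  apply: (mulrI u36); apply/eqP; rewrite -subr_eq0; apply/eqP.
  rewrite -[RHS](subrr (36 * w * (2 * vm) + (36 * w) ^+ 2 * (2 ^+ 2 * v2m))) -{1}h3.
  by ring: w3.
split; first by ring: h2.
by apply: (lincomb3 (c1 := 72) (c2 := - 72) (c3 := 2) h1 h2 h3); ring.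
Qed.

Lemma big_mod3 m (V : Type) (idx : V) (op : Monoid.com_law idx) (f : nat -> V) :
  \big[op/idx]_(i < 3 * m + 1) f i =
  op (op (\big[op/idx]_(i < m.+1) f (3 * i)%N) (\big[op/idx]_(i < m) f (3 * i + 1)%N))
     (\big[op/idx]_(i < m) f (3 * i + 2)%N).
Proof.
elim: m => [|m IHm]; first by rewrite !big_ord_recr !big_ord0 /= !Monoid.mulm1.
rewrite (_ : (3 * m.+1 + 1 = (3 * m + 1).+3)%N); last by lia.
have rec n g : \big[op/idx]_(i < n.+1) g (i : nat) = op (\big[op/idx]_(i < n) g (i : nat)) (g n).
  exact: big_ord_recr.
rewrite !rec {}IHm (rec m.+1 (fun i => f (3 * i)%N)).
rewrite (rec m (fun i => f (3 * i + 1)%N)) (rec m (fun i => f (3 * i + 2)%N)).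
have -> : (3 * m + 1).+1 = (3 * m + 2)%N by lia.
have -> : (3 * m + 2).+1 = (3 * m.+1)%N by lia.
move: (\big[op/idx]_(i < m.+1) _) (\big[op/idx]_(i < m) _) (\big[op/idx]_(i < m) _).
move: (f _) (f _) (f _) => u v s x y z.
rewrite -!Monoid.mulmA; congr (op _ _).
rewrite [RHS]Monoid.mulmCA; congr (op _ _).
by rewrite [RHS]Monoid.mulmC -!Monoid.mulmA [RHS]Monoid.mulmCA.
Qed.

(** Multiply by (p-1)!. Among the multiples of 3 up to 3(p-1), m lie below p, m + 1 have the form p
    + (3i+1), and m the form 2p + (3i+2). *)
Lemma pow3_prod m : p = (3 * m + 2)%N ->
  (3 : R) ^+ p.-1 = \prod_(i < m.+1) (1 + 36 * w * (3 * i + 1)%:R^-1) *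
                    \prod_(i < m) (1 + 36 * w * (2 * (3 * i + 2)%:R^-1)).
Proof.
move=> hp; pose F : R := \prod_(i < 3 * m + 1) i.+1%:R.
have uF : F \is a GRing.unit by rewrite prodS_unit //; lia.
apply: (mulIr uF); transitivity (\prod_(i < m + (m.+1 + m)) (3 * i.+1%:R) : R).
  rewrite big_split /= prodr_const card_ord /F.
  have -> : p.-1 = (m + (m.+1 + m))%N by lia.
  by have -> : (3 * m + 1 = m + (m.+1 + m))%N by lia.
rewrite !big_split_ord /= /F (big_mod3 _ _ (fun i => i.+1%:R)) /=.
have -> : forall a b c d e : R, a * b * (c * d * e) = e * ((a * c) * (b * d)).
  by move=> *; ring.
rewrite -!big_split /=; congr (_ * (_ * _)); apply: eq_bigr => i _; have im := ltn_ord i.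
- by rewrite -natrM; congr _%:R; lia.
- have u : ((3 * i).+1%:R : R) \is a GRing.unit by rewrite unitS_lt; lia.
  rewrite addn1 [RHS]mulrDl mulrVK // mul1r -Pw -natrM -natrD.
  by congr _%:R; lia.
have -> : (3 * i + 1).+1 = (3 * i + 2)%N by lia.
have u : ((3 * i + 2)%:R : R) \is a GRing.unit by rewrite unit_lt; lia.
rewrite [RHS]mulrDl mul1r [_ * (2 / _)]mulrA mulrVK // -Pw -!natrM -natrD.
by congr _%:R; lia.
Qed.

(** Under i -> p - i the class of 1 modulo 3 is preserved, which determines its reciprocal sum from
    its sum of inverse squares, while the class of 2 is carried to the class of 0. The three sums of
    inverse squares add up to 0 modulo p. *)
Lemma w_H_third m (q : R) : p = (3 * m + 2)%N -> 3 ^+ p.-1 = 1 + P * q ->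
  2 * w * H m = - 3 * w * q + 54 * w ^+ 2 * q ^+ 2 - 24 * w ^+ 2 * H2 m.
Proof.
move=> hp; pose V : R := \sum_(i < m) (3 * i.+1)%:R^-1.
pose V2 : R := \sum_(i < m) (3 * i.+1)%:R ^- 2.
pose V3 : R := \sum_(i < m) (3 * i.+1)%:R ^- 3.
have hV : H m = 3 * V.
  rewrite /H mulr_sumr; apply: eq_bigr => i _; have im := ltn_ord i.
  by rewrite mulnC natrM invrM ?mulVKr ?unit3 // unitS_lt; lia.
have hV2 : H2 m = 9 * V2.
  rewrite (_ : 9 = 3 ^+ 2); last by ring.
  rewrite /H2 mulr_sumr; apply: eq_bigr => i _; have im := ltn_ord i.
  rewrite -!exprVn -exprMn mulnC natrM invrM ?mulVKr ?unit3 // unitS_lt; lia.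
pose S1 : R := \sum_(i < m.+1) (3 * i + 1)%:R^-1.
pose S2 : R := \sum_(i < m) (3 * i + 2)%:R^-1.
pose Q1 : R := \sum_(i < m.+1) (3 * i + 1)%:R^-1 ^+ 2.
pose Q2 : R := \sum_(i < m) (3 * i + 2)%:R^-1 ^+ 2.
have rev1 (f : nat -> R) :
    \sum_(i < m.+1) f (3 * i + 1)%N = \sum_(i < m.+1) f (p - (3 * i + 1))%N.
  rewrite (reindex_inj rev_ord_inj) /=; apply: eq_bigr => i _; congr f.
  have := ltn_ord i; lia.
have rev2 (f : nat -> R) :
    \sum_(i < m) f (3 * i + 2)%N = \sum_(i < m) f (p - 3 * i.+1)%N.
  rewrite (reindex_inj rev_ord_inj) /=; apply: eq_bigr => i _; congr f.
  have := ltn_ord i; lia.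
have hS2 : S2 = - (V + P * V2 + P ^+ 2 * V3).
  rewrite /S2 (rev2 (fun i => i%:R^-1)) /V /V2 !mulr_sumr -!big_split -sumrN /=.
  by apply: eq_bigr => i _; rewrite subP_inv //; have := ltn_ord i; lia.
have hQ2 : P ^+ 2 * Q2 = P ^+ 2 * V2.
  rewrite /Q2 (rev2 (fun i => i%:R^-1 ^+ 2)) /V2 !mulr_sumr.
  apply: eq_bigr => i _; rewrite subP_inv; last by have := ltn_ord i; lia.
  by rewrite -!exprVn; move: (_^-1) => v; ring: P3.
have hS1 : P * S1 = - (P * S1) - P ^+ 2 * Q1.
  rewrite {1}/S1 (rev1 (fun i => i%:R^-1)) /S1 /Q1 !mulr_sumr -!sumrN -big_split /=.
  apply: eq_bigr => i _; rewrite subP_inv; last by have := ltn_ord i; lia.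
  by rewrite -!exprVn; move: (_^-1) => v; ring: P3.
have hQ : P ^+ 2 * (V2 + Q1 + Q2) = 0.
  rewrite -[RHS]H2_full; congr (_ * _).
  have -> : p.-1 = (3 * m + 1)%N by lia.
  rewrite /H2 (big_mod3 _ _ (fun i => i.+1%:R ^- 2)) -addrA addrC -!addrA /=.
  rewrite addrA; congr (_ + _ + _); apply: eq_bigr => i _; rewrite ?exprVn.
  - by rewrite addn1.
  - by congr (_%:R ^- _); lia.
  by congr (_%:R ^- _); lia.
have {}hQ2 : w ^+ 2 * (Q2 - V2) = 0.
  by apply: w2_eq0; rewrite mulrBr hQ2 subrr.
have {}hQ : w ^+ 2 * (Q1 + 2 * V2) = 0.
  rewrite -[RHS](w2_eq0 hQ); apply: (lincomb1 (c1 := -1) hQ2); ring.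
have {}hS1 : w * S1 = 36 * w ^+ 2 * V2.
  have u : (2 * 36 : R) \is a GRing.unit by rewrite unitrM unit2 unit36.
  apply: (mulrI u); apply: (lincomb2 (c1 := 1) (c2 := - 36 ^+ 2) hS1 hQ).
  by rewrite Pw; ring.
rewrite (pow3_prod hp) (prod_expand _ (fun i => (3 * i + 1)%:R^-1)).
rewrite (prod_expand _ (fun i => 2 * (3 * i + 2)%:R^-1)) -/S1 -/Q1 -mulr_sumr -/S2.
have -> : \sum_(i < m) (2 / (3 * i + 2)%:R : R) ^+ 2 = 4 * Q2.
  by rewrite mulr_sumr; apply: eq_bigr => i _; rewrite exprMn; congr (_ * _); ring.
move=> hq; have {}hq : w * q = - 2 * w * V + 72 * w ^+ 2 * V ^+ 2 - 72 * w ^+ 2 * V2.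
  apply: (mulrI unit36).
  have {}hq : 36 * (w * q) = 36 * w * S1 - 648 * w ^+ 2 * Q1 + 72 * w * S2
       + 2592 * w ^+ 2 * (S2 ^+ 2 - Q2).
    apply: (lincomb2 (c1 := - 1) (c2 := 648 * w * S1 + 2592 * w * S2) hq hS1).
    by rewrite Pw; ring: w3.
  have e : w * S2 = - (w * V) - 36 * w ^+ 2 * V2 by rewrite hS2 Pw; ring: w3.
  rewrite hq; have {hq}-> : 36 * w * S1 - 648 * w ^+ 2 * Q1 + 72 * w * S2 +
      2592 * w ^+ 2 * (S2 ^+ 2 - Q2) =
    36 * (w * S1) - 648 * w ^+ 2 * Q1 + 72 * (w * S2) + 2592 * (w * S2) ^+ 2
      - 2592 * w ^+ 2 * Q2 by ring.
  rewrite e; apply: (lincomb3 (c1 := 36) (c2 := -648) (c3 := -2592) hS1 hQ hQ2).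
  by ring: w3.
rewrite hV hV2; apply: (lincomb1 (c1 := 3 - 54 * w * q
   - 54 * (- 2 * w * V + 72 * w ^+ 2 * V ^+ 2 - 72 * w ^+ 2 * V2)) hq).
by ring: w3.
Qed.

Lemma fermat_pred a : ~~ (p %| a)%N -> exists q, (a ^ p.-1 = 1 + p * q)%N.
Proof.
move=> pa; have a0 : (0 < a)%N by case: a pa => //; rewrite dvdn0.
have h : a ^ p.-1 = 1 %[mod p].
  apply/eqP; rewrite eqn_mod_dvd ?expn_gt0 ?a0 //.
  have := fermat_little a p_prime => /eqP.
  rewrite -{1}(prednK (prime_gt0 p_prime)) expnS eqn_mod_dvd; last first.
    by rewrite leq_pmulr // expn_gt0 a0.
  by rewrite -[X in (_ - X)%N]muln1 -mulnBr Gauss_dvdr // prime_coprime.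
exists (a ^ p.-1 %/ p)%N.
by rewrite {1}(divn_eq (a ^ p.-1) p) h modn_small ?prime_gt1 // addnC mulnC.
Qed.

Lemma P2_expr_inv k : (k < p)%N ->
  P ^+ 2 * k%:R ^+ (p - 3) = P ^+ 2 * k%:R ^- 2.
Proof.
(* At 0 both sides vanish, by the convention that 0 is its own inverse; so sums over residue classes
   may include the index 0. *)
case: (posnP k) => [-> _|k0 kp].
  by rewrite !expr0n /= subn_eq0 leqNgt p_gt3 invr0.
have uk : (k%:R : R) \is a GRing.unit by rewrite unit_lt ?k0.
apply: (mulIr (unitrX 2 uk)); rewrite divrK ?unitrX // -mulrA -exprD.
have [|q hq] := @fermat_pred k; first by rewrite gtnNdvd.
have -> : (p - 3 + 2 = p.-1)%N by lia.
by rewrite -[k%:R ^+ _]natrX hq natrD natrM mulrDr mulr1 mulrA P2P mul0r addr0.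
Qed.

(* Here i^-2 = i^(p-3) modulo p, and the power sums over residue classes modulo 6
   telescope through [Upoly_mul6]. *)
Lemma w2_H2_third_U r m : (p = 6 * r + 5)%N -> (m = 2 * r + 1)%N ->
  w ^+ 2 * H2 m = - 3 * w ^+ 2 * (U (p - 3))%:~R.
Proof.
move=> hp hm; pose K := r.+1; pose g (k : nat) : R := k%:R ^- 2.
pose D a := \sum_(i < K) g (6 * i + a)%N.
have g0 : g 0%N = 0 by rewrite /g expr0n invr0.
have hU : P ^+ 2 * ((U (p - 3))%:~R - 2 * (D 3 + D 4 - D 0%N - D 1%N)) = 0.
  have en : ~~ odd (p - 3) by rewrite hp; lia.
  have eU : 2 * Upoly (p - 3) (- 1) = (U (p - 3))%:~R :> R.
    have := UpolyP (p - 3) (0 : R); rewrite add0r sub0r -(UpolyN 1 en) Upoly0.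
    rewrite expr0n subn_eq0 leqNgt p_gt3 /= => /eqP; rewrite subr_eq0 => /eqP <-.
    ring.
  have PU : P ^+ 2 * Upoly (p - 3) P = P ^+ 2 * (U (p - 3))%:~R.
    rewrite -Upoly0 /Upoly !mulr_sumr; apply: eq_bigr => j _.
    rewrite mulrCA [RHS]mulrCA; congr (_ * _).
    by case: (_ - j)%N => [//|k]; rewrite [P ^+ k.+1]exprS mulrA P2P mul0r [0 ^+ _]exprS mul0r
      mulr0.
  have eP : P = - 1 + 6 * K%:R by rewrite hp natrD natrM /K -natr1; ring.
  have := PU; rewrite [X in Upoly _ X]eP Upoly_mul6 mulrDr [_ * \sum_(i < K) _]mulr_sumr.
  have -> : \sum_(i < K) P ^+ 2 * ((6 * i + 3)%:R ^+ (p - 3) + (6 * i + 4)%:R ^+ (p - 3)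
     - (6 * i)%:R ^+ (p - 3) - (6 * i + 1)%:R ^+ (p - 3)) =
     P ^+ 2 * (D 3 + D 4 - D 0%N - D 1%N).
    rewrite /D -big_split -!sumrB mulr_sumr; apply: eq_bigr => i _ /=.
    have iK := ltn_ord i; rewrite !(mulrBr, mulrDr) !P2_expr_inv ?addn0 //; lia.
  by rewrite -eU => h; apply: (lincomb1 (c1 := 2) (esym h)); ring.
(* For p = 6r + 5 the reflection i -> p - i exchanges the classes of 1 and 4 modulo 6. *)
have hD : P ^+ 2 * (D 4 - D 1%N) = 0.
  apply/eqP; rewrite mulrBr subr_eq0; apply/eqP.
  rewrite /D [in LHS](reindex_inj rev_ord_inj) !mulr_sumr; apply: eq_bigr => i _ /=.
  have iK := ltn_ord i; rewrite /g; have -> : (6 * (K - i.+1) + 4 = p - (6 * i + 1))%N.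
    by move: iK; rewrite hp /K; lia.
  rewrite -!exprVn subP_inv; last by lia.
  by rewrite -!exprVn; move: (_^-1) => v; ring: P3.
have hm2 : H2 m = 9 * (D 0%N + D 3).
  transitivity (\sum_(j < K + K) 9 * g (3 * j)%N).
    rewrite (_ : K + K = m.+1)%N; last by lia.
    rewrite big_ord_recl muln0 g0 mulr0 add0r; apply: eq_bigr => i _; have im := ltn_ord i.
    rewrite (_ : 9 = 3 ^+ 2); last by ring.
    rewrite lift0 /g -!exprVn -exprMn natrM invrM ?unit3 ?unitS_lt //; last by lia.
    by rewrite mulrCA mulrV ?mulr1 ?unit3.
  rewrite (big_even_odd _ (fun j => 9 * g (3 * j)%N)) mulrDr /D !mulr_sumr.
  by congr (_ + _); apply: eq_bigr => i _; congr (_ * g _); lia.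
have hr2 : H2 r = 36 * D 0%N.
  rewrite /D big_ord_recl g0 add0r mulr_sumr; apply: eq_bigr => i _; have ir := ltn_ord i.
  rewrite (_ : 36 = 6 ^+ 2); last by ring.
  have u6 : (6 : R) \is a GRing.unit by rewrite (_ : 6 = 2 * 3) ?unitrM ?unit2 ?unit3 //; ring.
  rewrite addn0 lift0 /g -!exprVn -exprMn natrM invrM ?u6 ?unitS_lt //; last by lia.
  by rewrite mulrCA mulrV ?mulr1.
(* [H2 r] gives the class of 0, [H2 m] the classes of 0 and 3 together, and [H2 r] is 5 [H2 m]
   modulo p; so D 3 - D 0 is a multiple of [H2 m]. *)
have [h5 _] := H_third_sixth (or_intror (conj hp hm)).
have {}hU := w2_eq0 hU; have {}hD := w2_eq0 hD.
move: h5; rewrite hm2 hr2 => h5; apply: (mulrI unit3).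
by apply: (lincomb3 (c1 := -1) (c2 := 9) (c3 := 18) h5 hU hD); ring.
Qed.

(** * Evaluation of the truncated sums *)

Lemma cbin4_rec k : (k.+1 < p)%N ->
  cbin4 R k.+1 * (2 * k.+1%:R) = cbin4 R k * (2 * k%:R + 1).
Proof. by move=> kp; rewrite cbin4SE ?unit2 ?unitS_lt. Qed.

Lemma cbin4_unit k : (k <= b)%N -> cbin4 R k \is a GRing.unit.
Proof.
have hb := p_half; elim: k => [|k IHk] kb; first by rewrite cbin40 unitr1.
rewrite cbin4S !unitrM IHk ?unitrV ?unitrM ?unit2 ?unitS_lt; [|lia..].
rewrite (_ : 2 * k%:R + 1 = (2 * k).+1%:R) ?unitS_lt //; [lia|].
by rewrite -[RHS]natr1 natrM.
Qed.

(** C(2k,k)/4^k is (-1)^k C(-1/2,k), and -1/2 = b modulo p; the factor P^2 makes a congruence modulo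
    p sufficient. *)
Lemma P2_cbin4 k : (k < p)%N ->
  P ^+ 2 * cbin4 R k = P ^+ 2 * ((-1) ^+ k * 'C(b, k)%:R).
Proof.
elim: k => [|k IHk] kp; first by rewrite cbin40 bin0 expr0 mul1r.
have u : (2 * k.+1%:R : R) \is a GRing.unit by rewrite unitrM unit2 unitS_lt.
apply: (mulIr u); rewrite -mulrA cbin4_rec // mulrA IHk ?(ltnW kp) //.
have h : k.+1%:R * 'C(b, k.+1)%:R = (b%:R - k%:R) * 'C(b, k)%:R :> R.
  rewrite -natrM mul_bin_left; have [kb|bk] := leqP k b.
    by rewrite natrM natrB.
  by rewrite (@bin_small b k) // muln0 mulr0.
have hP : P = 2 * b%:R + 1 by rewrite {1}p_half natrD natrM.
transitivity (P ^+ 2 * (-1) ^+ k.+1 * 2 * (k.+1%:R * 'C(b, k.+1)%:R)); last by ring.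
rewrite h; transitivity (P ^+ 2 * (-1) ^+ k * 'C(b, k)%:R * (2 * k%:R + 1)); first by ring.
have -> : P ^+ 2 * (-1) ^+ k.+1 * 2 * ((b%:R - k%:R) * 'C(b, k)%:R) =
  (-1) ^+ k * 'C(b, k)%:R * P ^+ 2 * (2 * k%:R + 1 - (2 * b%:R + 1))
  by rewrite [(-1) ^+ k.+1]exprS; ring.
by rewrite -hP; ring: P3.
Qed.

(** With b = (p-1)/2, the numerator factor b - i is -(2i+1)/2 times 1 - p/(2i+1). *)
Lemma bin_cbin4 k : (k <= b)%N ->
  'C(b, k)%:R = (-1) ^+ k * cbin4 R k * \prod_(i < k) (1 - 36 * w / (2 * i + 1)%:R).
Proof.
have hb := p_half.
elim: k => [|k IHk] kb; first by rewrite big_ord0 bin0 cbin40 !mulr1.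
have u : (2 * k.+1%:R : R) \is a GRing.unit by rewrite unitrM unit2 unitS_lt //; lia.
apply: (mulIr u); rewrite big_ord_recr /=.
have h : k.+1%:R * 'C(b, k.+1)%:R = (b%:R - k%:R) * 'C(b, k)%:R :> R.
  by rewrite -natrM mul_bin_left natrM natrB //; lia.
transitivity (2 * (k.+1%:R * 'C(b, k.+1)%:R) : R); first by ring.
rewrite h IHk; last by lia.
set X := \prod_(i < k) _.
transitivity ((-1) ^+ k.+1 * (cbin4 R k.+1 * (2 * k.+1%:R)) * X *
  (1 - 36 * w / (2 * k + 1)%:R)); last by ring.
rewrite cbin4_rec; last by lia.
have u' : ((2 * k + 1)%:R : R) \is a GRing.unit by rewrite unit_lt //; lia.
rewrite -Pw; have -> : 2 * k%:R + 1 = (2 * k + 1)%:R :> R by rewrite natrD natrM.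
transitivity ((-1) ^+ k.+1 * cbin4 R k * X * ((2 * k + 1)%:R - P / (2 * k + 1)%:R * (2 * k +
  1)%:R)); last by ring.
rewrite mulrVK // [(-1) ^+ k.+1]exprS.
rewrite (_ : (2 * k + 1)%:R - P = - 2 * (b%:R - k%:R)); first by ring.
have -> : P = 2 * b%:R + 1 by rewrite {1}p_half natrD natrM.
by rewrite natrD natrM; ring.
Qed.

(** The square of Morley's congruence for C(p-1, b). At k = b the binomial of [bin_cbin4] is 1, and
    the product of the 1 - p/(2i+1) inverts that of the 1 + p/(2i+1), which is 2^(p-1), because the
    inverse squares of the odd numbers sum to 0 modulo p. *)
Lemma cbin4_half : cbin4 R b ^+ 2 = (2 ^+ p.-1) ^+ 2.
Proof.
have := bin_cbin4 (leqnn b); rewrite binn.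
set X := \prod_(i < b) _ => hX.
have : X * 2 ^+ p.-1 = 1.
  rewrite pow2_prod (prod_expand _ (fun i => (2 * i + 1)%:R^-1)).
  have -> : X = \prod_(i < b) (1 + 36 * w * - (2 * i + 1)%:R^-1).
    by apply: eq_bigr => i _; ring.
  rewrite (prod_expand _ (fun i => - (2 * i + 1)%:R^-1)) sumrN.
  have -> : \sum_(i < b) (- (2 * i + 1)%:R^-1) ^+ 2 = \sum_(i < b) (2 * i + 1)%:R^-1 ^+ 2 :> R.
    by apply: eq_bigr => i _; rewrite sqrrN.
  have := w2_sum_odd_inv2.
  move: (\sum_(i < b) (2 * i + 1)%:R^-1 ^+ 2) (\sum_(i < b) (2 * i + 1)%:R^-1) => o2 o h.
  by apply: (lincomb1 (c1 := - 1296) h); ring: w3.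
move=> hXY; have -> : cbin4 R b = (-1) ^+ b * 2 ^+ p.-1.
  transitivity ((-1) ^+ b * ((-1) ^+ b * cbin4 R b * X) * 2 ^+ p.-1); last by rewrite -hX mulr1.
  by rewrite !mulrA -expr2 sqrr_sign mul1r -mulrA hXY mulr1.
by rewrite exprMn sqrr_sign mul1r.
Qed.

(** * Alternating binomial sums and truncated sums near 0 *)

Definition altbin e n : R :=
  \sum_(k < n) (-1) ^+ k.+1 * 'C(n, k.+1)%:R * k.+1%:R^-1 ^+ e.

Lemma altbinS e n : (n.+1 < p)%N ->
  altbin e.+1 n.+1 = altbin e.+1 n + altbin e n.+1 / n.+1%:R.
Proof.
move=> np; have -> : altbin e.+1 n =
    \sum_(k < n.+1) (-1) ^+ k.+1 * 'C(n, k.+1)%:R * k.+1%:R^-1 ^+ e.+1.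
  by rewrite big_ord_recr /= (@bin_small n n.+1) // mulr0 mul0r addr0.
rewrite /altbin mulr_suml -big_split /=; apply: eq_bigr => k _; have kn := ltn_ord k.
have hC : 'C(n.+1, k.+1)%:R = 'C(n, k.+1)%:R + 'C(n, k)%:R :> R by rewrite binS natrD.
rewrite [in LHS]hC mulrDr [LHS]mulrDl {hC}; congr (_ + _); rewrite [_^-1 ^+ e.+1]exprSr mulrA.
have uk : (k.+1%:R : R) \is a GRing.unit by rewrite unitS_lt; lia.
apply: eq_divr => //; first by rewrite unitS_lt.
have := mul_bin_diag n.+1 k; rewrite succnK => /(congr1 (fun i : nat => i%:R : R)).
rewrite !natrM => h; transitivity ((-1) ^+ k.+1 * k.+1%:R^-1 ^+ e * (n.+1%:R * 'C(n, k)%:R) : R).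
  by ring.
by rewrite h; ring.
Qed.

Lemma altbin0 n : altbin 0 n.+1 = -1.
Proof.
have := exprDn (1 : R) (-1) n.+1; rewrite subrr expr0n big_ord_recl /=.
rewrite bin0 expr0 expr1n mulr1 mulr1n => /esym/eqP; rewrite addrC addr_eq0 => /eqP <-.
apply: eq_bigr => i _.
by rewrite expr0 mulr1 expr1n mul1r mulr_natr.
Qed.

Lemma altbin1 n : (n < p)%N -> altbin 1 n = - H n.
Proof.
elim: n => [|n IHn] np; first by rewrite /altbin /H !big_ord0 oppr0.
rewrite altbinS // altbin0 IHn; last by lia.
by rewrite /H big_ord_recr /= opprD mulN1r.
Qed.

Lemma altbin2 n : (n < p)%N -> 2 * altbin 2 n = - (H n ^+ 2 + H2 n).
Proof.
elim: n => [|n IHn] np; first by rewrite /altbin /H /H2 !big_ord0; ring.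
rewrite altbinS // altbin1 // mulrDr IHn; last by lia.
rewrite /H /H2 !big_ord_recr /= -!exprVn; move: (n.+1%:R^-1) => v.
by move: (\sum_(i < n) _) (\sum_(i < n) _) => x y; ring.
Qed.

(** The factor i = 0 is -y, and the others are i/(i+1) times 1 - y/(i(i+1)). To first order the
    latter multiply to 1 - y(1 - 1/(k+1)), since 1/(i(i+1)) telescopes. *)
Lemma legc_small (y a : R) k : y = a * (a + 1) -> y ^+ 3 = 0 -> (k.+1 < p)%N ->
  legc a k.+1 = - y / k.+1%:R + y ^+ 2 * (k.+1%:R^-1 - k.+1%:R ^- 2).
Proof.
move=> hy y3; elim: k => [|k IHk] kp.
  by rewrite legcS legc0 expr1n invr1 hy; ring.
rewrite legcS IHk; last by lia.
have hn := mulrV (unitS_lt (ltnW kp)); have hn1 := mulrV (unitS_lt kp).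
rewrite -!exprVn; move: (k.+1%:R^-1) (k.+2%:R^-1) hn hn1 => u v.
rewrite -[k.+2%:R]natr1; move: (k.+1%:R) => n hn hn1.
transitivity ((- y * u + y ^+ 2 * (u - u ^+ 2)) *
               (n * v * ((n + 1) * v) - y * v ^+ 2));
  first by apply: (lincomb1 (c1 := (- y * u + y ^+ 2 * (u - u ^+ 2)) * v ^+ 2) hy); ring.
rewrite hn1 mulr1; apply: (lincomb2 (c2 := y ^+ 2 * u * v)
  (c1 := - y * v + y ^+ 2 * v - y ^+ 2 * u * v - y ^+ 2 * v ^+ 2) hn hn1).
by ring: y3.
Qed.

Lemma legs_quad (u : R) : legs p (P * u) = 1
  - P * u * \sum_(k < p.-1) cbin4 R k.+1 / k.+1%:R
  - P ^+ 2 * u ^+ 2 * \sum_(k < p.-1) cbin4 R k.+1 * k.+1%:R^-1 ^+ 2.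
Proof.
rewrite -[X in legs X _](prednK (prime_gt0 p_prime)) /legs big_ord_recl /= cbin40 legc0 mulr1.
rewrite -[RHS]addrA -opprD; congr (_ + _); rewrite !mulr_sumr -big_split /= -sumrN.
apply: eq_bigr => k _; have kp := ltn_ord k.
rewrite (@legc_small (P * u * (P * u + 1))) //; [|ring: P3|lia].
by rewrite -exprVn; move: (_^-1) => v; ring: P3.
Qed.

(* The unknown linear coefficient is read off at t = -1, where legs p (- P) equals
   legs p (p - 1), a square of a central coefficient. *)
Lemma legs_small (t : R) :
  legs p (P * t) = 1 - t * (legs p (- P) - 1) +
     (t + t ^+ 2) * (648 * w ^+ 2 * H b ^+ 2).
Proof.
have hb := p_half.
have := legs_quad (-1); rewrite mulrN1 => ->; rewrite legs_quad.
set Z1 := \sum_(k < p.-1) cbin4 R k.+1 / k.+1%:R.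
set Z2 := \sum_(k < p.-1) cbin4 R k.+1 * k.+1%:R^-1 ^+ 2.
(* Modulo p, [cbin4] is a signed binomial coefficient that vanishes beyond b, so Z2 is [altbin 2 b],
   where [H2 b] drops; 648 is again 36^2 / 2. *)
have hZ2 : P ^+ 2 * Z2 = - (648 * w ^+ 2 * H b ^+ 2).
  have : P ^+ 2 * Z2 = P ^+ 2 * altbin 2 b.
    rewrite /Z2 /altbin (_ : p.-1 = (b + b)%N); last by lia.
    rewrite big_split_ord /= mulrDr [X in _ + X](_ : _ = 0) ?addr0 ?mulr_sumr.
      apply: eq_bigr => i _; have ib := ltn_ord i.
      rewrite mulrA P2_cbin4; last by lia.
      by rewrite -[LHS]mulrA.
    rewrite big1 // => i _; have ib := ltn_ord i.
    rewrite mulrA P2_cbin4; last by lia.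
    by rewrite bin_small ?mulr0n ?mulr0 ?mul0r //; lia.
  move=> ->; apply: (mulrI unit2).
  rewrite mulrCA altbin2; last by lia.
  by apply: (lincomb1 (c1 := -1) H2_half); rewrite Pw; ring.
apply: (lincomb1 (c1 := - t - t ^+ 2) hZ2); ring.
Qed.

(** * Truncated sums at the points n + pt *)

Lemma legs_rec_p a : a ^+ 2 * legs p a - (a - 1) ^+ 2 * legs p (a - 2) =
  (2 * a - 1) * (2 * P - 1) * (cbin4 R p.-1 * legc (a - 1) p.-1).
Proof.
have p0 := prime_gt0 p_prime.
rewrite -{1 2}(prednK p0) legs_rec ?unit2 // => [|k kp]; last by rewrite unitS_lt; lia.
by rewrite -[in RHS](prednK p0) -[p.-1.+1%:R]natr1; ring.
Qed.

Lemma cbin4_pred : exists v, cbin4 R p.-1 = P * v.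
Proof.
have hb := p_half; pose F i : R := (2 * i%:R + 1) / (2 * i.+1%:R).
have bp : (b < p.-1)%N by lia.
rewrite /cbin4 (bigD1 (Ordinal bp)) //=.
have -> : 2 * b%:R + 1 = P :> R by rewrite [in RHS]p_half natrD natrM.
by eexists; rewrite -mulrA; reflexivity.
Qed.

(** Three factors P meet: one in [cbin4], one from a - n = Pt, and one from the mirror index p - 1 -
    n, where the factor is P(1 + t). *)
Lemma legc_vanish (t : R) n : (0 < n)%N -> (n.+1 < p)%N ->
  cbin4 R p.-1 * legc (n%:R + P * t) p.-1 = 0.
Proof.
move=> n0 np; have [v ->] := cbin4_pred.
have -> : legc (n%:R + P * t) p.-1 =
   \prod_(i < p.-1) (i%:R - (n%:R + P * t)) *
   (\prod_(i < p.-1) (i%:R + 1 + (n%:R + P * t)) * \prod_(i < p.-1) i.+1%:R ^- 2).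
  by rewrite -!big_split; apply: eq_bigr => i _ /=; ring.
have hn : (n < p.-1)%N by lia.
have hn' : (p.-1 - n < p.-1)%N by lia.
rewrite (bigD1 (Ordinal hn)) //= (bigD1 (F := fun i : 'I_p.-1 => i%:R + 1 + _) (Ordinal hn')) //=.
have -> : (p.-1 - n)%:R + 1 + (n%:R + P * t) = P * (1 + t).
  rewrite natrB; last by lia.
  have hP : P = p.-1%:R + 1 by rewrite natr1 prednK // prime_gt0.
  by apply: (lincomb1 (c1 := -1) hP); ring.
by ring: P3.
Qed.

Lemma legs_step (t : R) n : (0 < n)%N -> (n.+1 < p)%N ->
  (n.+1%:R + P * t) ^+ 2 * legs p (n.+1%:R + P * t) =
  (n%:R + P * t) ^+ 2 * legs p (n%:R - 1 + P * t).
Proof.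
move=> n0 np; have := legs_rec_p (n.+1%:R + P * t).
have -> : n.+1%:R + P * t - 1 = n%:R + P * t by rewrite -natr1; ring.
have -> : n.+1%:R + P * t - 2 = n%:R - 1 + P * t by rewrite -natr1; ring.
by rewrite legc_vanish // mulr0 => /eqP; rewrite subr_eq0 => /eqP.
Qed.

(** Each use of [legs_step] multiplies by ((2i+1+Pt) / (2i+2+Pt))^2; the value of this ratio at t =
    0 is a squared factor of [cbin4], and the deviations form the two products. *)
Lemma legs_even (t : R) n : (n <= b)%N ->
  legs p ((2 * n)%:R + P * t) *
    (\prod_(i < n) (1 + 36 * w * (t / (2 * i.+1)%:R))) ^+ 2 =
  cbin4 R n ^+ 2 * (\prod_(i < n) (1 + 36 * w * (t / (2 * i + 1)%:R))) ^+ 2 *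
    legs p (P * t).
Proof.
have hb := p_half.
elim: n => [|n IHn] nb; first by rewrite !big_ord0 muln0 add0r cbin40; ring.
have ue : ((2 * n.+1)%:R : R) \is a GRing.unit by rewrite unit_lt //; lia.
have uo : ((2 * n + 1)%:R : R) \is a GRing.unit by rewrite unit_lt //; lia.
have hstep : ((2 * n.+1)%:R + P * t) ^+ 2 * legs p ((2 * n.+1)%:R + P * t) =
    ((2 * n + 1)%:R + P * t) ^+ 2 * legs p ((2 * n)%:R + P * t).
  have := @legs_step t (2 * n + 1).
  have -> : (2 * n + 1)%:R - 1 + P * t = (2 * n)%:R + P * t by rewrite natrD; ring.
  have -> : ((2 * n + 1).+1 = 2 * n.+1)%N by lia.
  by apply; lia.
move: hstep; set L := legs p _; set L' := legs p _ in IHn * => hstep.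
rewrite !big_ord_recr /=; move: IHn => /(_ (ltnW nb)).
set A := \prod_(i < n) _; set B := \prod_(i < n) _ => IHn.
have hg : cbin4 R n.+1 * (2 * n.+1)%:R = cbin4 R n * (2 * n + 1)%:R.
  rewrite natrM cbin4_rec; last by lia.
  by rewrite [in RHS]natrD natrM.
have fe : (2 * n.+1)%:R * (1 + 36 * w * (t / (2 * n.+1)%:R)) = (2 * n.+1)%:R + P * t.
  by rewrite Pw mulrDr mulr1 [36 * w * _]mulrA [X in _ + X]mulrC mulrVK.
have fo : (2 * n + 1)%:R * (1 + 36 * w * (t / (2 * n + 1)%:R)) = (2 * n + 1)%:R + P * t.
  by rewrite Pw mulrDr mulr1 [36 * w * _]mulrA [X in _ + X]mulrC mulrVK.
move: fe fo; set x := _ / _; set y := _ / _ => fe fo.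
apply: (mulrI (unitrX 2 ue)).
transitivity (((2 * n.+1)%:R * (1 + 36 * w * x)) ^+ 2 * L * A ^+ 2); first by ring.
rewrite fe hstep; transitivity (((2 * n + 1)%:R + P * t) ^+ 2 * (L' * A ^+ 2)); first by ring.
rewrite IHn -fo; transitivity ((cbin4 R n * (2 * n + 1)%:R) ^+ 2 * B ^+ 2 * (1 +
  36 * w * y) ^+ 2 * legs p (P * t)); first by ring.
by rewrite -hg; ring.
Qed.

(** Modulo p the factor of [cbin4] at b + 1 + i is (2i+2)/(2i+3). Multiplied by the factor
    (2i+1)/(2i+2) at i it telescopes, so the product in [key] does not depend on j; j = b - 1 gives
    the claim. *)
Lemma P_cbin4_pred : P * cbin4 R p.-1 = - P ^+ 2.
Proof.
have hb := p_half.
have hP : P = 2 * b%:R + 1 by rewrite {1}p_half natrD natrM.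
have z k : (b < k < p)%N -> P ^+ 2 * cbin4 R k = 0.
  by case/andP=> bk kp; rewrite P2_cbin4 // bin_small // mulr0n !mulr0.
have key j : (b + j.+1 < p)%N ->
    P * cbin4 R (b + j.+1) * cbin4 R j * (2 * j%:R + 1) = P ^+ 2 * cbin4 R b.
  elim: j => [|j IHj] jb.
    have h : cbin4 R (b + 1) * (2 * (b%:R + 1)) = cbin4 R b * (2 * b%:R + 1).
      by rewrite addn1 natr1 cbin4_rec //; lia.
    have z1 : P ^+ 2 * cbin4 R (b + 1) = 0 by rewrite z //; lia.
    rewrite cbin40; apply: (lincomb3 (c1 := P) (c2 := P * cbin4 R (b +
      1) - P * cbin4 R b) (c3 := - 1) h hP z1).
    by ring.
  have r1 : cbin4 R (b + j.+2) * (2 * (b%:R + j%:R + 2)) =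
            cbin4 R (b + j.+1) * (2 * (b%:R + j%:R + 1) + 1).
    have := @cbin4_rec (b + j.+1); rewrite -addnS => h.
    transitivity (cbin4 R (b + j.+2) * (2 * (b + j.+2)%:R)).
      by rewrite natrD -addn2 natrD; ring.
    by rewrite h // natrD -[j.+1%:R]natr1; ring.
  have z2 : P ^+ 2 * (cbin4 R (b + j.+2) - cbin4 R (b + j.+1)) = 0.
    by rewrite mulrBr !z ?subrr //; lia.
  have IH := IHj ltac:(lia).
  have r2 : cbin4 R j.+1 * (2 * (j%:R + 1)) = cbin4 R j * (2 * j%:R + 1).
    by rewrite natr1 cbin4_rec //; lia.
  have e1 : P * cbin4 R (b + j.+2) * (2 * j%:R + 3) = P * cbin4 R (b + j.+1) * (2 * j%:R + 2).
    apply: (lincomb3 (c1 := P) (c3 := - 1)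
      (c2 := P * cbin4 R (b + j.+2) - P * cbin4 R (b + j.+1)) r1 hP z2).
    by ring.
  rewrite -[j.+1%:R]natr1.
  apply: (lincomb3 (c1 := cbin4 R j.+1) (c2 := P * cbin4 R (b + j.+1)) (c3 := 1) e1 r2 IH).
  by ring.
have b0 : (0 < b)%N by lia.
have := key b.-1; rewrite prednK // => /(_ ltac:(lia)).
have := @cbin4_rec b.-1; rewrite prednK // => /(_ ltac:(lia)).
have -> : (b + b = p.-1)%N by lia.
have z1 : P ^+ 2 * cbin4 R p.-1 = 0 by rewrite z //; lia.
have hP' : P - 1 = 2 * b%:R by rewrite hP; ring.
rewrite -hP' -!mulrA => <- h; apply: (mulrI (cbin4_unit (leqnn b))).
apply: (lincomb2 (c1 := cbin4 R b) (c2 := - 1) z1 h); ring.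
Qed.

(** At a = 1 + Pt the boundary term of the recurrence survives, being divisible only by P^2, and
    supplies P^2 t. The other part, P^2 t^2, comes from (a-1)^2 times the sum at a - 2 = -1 + Pt,
    which reflects to -Pt. *)
Lemma legs_odd1 (t : R) : legs p (1 + P * t) = P ^+ 2 * (t * (t + 1)).
Proof.
have := legs_rec_p (1 + P * t).
have -> : 1 + P * t - 1 = P * t by ring.
have -> : 1 + P * t - 2 = - 1 - P * (- t) by ring.
rewrite legsN.
have hL : exists l, legc (P * t) p.-1 = P * l /\ P * (P * l) = P ^+ 2 * t.
  have -> : p.-1 = p.-2.+1 by lia.
  rewrite (legc_small (erefl (P * t * (P * t + 1)))); [|ring: P3|lia].
  have hv : (P - 1) * p.-2.+1%:R^-1 = 1.
    have -> : P - 1 = p.-2.+1%:R.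
      by apply/eqP; rewrite subr_eq natr1; apply/eqP; congr _%:R; lia.
    by rewrite mulrV // unitS_lt; lia.
  rewrite -exprVn; move: (_^-1) hv => v hv;
    exists (- (t * (P * t + 1)) * v + P * t ^+ 2 * (P * t + 1) ^+ 2 * (v - v ^+ 2)).
  split; first by ring.
  by apply: (lincomb1 (c1 := P ^+ 2 * t) hv); ring: P3.
case: hL => l [-> hl]; rewrite legs_quad => h.
have {}h : (1 + P * t) ^+ 2 * legs p (1 + P * t) = P ^+ 2 * (t * (t + 1)).
  have hg := P_cbin4_pred.
  apply: (lincomb3 (c1 := 1) (c2 := (2 * (1 + P * t) - 1) * (2 * P - 1) * l) (c3 := (2 * (1 +
    P * t) - 1) * (1 - 2 * P)) h hg hl).
  by ring: P3.
apply: (lincomb1 (c1 := 1 - 2 * P * t + 3 * P ^+ 2 * t ^+ 2) h).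
by ring: P3.
Qed.

Lemma legs_odd (t : R) n : (n < b)%N ->
  legs p ((2 * n + 1)%:R + P * t) =
  P ^+ 2 * (t * (t + 1)) / ((2 * n + 1)%:R ^+ 2 * cbin4 R n ^+ 2).
Proof.
have hb := p_half.
elim: n => [|n IHn] nb; first by rewrite muln0 cbin40 !expr1n mulr1 divr1 legs_odd1.
have hstep : ((2 * n.+1 + 1)%:R + P * t) ^+ 2 * legs p ((2 * n.+1 + 1)%:R + P * t) =
    ((2 * n.+1)%:R + P * t) ^+ 2 * legs p ((2 * n + 1)%:R + P * t).
  have := @legs_step t (2 * n.+1).
  have -> : (2 * n.+1)%:R - 1 = (2 * n + 1)%:R :> R.
    by apply/eqP; rewrite subr_eq natr1; apply/eqP; congr _%:R; lia.
  have -> : ((2 * n.+1).+1 = 2 * n.+1 + 1)%N by lia.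
  by apply; lia.
rewrite IHn in hstep; last by lia.
have ue : ((2 * n.+1)%:R : R) \is a GRing.unit by rewrite unit_lt //; lia.
have uo : ((2 * n + 1)%:R : R) \is a GRing.unit by rewrite unit_lt //; lia.
have uo' : ((2 * n.+1 + 1)%:R : R) \is a GRing.unit by rewrite unit_lt //; lia.
have ug : cbin4 R n \is a GRing.unit by rewrite cbin4_unit; lia.
have ug' : cbin4 R n.+1 \is a GRing.unit by rewrite cbin4_unit; lia.
have hg : cbin4 R n.+1 * (2 * n.+1)%:R = cbin4 R n * (2 * n + 1)%:R.
  rewrite natrM cbin4_rec; last by lia.
  by rewrite [in RHS]natrD natrM.
move: hstep; set L := legs p _; set z := (_ / _); move: (2 * n.+1 + 1)%:R uo' => m uo' hL.
have um := unitrX 2 uo'; set e := (2 * n.+1)%:R in ue hg hL;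
  set o := (2 * n + 1)%:R in uo hg z hL *.
(* Both sides of [hstep] are multiples of P^2, so the terms Pt inside its squares can be
   discarded. *)
have hz : P * z = 0 by rewrite /z mulrA; ring: P3.
have P2L : P ^+ 2 * L = 0.
  by apply: (mulrI um); apply: (lincomb2 (c1 := P ^+ 2) (c2 := P * (e + P * t) ^+ 2) hL hz);
    ring: P3.
have PL : P * L = 0.
  by apply: (mulrI um); apply: (lincomb3 (c1 := P) (c2 := (e + P * t) ^+ 2)
    (c3 := - 2 * m * t - P * t ^+ 2) hL hz P2L); ring.
have {}hL : m ^+ 2 * L = e ^+ 2 * z.
  by apply: (lincomb3 (c1 := 1) (c2 := 2 * e * t + P * t ^+ 2)
    (c3 := - 2 * m * t - P * t ^+ 2) hL hz PL); ring.
have hz' : o ^+ 2 * cbin4 R n ^+ 2 * z = P ^+ 2 * (t * (t + 1)).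
  by rewrite /z mulrC divrK // unitrM !unitrX.
have u : m ^+ 2 * cbin4 R n.+1 ^+ 2 \is a GRing.unit by rewrite unitrM !unitrX.
apply: (mulIr u); rewrite divrK // -hz'.
transitivity (cbin4 R n.+1 ^+ 2 * (m ^+ 2 * L)); first by ring.
rewrite hL; transitivity ((cbin4 R n.+1 * e) ^+ 2 * z); first by ring.
by rewrite hg; ring.
Qed.

Definition tsum (a : R) := \sum_(k < p.-1) cbin4 R k * legc a k / k.+1%:R.

Lemma tsum_contiguous a : cbin4 R p.-1 * legc a p.-1 = 0 ->
  (2 * a + 1) * tsum a =
  (a + 1) * legs p (a + 1) + a * legs p (a - 1) + (2 * a + 1) * legs p a.
Proof.
move=> h; have := @legs_contiguous R p.-1 a.
rewrite prednK ?prime_gt0 // => -> //; last 2 first.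
- by move=> k kp; rewrite unitS_lt; lia.
- exact: unit2.
by rewrite h /tsum; ring.
Qed.

(* For p = 6r + 1 we have -1/3 = 2r - p/3, so tsum reduces to truncated sums near
   the integers 2r and 2r + 1; for p = 6r + 5 the reflection a -> -1 - a is needed first. *)
Lemma tsum_1mod6 r : p = (6 * r + 1)%N -> let t := - 3^-1 in
  tsum t = legs p ((2 * r)%:R + P * t) - 2 * legs p ((2 * r + 1)%:R + P * t).
Proof.
move=> hp t; have u3 := unit3.
have ht : 3 * t = - 1 by rewrite mulrN mulrV.
have hP : P = 6 * r%:R + 1 by rewrite {1}hp natrD natrM.
have r0 : (0 < r)%N by lia.
have ea : (2 * r)%:R + P * t = t.
  apply: (mulrI u3); rewrite natrM; apply: (lincomb2 (c1 := P - 1) (c2 := - 1) ht hP).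
  by ring.
have := @legs_step t (2 * r).
have e1 : (2 * r).+1%:R + P * t = t + 1 by rewrite -natr1 -{2}ea; ring.
have e2 : (2 * r)%:R - 1 + P * t = t - 1 by rewrite -{2}ea; ring.
rewrite addn1 e1 e2 ea => /(_ ltac:(lia) ltac:(lia)) hs.
have hc := @tsum_contiguous t; rewrite -{1}ea legc_vanish in hc; [|lia..].
have {}hc := hc erefl; move: hs hc.
set T := tsum t; set L0 := legs p t; set L1 := legs p (t + 1); set L2 := legs p (t - 1) => hs hc.
(* At t = -1/3 the squares of t + 1 and t are 4/9 and 1/9. *)
have {}hs : 4 * L1 = L2.
  by apply: (lincomb2 (c1 := 9) (c2 := - (3 * t + 5) * L1 + (3 * t - 1) * L2) hs ht); ring.
apply: (lincomb3 (c1 := 3) (c2 := - 2 * T + L1 + L2 + 2 * L0) (c3 := 1) hc ht hs).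
by ring.
Qed.

Lemma tsum_5mod6 r : p = (6 * r + 5)%N -> let t := - 3^-1 in
  tsum t = legs p ((2 * r + 1)%:R + P * t) - 2 * legs p ((2 * r)%:R + P * t).
Proof.
move=> hp t; have u3 := unit3.
have ht : 3 * t = - 1 by rewrite mulrN mulrV.
have hP : P = 6 * r%:R + 5 by rewrite {1}hp natrD natrM.
pose a := (2 * r + 1)%:R + P * t.
have ha : 3 * a = - 2.
  by rewrite /a natrD natrM; apply: (lincomb2 (c1 := P) (c2 := - 1) ht hP); ring.
have -> : tsum t = tsum a.
  apply: eq_bigr => k _; rewrite -legcN; congr (_ * legc _ _ / _).
  by apply: (mulrI u3); apply: (lincomb2 (c1 := - 1) (c2 := - 1) ha ht); ring.
have := @legs_step t (2 * r + 1).
have e1 : (2 * r + 1).+1%:R + P * t = a + 1 by rewrite -natr1 /a; ring.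
have e2 : (2 * r + 1)%:R - 1 + P * t = a - 1 by rewrite /a; ring.
have e3 : (2 * r)%:R + P * t = a - 1 by rewrite /a natrD; ring.
rewrite e1 e2 e3 -/a => /(_ ltac:(lia) ltac:(lia)) hs.
have hc := @tsum_contiguous a; rewrite {1}/a legc_vanish in hc; [|lia..].
have {}hc := hc erefl; move: hs hc.
set T := tsum a; set L0 := legs p a; set L1 := legs p (a + 1); set L2 := legs p (a - 1) => hs hc.
have {}hs : L1 = 4 * L2.
  by apply: (lincomb2 (c1 := 9) (c2 := - (3 * a + 4) * L1 + (3 * a - 2) * L2) hs ha); ring.
apply: (lincomb3 (c1 := - 3) (c2 := 2 * T - L1 - L2 - 2 * L0) (c3 := - 1) hc ha hs).
by ring.
Qed.

(** * The case p = 5 modulo 6 *)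

Definition v : R := w / 2.

Lemma wv : w = 2 * v. Proof. by rewrite mulrC divrK // unit2. Qed.

Lemma v3 : v ^+ 3 = 0. Proof. by rewrite expr_div_n w3 mul0r. Qed.

Lemma unit_1Dw z : 1 + w * z \is a GRing.unit.
Proof.
apply/unitrP; exists (1 - w * z + w ^+ 2 * z ^+ 2).
by split; ring: w3.
Qed.

Lemma w_H_half (q : R) : 2 ^+ p.-1 = 1 + P * q ->
  w * H b = - 2 * w * q + 36 * w ^+ 2 * q ^+ 2.
Proof.
move=> /P_H_half h; apply: (mulrI unit36).
by rewrite mulrA -Pw h Pw; ring.
Qed.

Lemma legs_minus_P : legs p (- P) = (2 ^+ p.-1) ^+ 2.
Proof.
rewrite -cbin4_half; have := legs_even 0 (leqnn b).
have hp1 : \prod_(i < b) (1 + 36 * w * (0 / (2 * i.+1)%:R)) = 1.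
  by rewrite big1 // => i _; ring.
have hp2 : \prod_(i < b) (1 + 36 * w * (0 / (2 * i + 1)%:R)) = 1.
  by rewrite big1 // => i _; ring.
rewrite hp1 hp2 !mulr0 !addr0 !expr1n !mulr1.
have -> : legs p (0 : R) = 1.
  have := legs_small 0; rewrite mulr0 => ->; ring.
rewrite mulr1 => <-; rewrite -legsN; congr legs.
have -> : P = (2 * b)%:R + 1 by rewrite {1}p_half natrD.
by ring.
Qed.

Lemma legs_third (q : R) : 2 ^+ p.-1 = 1 + P * q ->
  legs p (P * - 3^-1) = 1 + 24 * w * q - 144 * w ^+ 2 * q ^+ 2.
Proof.
move=> hq; rewrite legs_small legs_minus_P hq.
have h3 : 3 * - 3^-1 = - 1 :> R by rewrite mulrN mulrV // unit3.
have hw := w_H_half hq; move: (- 3^-1) h3 => t ht.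
have {}hw : w ^+ 2 * H b ^+ 2 = 4 * w ^+ 2 * q ^+ 2 by rewrite -exprMn hw; ring: w3.
have -> : 648 * w ^+ 2 * H b ^+ 2 = 2592 * w ^+ 2 * q ^+ 2 by rewrite -mulrA hw; ring.
rewrite Pw; apply: (lincomb1 (c1 := - 24 * w * q - 432 * w ^+ 2 * q ^+ 2 + (3 * t +
  2) * 288 * w ^+ 2 * q ^+ 2) ht).
by ring.
Qed.

Section ThirdProducts.

Variable r : nat.
Hypothesis rb : (r <= b)%N.

Let t : R := - 3^-1.

Lemma third_t : 3 * t = - 1. Proof. by rewrite mulrN mulrV // unit3. Qed.

Lemma prod_even_third : \prod_(i < r) (1 + 36 * w * (t / (2 * i.+1)%:R)) =
  1 - 6 * w * H r + 18 * w ^+ 2 * (H r ^+ 2 - H2 r).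
Proof.
have hb := p_half; rewrite (prod_expand _ (fun i => t / (2 * i.+1)%:R)) -mulr_sumr.
have -> : \sum_(i < r) (t / (2 * i.+1)%:R) ^+ 2 = t ^+ 2 * \sum_(i < r) (2 * i.+1)%:R ^- 2.
  by rewrite mulr_sumr; apply: eq_bigr => i _; rewrite exprMn exprVn.
rewrite H_double ?H2_double; [|lia..].
move: (\sum_(i < r) (2 * i.+1)%:R^-1) (\sum_(i < r) (2 * i.+1)%:R ^- 2) third_t => x y ht.
apply: (lincomb1 (c1 := 12 * w * x + 72 * w ^+ 2 * (3 * t - 1) * (x ^+ 2 - y)) ht).
by ring.
Qed.

Lemma sum_odd_H :
  2 * \sum_(i < r) (2 * i + 1)%:R^-1 = 2 * H (2 * r) - H r.
Proof.
have hb := p_half; rewrite (H_double (k := r)) -?mulrBr; last by lia.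
congr (2 * _); rewrite /H mul2n -addnn (big_even_odd _ (fun i => i.+1%:R^-1)) addrC.
have -> : \sum_(i < r) (2 * i + 1).+1%:R^-1 = \sum_(i < r) (2 * i.+1)%:R^-1 :> R.
  by apply: eq_bigr => i _; congr _%:R^-1; lia.
rewrite addrCA addNr addr0; apply: eq_bigr => i _; by rewrite addn1.
Qed.

Lemma sum_odd_H2 :
  2 ^+ 2 * \sum_(i < r) (2 * i + 1)%:R^-1 ^+ 2 = 4 * H2 (2 * r) - H2 r.
Proof.
have hb := p_half; rewrite (H2_double (k := r)); last by lia.
have -> : 4 * H2 (2 * r) = 2 ^+ 2 * H2 (2 * r) by ring.
rewrite -mulrBr; congr (_ * _).
rewrite /H2 mul2n -addnn (big_even_odd _ (fun i => i.+1%:R ^- 2)) addrC.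
have -> : \sum_(i < r) (2 * i + 1).+1%:R ^- 2 = \sum_(i < r) (2 * i.+1)%:R ^- 2 :> R.
  by apply: eq_bigr => i _; congr (_%:R ^- 2); lia.
by rewrite addrCA addNr addr0; apply: eq_bigr => i _; rewrite addn1 exprVn.
Qed.

Lemma prod_odd_third : \prod_(i < r) (1 + 36 * w * (t / (2 * i + 1)%:R)) =
  1 - 6 * w * (2 * H (2 * r) - H r)
  + 18 * w ^+ 2 * ((2 * H (2 * r) - H r) ^+ 2 - (4 * H2 (2 * r) - H2 r)).
Proof.
rewrite (prod_expand _ (fun i => t / (2 * i + 1)%:R)) -mulr_sumr.
have -> : \sum_(i < r) (t / (2 * i + 1)%:R) ^+ 2 = t ^+ 2 * \sum_(i < r) (2 * i + 1)%:R^-1 ^+ 2.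
  by rewrite mulr_sumr; apply: eq_bigr => i _; rewrite exprMn.
rewrite -sum_odd_H -sum_odd_H2.
move: (\sum_(i < r) (2 * i + 1)%:R^-1) (\sum_(i < r) (2 * i + 1)%:R^-1 ^+ 2) third_t => x y ht.
apply: (lincomb1 (c1 := 12 * w * x + 72 * w ^+ 2 * (3 * t - 1) * (x ^+ 2 - y)) ht).
by ring.
Qed.

Lemma prod_odd_minus : \prod_(i < r) (1 - 36 * w / (2 * i + 1)%:R) =
  1 - 18 * w * (2 * H (2 * r) - H r)
  + 162 * w ^+ 2 * ((2 * H (2 * r) - H r) ^+ 2 - (4 * H2 (2 * r) - H2 r)).
Proof.
transitivity (\prod_(i < r) (1 + 36 * w * - (2 * i + 1)%:R^-1)).
  by apply: eq_bigr => i _; ring.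
rewrite (prod_expand _ (fun i => - (2 * i + 1)%:R^-1)) sumrN.
have -> : \sum_(i < r) (- (2 * i + 1)%:R^-1) ^+ 2 = \sum_(i < r) (2 * i + 1)%:R^-1 ^+ 2 :> R.
  by apply: eq_bigr => i _; rewrite sqrrN.
rewrite -sum_odd_H -sum_odd_H2; ring.
Qed.

End ThirdProducts.

(** [legs_even] and [legs_odd] involve the square of [cbin4 r]; [X] converts it to the squared
    binomial. The value at 2r + Pt then amounts to the identity [hF], polynomial in the two Fermat
    quotients and u modulo v^3. *)
Lemma tsum_5mod6_eval r (q2 q3 u : R) : p = (6 * r + 5)%N ->
    2 ^+ p.-1 = 1 + P * q2 -> 3 ^+ p.-1 = 1 + P * q3 -> u = (U (p - 3))%:~R ->
  tsum (- 3^-1) = - 2 * 'C(b, r)%:R ^+ 2 *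
    (1 + w * (72 + 48 * q2 - 54 * q3) + w ^+ 2 * (1296 + 3456 * q2 + 288 * q2 ^+ 2
        - 3888 * q3 - 2592 * q2 * q3 + 2430 * q3 ^+ 2 + 972 * u))
    - 648 * w ^+ 2 * 'C(b, r)%:R ^- 2.
Proof.
move=> hp hq2 hq3 hu; have hb := p_half; pose m := (2 * r + 1)%N.
have rb : (r <= b)%N by lia.
have hH2m : w ^+ 2 * H2 m = - 3 * w ^+ 2 * u.
  by rewrite hu; apply: (w2_H2_third_U hp).
have [hH2r hHr] := H_third_sixth (or_intror (conj hp (erefl m))).
have hHb := w_H_half hq2.
have hHm : 2 * w * H m = - 3 * w * q3 + 54 * w ^+ 2 * q3 ^+ 2 - 24 * w ^+ 2 * H2 m.
  by apply: w_H_third => //; rewrite /m; lia.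
have um : (m%:R : R) \is a GRing.unit by rewrite unit_lt // /m; lia.
have rb' : (r < b)%N by lia.
(* [w_H_third] is about m = 2r + 1, while the products need 2r; the extra reciprocal 1/m is 3/(P -
   2), expanded to second order. *)
pose mu : R := m%:R^-1.
have hmu : m%:R * mu = 1 by rewrite mulrV // unit_lt // /m; lia.
have hm : 3 * m%:R = P - 2.
  by apply/eqP; rewrite eq_sym subr_eq -natrM -natrD; apply/eqP; congr _%:R; rewrite /m; lia.
have hH : H m = H (2 * r) + mu by rewrite /m addn1 /H big_ord_recr /= /mu /m addn1.
have hH2 : H2 m = H2 (2 * r) + mu ^+ 2.
  by rewrite /m addn1 /H2 big_ord_recr /= /mu /m addn1 exprVn.
have hwmu : 2 * w * mu = - 3 * w - 54 * w ^+ 2.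
  apply: (lincomb3 (c1 := - 3 * w - 54 * w ^+ 2) (c2 := (w + 18 * w ^+ 2) * mu)
     (c3 := (w + 18 * w ^+ 2) * mu) hmu hm Pw); ring: w3.
have {}hHr : w * H r = v * (- 3 * q3 - 4 * q2 + v * (108 * q3 ^+ 2 + 144 * q2 ^+ 2 + 360 * u)).
  apply: (mulrI unit2); rewrite hHr !mulrBr !mulrDr [2 * (w * H m)]mulrA hHm hHb.
  apply: (lincomb1 (c1 := - 60) hH2m).
  by rewrite wv; ring.
pose zr := - 3 * q3 - 4 * q2 + v * (108 * q3 ^+ 2 + 144 * q2 ^+ 2 + 360 * u).
pose zd := 6 - 3 * q3 + 4 * q2 + v * (216 + 108 * q3 ^+ 2 - 144 * q2 ^+ 2 - 72 * u).
have hD : w * (2 * H (2 * r) - H r) = v * zd.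
  have -> : w * (2 * H (2 * r) - H r) = 2 * w * H m - 2 * w * mu - w * H r.
    by rewrite hH; ring.
  rewrite hHm hwmu hHr; apply: (lincomb1 (c1 := - 24) hH2m).
  by rewrite /zd wv; ring.
have {}hH2r : w ^+ 2 * H2 r = - 60 * v ^+ 2 * u.
  by rewrite hH2r -mulrA hH2m wv; ring.
have hD2 : w ^+ 2 * (4 * H2 (2 * r) - H2 r) = v ^+ 2 * (12 * u - 36).
  have -> : w ^+ 2 * (4 * H2 (2 * r) - H2 r) =
    4 * (w ^+ 2 * H2 m) - (2 * w * mu) ^+ 2 - w ^+ 2 * H2 r by rewrite hH2; ring.
  by rewrite hH2m hwmu hH2r wv; ring: v3.
pose Ev := 1 - 6 * v * zr + 18 * v ^+ 2 * (zr ^+ 2 + 60 * u).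
pose Od := 1 - 6 * v * zd + 18 * v ^+ 2 * (zd ^+ 2 - (12 * u - 36)).
pose X := 1 - 18 * v * zd + 162 * v ^+ 2 * (zd ^+ 2 - (12 * u - 36)).
have hEv : \prod_(i < r) (1 + 36 * w * (- 3^-1 / (2 * i.+1)%:R)) = Ev.
  rewrite prod_even_third //; have h : w * H r = v * zr by [].
  apply: (lincomb2 (c1 := - 6 + 18 * (w * H r + v * zr)) (c2 := - 18) h hH2r).
  by rewrite /Ev; ring.
have hOd : \prod_(i < r) (1 + 36 * w * (- 3^-1 / (2 * i + 1)%:R)) = Od.
  rewrite prod_odd_third //; move: hD hD2; set D := _ - _; set D2 := _ - _ => hD hD2.
  apply: (lincomb2 (c1 := - 6 + 18 * (w * D + v * zd)) (c2 := - 18) hD hD2).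
  by rewrite /Od; ring.
have hX : 'C(b, r)%:R ^+ 2 = cbin4 R r ^+ 2 * X ^+ 2.
  rewrite bin_cbin4 // exprMn exprMn sqrr_sign mul1r; congr (_ * _ ^+ 2).
  rewrite prod_odd_minus //; move: hD hD2; set D := _ - _; set D2 := _ - _ => hD hD2.
  apply: (lincomb2 (c1 := - 18 + 162 * (w * D + v * zd)) (c2 := - 162) hD hD2).
  by rewrite /X; ring.
have {hEv hOd} he : legs p ((2 * r)%:R + P * - 3^-1) * Ev ^+ 2 =
    cbin4 R r ^+ 2 * Od ^+ 2 * (1 + 48 * v * q2 - 576 * v ^+ 2 * q2 ^+ 2).
  have := legs_even (- 3^-1) rb; rewrite hEv hOd (legs_third hq2) => ->.
  by rewrite wv; ring.
rewrite (tsum_5mod6 hp); set F := 1 + w * _ + _.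
have hF : Od ^+ 2 * (1 + 48 * v * q2 - 576 * v ^+ 2 * q2 ^+ 2) = F * Ev ^+ 2 * X ^+ 2.
  by rewrite /F /Od /Ev /X /zr /zd wv; ring: v3.
have uEv : Ev ^+ 2 \is a GRing.unit.
  apply: unitrX; have -> : Ev = 1 + w * (- 3 * zr + 9 * v * (zr ^+ 2 + 60 * u)).
    by rewrite /Ev wv; ring.
  exact: unit_1Dw.
have {he hF}-> : legs p ((2 * r)%:R + P * - 3^-1) = 'C(b, r)%:R ^+ 2 * F.
  apply: (mulIr uEv); rewrite he hX.
  by apply: (lincomb1 (c1 := cbin4 R r ^+ 2) hF); ring.
have ug := cbin4_unit rb.
have uC : ('C(b, r)%:R : R) ^+ 2 \is a GRing.unit.
  rewrite hX unitrM unitrX //= unitrX //.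
  have -> : X = 1 + w * (- 9 * zd + 81 * v * (zd ^+ 2 - (12 * u - 36))).
    by rewrite /X wv; ring.
  exact: unit_1Dw.
(* Modulo p, m = -2/3 and t = -1/3, so t(t+1)/m^2 = -1/2; and 648 w^2 is P^2/2. *)
have -> : legs p ((2 * r + 1)%:R + P * - 3^-1) = - 648 * w ^+ 2 / 'C(b, r)%:R ^+ 2.
  rewrite (legs_odd (- 3^-1) rb').
  apply: eq_divr => //; first by rewrite unitrM !unitrX.
  have := third_t; rewrite hX -/m; move: (- 3^-1) => t ht; rewrite Pw wv in hm *.
  apply: (lincomb2 (c1 := 576 * v ^+ 2 * cbin4 R r ^+ 2 * X ^+ 2 * (3 * t + 2))
    (c2 := 288 * v ^+ 2 * cbin4 R r ^+ 2 * (3 * m%:R + 72 * v - 2)) ht hm).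
  by rewrite /X; ring: v3.
by ring.
Qed.

(** * Binomials across multiples of p *)

Definition rho n (x : R) : R := \prod_(i < n) (1 + 36 * w * (x / i.+1%:R)).

Lemma rhoE n x : rho n x = 1 + 36 * w * x * H n
  + 648 * w ^+ 2 * x ^+ 2 * (H n ^+ 2 - H2 n).
Proof.
rewrite /rho (prod_expand _ (fun i => x / i.+1%:R)) -mulr_sumr -/(H n).
have -> : \sum_(i < n) (x / i.+1%:R) ^+ 2 = x ^+ 2 * H2 n.
  by rewrite /H2 mulr_sumr; apply: eq_bigr => i _; rewrite exprMn exprVn.
by ring.
Qed.

Lemma fact_unit n : (n < p)%N -> (n`!%:R : R) \is a GRing.unit.
Proof.
elim: n => [|n IHn] np; first by rewrite unitr1.
by rewrite factS natrM unitrM unitS_lt // IHn // ltnW.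
Qed.

Lemma asc_rho k n : (n < p)%N -> (asc (k * p) n)%:R = n`!%:R * rho n k%:R.
Proof.
elim: n => [|n IHn] np; first by rewrite /asc /rho !big_ord0 mulr1.
have u := unitS_lt np.
rewrite /asc /rho !big_ord_recr /= natrM -/(asc (k * p) n) IHn ?(ltnW np) //.
rewrite -/(rho n k%:R) factS natrM natrD natrM.
transitivity (n`!%:R * rho n k%:R * (n.+1%:R + k%:R / n.+1%:R * n.+1%:R * P)).
  by rewrite mulrVK //; ring.
by rewrite Pw; ring.
Qed.

(** A refinement of Lucas' congruence: beyond kp the ascending products are factorials times [rho],
    which leaves C(a+c, c). The gap [s] allows for identities such as 9r = p + 3r - 1 and 15r = 2p +
    3r - 2. *)
Lemma bin_rho M c s k a : (M + s = k * p + a)%N -> (a + c < p)%N ->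
  'C(M + c, c)%:R * rho a k%:R * (asc (M + c) s)%:R =
  'C(a + c, c)%:R * rho (a + c) k%:R * (asc M s)%:R.
Proof.
move=> hM hac; have := congr1 (fun i : nat => i%:R : R) (bin_asc c hM).
have hC := bin_fact (leq_addl a c); rewrite addnK in hC.
have uc : (c`!%:R : R) \is a GRing.unit by apply: fact_unit; lia.
have ua : (a`!%:R : R) \is a GRing.unit by apply: fact_unit; lia.
rewrite !natrM !asc_rho //; last by lia.
rewrite -hC !natrM => h; apply: (mulrI uc); apply: (mulrI ua).
by apply: (lincomb1 (c1 := 1) h); ring.
Qed.

(** At x = 1 this is Wolstenholme's theorem C(2p-1, p-1) = 1 modulo p^3. *)
Lemma rho_full (x : R) : rho p.-1 x = 1.
Proof.
have h1 : w * H p.-1 = 0.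
  by apply: (mulrI unit36); rewrite mulrA -Pw H_full mulr0.
have h2 := w2_eq0 H2_full.
rewrite rhoE; apply: (lincomb2 (c1 := 36 * x +
  648 * w * x ^+ 2 * H p.-1) (c2 := - 648 * x ^+ 2) h1 h2).
by ring.
Qed.

(** Here both parts are measured from p and their sum from 2p; the factor 2 is C(2p, p), evaluated
    by [rho_full]. *)
Lemma bin_rho2 M M' a a' : (M + 1 = p + a)%N -> (M' + 1 = p + a')%N -> (a + a' < p)%N ->
  'C(M + M', M')%:R * rho a 1 * rho a' 1 * (asc (M + M') 2)%:R =
  2 * 'C(a + a', a')%:R * rho (a + a') 2 * (asc M 1)%:R * (asc M' 1)%:R :> R.
Proof.
move=> hM hM' haa.
have e0 : ('C(M + M', M') * (p.-1)`! * asc p a * asc p a' * asc (M + M') 2 =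
  2 * asc p p.-1 * asc (2 * p) (a + a') * asc M 1 * asc M' 1)%N.
  have hb := bin_fact (leq_addl M M'); rewrite addnK in hb.
  have e1 := fact_asc M 1; rewrite hM fact_asc in e1.
  have e2 := fact_asc M' 1; rewrite hM' fact_asc in e2.
  have e3 : ((2 * p)`! * asc (2 * p) (a + a') = (M + M')`! * asc (M + M') 2)%N.
    by rewrite -!fact_asc; congr _`!; lia.
  have e4 : (p`! = p * (p.-1)`!)%N by rewrite -{1}(prednK (prime_gt0 p_prime)) factS prednK
    ?prime_gt0.
  have e5 : ((2 * p)`! = p`! * (asc p p.-1 * (2 * p)))%N.
    rewrite mul2n -addnn fact_asc; congr (_ * _)%N.
    by rewrite -{2}(prednK (prime_gt0 p_prime)) /asc big_ord_recr /= prednK ?prime_gt0.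
  have p0 : (0 < p * p`!)%N by rewrite muln_gt0 prime_gt0 // fact_gt0.
  apply/eqP; rewrite -(eqn_pmul2l p0); apply/eqP.
  transitivity ('C(M + M', M') * (p`! * asc p a) * (p`! * asc p a') * asc (M + M') 2)%N.
    by rewrite {3}e4; ring.
  rewrite e1 e2; transitivity ('C(M + M', M') * (M'`! * M`!) * asc (M +
    M') 2 * asc M 1 * asc M' 1)%N.
    by ring.
  by rewrite hb -e3 e5; ring.
have uf : ((p.-1)`!%:R : R) \is a GRing.unit by apply: fact_unit; have := prime_gt0 p_prime; lia.
have ua : (a`!%:R : R) \is a GRing.unit by apply: fact_unit; lia.
have ua' : (a'`!%:R : R) \is a GRing.unit by apply: fact_unit; lia.
have := congr1 (fun i : nat => i%:R : R) e0.
have hC := bin_fact (leq_addl a a'); rewrite addnK in hC.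
have asc_p n : (n < p)%N -> (asc p n)%:R = n`!%:R * rho n 1.
  by move=> np; have := asc_rho 1 np; rewrite mul1n.
rewrite !natrM asc_rho // !asc_p; [|by have := prime_gt0 p_prime; lia|lia..].
rewrite rho_full mulr1 -hC !natrM => h.
apply: (mulrI uf); apply: (mulrI ua); apply: (mulrI ua').
by apply: (lincomb1 (c1 := 1) h); ring.
Qed.

Lemma P72v : P = 72 * v. Proof. by rewrite Pw wv; ring. Qed.

Lemma unit_1Dv z : 1 + v * z \is a GRing.unit.
Proof.
by apply/unitrP; exists (1 - v * z + v ^+ 2 * z ^+ 2); split; ring: v3.
Qed.

(** * The case p = 1 modulo 6 *)

Section OneModSix.

Variables (r : nat) (q : R).
Hypotheses (hp : p = (6 * r + 1)%N) (hq : 2 ^+ p.-1 = 1 + P * q).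

Let h := H (2 * r).
Let k := H2 (2 * r).
Let C0 : R := 'C(3 * r, 2 * r)%:R.

Lemma half_1mod6 : p./2 = (3 * r)%N.
Proof. by have := p_half; lia. Qed.

Lemma natr_1mod6 : 6 * r%:R = 72 * v - 1 :> R.
Proof. by rewrite -P72v {1}hp natrD natrM addrK. Qed.

Lemma H_1mod6 :
  w ^+ 2 * H2 r = 20 * v ^+ 2 * k /\
  w * H r = 2 * v * h - 4 * v * q + 144 * v ^+ 2 * q ^+ 2 - 72 * v ^+ 2 * k.
Proof.
have [h1 h2] := H_third_sixth (or_introl (conj hp (erefl (2 * r)%N))).
split; first by rewrite h1 wv -/k; ring.
by rewrite h2 -/h -/k (w_H_half hq) wv; ring.
Qed.

Lemma rho_b x : rho (3 * r) x = 1 + 36 * x * (- 4 * v * q + 144 * v ^+ 2 * q ^+ 2)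
   + 648 * x ^+ 2 * 16 * v ^+ 2 * q ^+ 2.
Proof.
rewrite rhoE -half_1mod6; have hH := w_H_half hq; have h2 := w2_eq0 H2_half.
apply: (lincomb2 (c1 := 36 * x + 648 * x ^+ 2 * (w * H p./2 - 2 * w * q + 36 * w ^+ 2 * q ^+ 2))
  (c2 := - 648 * x ^+ 2) hH h2).
by rewrite wv; ring: v3.
Qed.

Lemma rho_2r x : rho (2 * r) x = 1 + 72 * x * v * h + 2592 * x ^+ 2 * v ^+ 2 * (h ^+ 2 - k).
Proof. by rewrite rhoE wv -/h -/k; ring. Qed.

Lemma rho_r x : rho r x =
  1 + 36 * x * (2 * v * h - 4 * v * q + 144 * v ^+ 2 * q ^+ 2 - 72 * v ^+ 2 * k)
  + 2592 * x ^+ 2 * v ^+ 2 * ((h - 2 * q) ^+ 2 - 5 * k).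
Proof.
have [h2 h1] := H_1mod6; rewrite rhoE.
apply: (lincomb2 (c1 := 36 * x + 648 * x ^+ 2 * (w * H r
   + (2 * v * h - 4 * v * q + 144 * v ^+ 2 * q ^+ 2 - 72 * v ^+ 2 * k)))
  (c2 := - 648 * x ^+ 2) h1 h2).
by ring: v3.
Qed.

Lemma unit_1Bv c : 1 - c * v \is a GRing.unit.
Proof. by rewrite -mulNr mulrC unit_1Dv. Qed.

Lemma unit_rho_r x : 1 + 36 * x * (2 * v * h - 4 * v * q + 144 * v ^+ 2 * q ^+ 2 - 72 * v ^+ 2 * k)
  + 2592 * x ^+ 2 * v ^+ 2 * ((h - 2 * q) ^+ 2 - 5 * k) \is a GRing.unit.
Proof.
set z := (X in X \is a _); have -> : z = 1 + v * (36 * x * (2 * h - 4 * q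
   + 144 * v * q ^+ 2 - 72 * v * k) + 2592 * x ^+ 2 * v * ((h - 2 * q) ^+ 2 - 5 * k)).
  by rewrite /z; ring.
exact: unit_1Dv.
Qed.

Lemma unit_rho_2r x :
  1 + 72 * x * v * h + 2592 * x ^+ 2 * v ^+ 2 * (h ^+ 2 - k) \is a GRing.unit.
Proof.
set z := (X in X \is a _).
have -> : z = 1 + v * (72 * x * h + 2592 * x ^+ 2 * v * (h ^+ 2 - k)) by rewrite /z; ring.
exact: unit_1Dv.
Qed.

Lemma C0_r : 'C(3 * r, r)%:R = C0.
Proof. by rewrite /C0 -[in RHS]bin_sub; [congr 'C(_, _)%:R; lia|lia]. Qed.

Lemma asc_9r : 2 * (asc (9 * r) 1)%:R = 216 * v - 1 :> R.
Proof.
by rewrite asc1 -[(_ * r).+1%:R]natr1 natrM; apply: (lincomb1 (c1 := 3) natr_1mod6); ring.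
Qed.

Lemma asc_7r : 6 * (asc (7 * r) 1)%:R = 504 * v - 1 :> R.
Proof.
by rewrite asc1 -[(_ * r).+1%:R]natr1 natrM; apply: (lincomb1 (c1 := 7) natr_1mod6); ring.
Qed.

Lemma asc_8r : 3 * (asc (8 * r) 1)%:R = 288 * v - 1 :> R.
Proof.
by rewrite asc1 -[(_ * r).+1%:R]natr1 natrM; apply: (lincomb1 (c1 := 4) natr_1mod6); ring.
Qed.

Lemma asc_15r : 4 * (asc (15 * r) 2)%:R = (360 * v - 3) * (360 * v - 1) :> R.
Proof.
rewrite asc2 natrM -[(_ * r).+2%:R]natr1 -[(_ * r).+1%:R]natr1 natrM.
apply: (lincomb1 (c1 := 5 * (2 * (15 * r%:R) + 360 * v + 1)) natr_1mod6).
by ring.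
Qed.

Lemma asc_13r : 36 * (asc (13 * r) 2)%:R = (936 * v - 7) * (936 * v - 1) :> R.
Proof.
rewrite asc2 natrM -[(_ * r).+2%:R]natr1 -[(_ * r).+1%:R]natr1 natrM.
apply: (lincomb1 (c1 := 13 * (6 * (13 * r%:R) + 936 * v + 5)) natr_1mod6).
by ring.
Qed.

Lemma asc_14r : 9 * (asc (14 * r) 2)%:R = (504 * v - 4) * (504 * v - 1) :> R.
Proof.
rewrite asc2 natrM -[(_ * r).+2%:R]natr1 -[(_ * r).+1%:R]natr1 natrM.
apply: (lincomb1 (c1 := 7 * (3 * (14 * r%:R) + 504 * v + 2)) natr_1mod6).
by ring.
Qed.

(* The coefficients below come from expanding the quotients of [rho]-products
   given by [bin_rho] and [bin_rho2] modulo v^3. *)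
Lemma bin_9r_2r : 3 * 'C(9 * r, 2 * r)%:R = C0 * (1 + v * (-288 - 72 * h) +
  v ^+ 2 * (-(972 * 64) + (972 * 16) * k + (648 * 32) * h + (648 * 4) * h ^+ 2)).
Proof.
have := @bin_rho (7 * r) (2 * r) 1 1 r ltac:(lia) ltac:(lia).
have -> : (7 * r + 2 * r = 9 * r)%N by lia.
have -> : (r + 2 * r = 3 * r)%N by lia.
rewrite -/C0 rho_r rho_b; set R1 := 1 + _ + _; set R3 := 1 + _ + _; set C := 'C(_, _)%:R => e.
have {}e : 3 * C * (R1 * (1 - 216 * v)) = C0 * (R3 * (1 - 504 * v)).
  by apply: (lincomb3 (c1 := - 6) (c2 := 3 * C * R1) (c3 := - C0 * R3) e asc_9r asc_7r); ring.
have u : R1 * (1 - 216 * v) \is a GRing.unit.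
  by rewrite unitrM /R1 unit_rho_r unit_1Bv.
apply: (mulIr u); rewrite e -[RHS]mulrA; congr (C0 * _).
by rewrite /R1 /R3; ring: v3.
Qed.

Lemma bin_9r_r : 3 * 'C(9 * r, r)%:R = C0 * (2 + v * (-144 - 288 * q - 144 * h) +
  v ^+ 2 * (-(972 * 32) + (648 * 8) * k + (648 * 32) * q + (972 * 32) * q ^+ 2 +
    (648 * 16) * h + (648 * 32) * h * q + (648 * 8) * h ^+ 2)).
Proof.
have := @bin_rho (8 * r) r 1 1 (2 * r) ltac:(lia) ltac:(lia).
have -> : (8 * r + r = 9 * r)%N by lia.
have -> : (2 * r + r = 3 * r)%N by lia.
rewrite C0_r rho_2r rho_b; set R1 := 1 + _ + _; set R3 := 1 + _ + _; set C := 'C(_, _)%:R => e.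
have {}e : 3 * C * (R1 * (1 - 216 * v)) = C0 * (2 * R3 * (1 - 288 * v)).
  by apply: (lincomb3 (c1 := - 6) (c2 := 3 * C * R1) (c3 := - 2 * C0 * R3) e asc_9r asc_8r); ring.
have u : R1 * (1 - 216 * v) \is a GRing.unit.
  by rewrite unitrM /R1 unit_rho_2r unit_1Bv.
apply: (mulIr u); rewrite e -[RHS]mulrA; congr (C0 * _).
by rewrite /R1 /R3; ring: v3.
Qed.

Lemma bin_15r_2r : 27 * 'C(15 * r, 2 * r)%:R = C0 * (7 + v * (-(516 * 8) - (504 * 2) * h) +
  v ^+ 2 * (-(611 * 576 * 4) + (693 * 576) * k + (387 * 768 * 2) * h + (567 * 128) * h ^+ 2)).
Proof.
have := @bin_rho (13 * r) (2 * r) 2 2 r ltac:(lia) ltac:(lia).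
have -> : (13 * r + 2 * r = 15 * r)%N by lia.
have -> : (r + 2 * r = 3 * r)%N by lia.
rewrite -/C0 rho_r rho_b; set R1 := 1 + _ + _; set R3 := 1 + _ + _; set C := 'C(_, _)%:R => e.
have {}e : 27 * C * (R1 * ((1 - 120 * v) * (1 - 360 * v))) =
  C0 * (R3 * ((7 - 936 * v) * (1 - 936 * v))).
  by apply: (lincomb3 (c1 := 36) (c2 := - 9 * C * R1) (c3 := C0 * R3) e asc_15r asc_13r); ring.
have u : R1 * ((1 - 120 * v) * (1 - 360 * v)) \is a GRing.unit.
  by rewrite !unitrM /R1 unit_rho_r !unit_1Bv.
apply: (mulIr u); rewrite e -[RHS]mulrA; congr (C0 * _).
by rewrite /R1 /R3; ring: v3.
Qed.

Lemma bin_15r_r : 27 * 'C(15 * r, r)%:R = C0 * (16 +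
  v * (-(600 * 4) - (576 * 8) * q - (576 * 4) * h) + v ^+ 2 * (-(359 * 576 * 4) +
    (648 * 256) * k + (675 * 512 * 2) * q + (810 * 512 * 2) * q ^+ 2 + (675 * 512) * h +
      (648 * 512 * 2) * h * q + (648 * 256) * h ^+ 2)).
Proof.
have := @bin_rho (14 * r) r 2 2 (2 * r) ltac:(lia) ltac:(lia).
have -> : (14 * r + r = 15 * r)%N by lia.
have -> : (2 * r + r = 3 * r)%N by lia.
rewrite C0_r rho_2r rho_b; set R1 := 1 + _ + _; set R3 := 1 + _ + _; set C := 'C(_, _)%:R => e.
have {}e : 27 * C * (R1 * ((1 - 120 * v) * (1 - 360 * v))) =
  C0 * (4 * R3 * ((4 - 504 * v) * (1 - 504 * v))).
  by apply: (lincomb3 (c1 := 36) (c2 := - 9 * C * R1) (c3 := 4 * C0 * R3) e asc_15r asc_14r); ring.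
have u : R1 * ((1 - 120 * v) * (1 - 360 * v)) \is a GRing.unit.
  by rewrite !unitrM /R1 unit_rho_2r !unit_1Bv.
apply: (mulIr u); rewrite e -[RHS]mulrA; congr (C0 * _).
by rewrite /R1 /R3; ring: v3.
Qed.

Lemma bin_15r_8r : 27 * 'C(15 * r, 8 * r)%:R = C0 * (4 + v * (-(624 * 2) - 576 * q - 576 * h) +
  v ^+ 2 * (-(747 * 256) + (567 * 128) * k + (702 * 256) * q + (972 * 64) * q ^+ 2 +
    (702 * 256) * h + (648 * 128) * h * q + (648 * 64) * h ^+ 2)).
Proof.
have := @bin_rho2 (7 * r) (8 * r) r (2 * r) ltac:(lia) ltac:(lia) ltac:(lia).
have -> : (7 * r + 8 * r = 15 * r)%N by lia.
have -> : (r + 2 * r = 3 * r)%N by lia.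
rewrite -/C0 rho_r rho_2r rho_b; set R1 := 1 + _ + _; set R2 := 1 + _ + _; set R3 := 1 + _ + _;
  set C := 'C(_, _)%:R => e.
have {}e : 27 * C * (R1 * R2 * ((1 - 120 * v) * (1 - 360 * v))) =
  C0 * (4 * R3 * ((1 - 288 * v) * (1 - 504 * v))).
  have e78 : 18 * (asc (7 * r) 1)%:R * (asc (8 * r) 1)%:R = (504 * v - 1) * (288 * v - 1) :> R.
    by rewrite -asc_7r -asc_8r; ring.
  by apply: (lincomb3 (c1 := 36) (c2 := - 9 * C * R1 * R2) (c3 := 4 * C0 * R3) e asc_15r e78); ring.
have u : R1 * R2 * ((1 - 120 * v) * (1 - 360 * v)) \is a GRing.unit.
  by rewrite !unitrM /R1 /R2 unit_rho_r unit_rho_2r !unit_1Bv.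
apply: (mulIr u); rewrite e -[RHS]mulrA; congr (C0 * _).
by rewrite /R1 /R2 /R3; ring: v3.
Qed.

(** The square root with constant term 1 of the quotient of [legs p (2r - p/3)] by [C0 ^+ 2], to
    order v^2. *)
Let F : R := 1 + v * (48 * q + 36 * h
  + v * (216 * k - 576 * q ^+ 2 + 1728 * h * q + 648 * h ^+ 2)).

(* A closed form for minus the Jacobi sum [jacobi (4 * r)], see [jacobi_jac]. *)
Definition jac : R := C0 * F.

Lemma tsum_1mod6_jac : jac \is a GRing.unit /\
  tsum (- 3^-1) = jac ^+ 2 + P ^+ 2 / jac ^+ 2.
Proof.
have r0 : (0 < r)%N by have := p_gt3; lia.
have rb : (r < p./2)%N by rewrite half_1mod6; lia.
have um : ((2 * r + 1)%:R : R) \is a GRing.unit by rewrite unit_lt //; lia.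
have [hH2r hHr] := H_1mod6.
pose zr := 2 * h - 4 * q + v * (144 * q ^+ 2 - 72 * k).
pose zd := 2 * h + 4 * q - v * (144 * q ^+ 2 - 72 * k).
have {}hHr : w * H r = v * zr by rewrite hHr /zr; ring.
have hD : w * (2 * H (2 * r) - H r) = v * zd.
  by rewrite mulrBr hHr wv /zd /zr -/h; ring.
have hD2 : w ^+ 2 * (4 * H2 (2 * r) - H2 r) = - 4 * v ^+ 2 * k.
  by rewrite mulrBr hH2r wv -/k; ring.
pose Ev := 1 - 6 * v * zr + 18 * v ^+ 2 * (zr ^+ 2 - 20 * k).
pose Od := 1 - 6 * v * zd + 18 * v ^+ 2 * (zd ^+ 2 + 4 * k).
pose X := 1 - 18 * v * zd + 162 * v ^+ 2 * (zd ^+ 2 + 4 * k).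
have hEv : \prod_(i < r) (1 + 36 * w * (- 3^-1 / (2 * i.+1)%:R)) = Ev.
  rewrite prod_even_third ?(ltnW rb) //.
  apply: (lincomb2 (c1 := - 6 + 18 * (w * H r + v * zr)) (c2 := - 18) hHr hH2r).
  by rewrite /Ev; ring.
have hOd : \prod_(i < r) (1 + 36 * w * (- 3^-1 / (2 * i + 1)%:R)) = Od.
  rewrite prod_odd_third ?(ltnW rb) //; move: hD hD2; set D := _ - _; set D2 := _ - _ => hD hD2.
  apply: (lincomb2 (c1 := - 6 + 18 * (w * D + v * zd)) (c2 := - 18) hD hD2).
  by rewrite /Od; ring.
have hX : C0 ^+ 2 = cbin4 R r ^+ 2 * X ^+ 2.
  rewrite -C0_r -half_1mod6 (bin_cbin4 (ltnW rb)) exprMn exprMn sqrr_sign mul1r; congr (_ * _ ^+ 2).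
  rewrite prod_odd_minus ?(ltnW rb) //; move: hD hD2; set D := _ - _; set D2 := _ - _ => hD hD2.
  apply: (lincomb2 (c1 := - 18 + 162 * (w * D + v * zd)) (c2 := - 162) hD hD2).
  by rewrite /X; ring.
have he := legs_even (- 3^-1) (ltnW rb).
rewrite hEv hOd (legs_third hq) in he.
have hF : F ^+ 2 * Ev ^+ 2 * X ^+ 2 = Od ^+ 2 * (1 + 24 * w * q - 144 * w ^+ 2 * q ^+ 2).
  by rewrite wv /F /Od /Ev /X /zr /zd; ring: v3.
have uEv : Ev ^+ 2 \is a GRing.unit.
  apply: unitrX; have -> : Ev = 1 + v * (- 6 * zr + 18 * v * (zr ^+ 2 - 20 * k)).
    by rewrite /Ev; ring.
  exact: unit_1Dv.
have ug := cbin4_unit (ltnW rb).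
have uF : F \is a GRing.unit by apply: unit_1Dv.
have uX : X \is a GRing.unit.
  have -> : X = 1 + v * (- 18 * zd + 162 * v * (zd ^+ 2 + 4 * k)) by rewrite /X; ring.
  exact: unit_1Dv.
have uC : C0 \is a GRing.unit by rewrite -(@unitrX_pos _ _ 2) // hX unitrM !unitrX.
have uj : jac \is a GRing.unit by rewrite unitrM uC.
split=> //; rewrite (tsum_1mod6 hp).
have -> : legs p ((2 * r)%:R + P * - 3^-1) = jac ^+ 2.
  apply: (mulIr uEv); have -> : jac ^+ 2 = C0 ^+ 2 * F ^+ 2 by rewrite -exprMn.
  rewrite he hX.
  by apply: (lincomb1 (c1 := - cbin4 R r ^+ 2) hF); ring.
rewrite (legs_odd (- 3^-1) rb).
(* Modulo p, 2r + 1 = 2/3 and t = -1/3, so this value is -P^2/2 divided by the square of [jac]; the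
   factor -2 in front makes it P^2 / [jac]^2. *)
set y := (X in _ - 2 * X); have -> : y = - 648 * w ^+ 2 / jac ^+ 2.
  apply: eq_divr; [by rewrite unitrM !unitrX|by rewrite unitrX|].
  have hm : 3 * (2 * r + 1)%:R = 72 * v + 2 :> R.
    by rewrite natrD natrM; apply: (lincomb1 (c1 := 1) natr_1mod6); ring.
  have := third_t; have -> : jac ^+ 2 = C0 ^+ 2 * F ^+ 2 by rewrite -exprMn.
  rewrite hX; move: (- 3^-1) (2 * r + 1)%:R hm => t m hm ht.
  rewrite P72v wv.
  apply: (lincomb2 (c1 := 576 * v ^+ 2 * cbin4 R r ^+ 2 * X ^+ 2 * F ^+ 2 * (3 * t + 2))
    (c2 := 288 * v ^+ 2 * cbin4 R r ^+ 2 * (3 * m + 72 * v + 2)) ht hm).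
  by rewrite /X /F; ring: v3.
by rewrite P72v wv; ring.
Qed.

(* The left-hand side is the expression that [jacobi_interpolation] gives for the
   Jacobi sum. *)
Lemma jac_interpolation (t : nat) : t = (3 * r * (p + 1))%N ->
  (P - 1) * ((1 - t%:R + 'C(t, 2)%:R) * C0
             + (t%:R - 2 * 'C(t, 2)%:R) * ('C(9 * r, 2 * r)%:R + 'C(9 * r, 8 * r)%:R)
             + 'C(t, 2)%:R * ('C(15 * r, 2 * r)%:R + 'C(15 * r, 8 * r)%:R + 'C(15 * r, 14 * r)%:R))
  = - jac.
Proof.
move=> ht; have r0 : (0 < r)%N by have := p_gt3; lia.
have e1 : 'C(9 * r, 8 * r) = 'C(9 * r, r) by rewrite -bin_sub; [congr 'C(_, _); lia|lia].
have e2 : 'C(15 * r, 14 * r) = 'C(15 * r, r) by rewrite -bin_sub; [congr 'C(_, _); lia|lia].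
(* 216 = 8 * 27: the factor 8 clears the interpolation weights, 27 the closed forms of the
   binomials. *)
have u : (216 : R) \is a GRing.unit.
  by rewrite (_ : 216 = 2 ^+ 3 * 3 ^+ 3) ?unitrM ?unitrX ?unit2 ?unit3 //; ring.
have hT : 2 * t%:R = P ^+ 2 - 1 :> R.
  rewrite ht !natrM natrD; apply: (lincomb2 (c1 := P + 1) (c2 := - P - 1) natr_1mod6 P72v); ring.
have hC : 2 * 'C(t, 2)%:R = t%:R * (t%:R - 1) :> R.
  have t0 : (0 < t)%N by rewrite ht; lia.
  have := mul_bin_left t 1; rewrite bin1 => /(congr1 (fun i : nat => i%:R : R)).
  by rewrite !natrM natrB // => ->; ring.
rewrite e1 e2; apply: (mulrI u); move: hT hC; move: (t%:R) ('C(t, 2)%:R) => T c hT hC.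
have h8 : 8 * c = 3 - 4 * P ^+ 2.
  by apply: (lincomb2 (c1 := 4) (c2 := 2 * T + P ^+ 2 - 3) hC hT); ring: P3.
have h4 : 8 * (1 - T + c) = 15 - 8 * P ^+ 2.
  by apply: (lincomb2 (c1 := 1) (c2 := - 4) h8 hT); ring.
have h6 : 8 * (T - 2 * c) = 12 * P ^+ 2 - 10.
  by apply: (lincomb2 (c1 := - 2) (c2 := 4) h8 hT); ring.
rewrite [LHS](_ : _ = (P - 1) * (27 * (8 * (1 - T + c)) * C0
   + 9 * (8 * (T - 2 * c)) * (3 * 'C(9 * r, 2 * r)%:R + 3 * 'C(9 * r, r)%:R)
   + 8 * c * (27 * 'C(15 * r, 2 * r)%:R + 27 * 'C(15 * r, 8 * r)%:R + 27 * 'C(15 * r, r)%:R)));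
     last by ring.
rewrite h8 h4 h6 bin_9r_2r bin_9r_r bin_15r_2r bin_15r_r bin_15r_8r /jac P72v.
by move: C0 => c0; rewrite /F; ring: v3.
Qed.

End OneModSix.

(** * Jacobi sums of Teichmüller characters *)

Section Teichmuller.

Definition congP (e : nat) (x y : R) := exists z, x = y + P ^+ e * z.

Lemma congP_exp x y n : congP 1 x y -> congP 1 (x ^+ n) (y ^+ n).
Proof.
case=> z ->; elim: n => [|n [u hu]]; first by exists 0; rewrite !expr0 mulr0 addr0.
by exists (u * y + z * (y ^+ n + P * u)); rewrite (exprSr _ n) hu [y ^+ n.+1]exprSr; ring.
Qed.

(** x^p - y^p is x - y times a sum of p terms, each congruent to y^(p-1) modulo p, so one more
    factor p appears. *)
Lemma congP_expp e x y : congP e.+1 x y -> congP e.+2 (x ^+ p) (y ^+ p).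
Proof.
case=> z ->; have hpow j : exists u, (y + P ^+ e.+1 * z) ^+ j = y ^+ j + P * u.
  elim: j => [|j [u hu]]; first by exists 0; rewrite !expr0 mulr0 addr0.
  exists (u * y + P ^+ e * z * (y ^+ j + P * u));
    rewrite (exprSr _ j) hu [y ^+ j.+1]exprSr [P ^+ e.+1]exprS; ring.
pose S := \sum_(i < p) (y + P ^+ e.+1 * z) ^+ (p.-1 - i) * y ^+ i.
have [u hS] : exists u, S = P * u.
  suff [u hS] : exists u, S = p%:R * y ^+ p.-1 + P * u.
    by exists (y ^+ p.-1 + u); rewrite hS; ring.
  have aux n : (n <= p)%N -> exists u, \sum_(i < n) (y + P ^+ e.+1 * z) ^+ (p.-1 - i) * y ^+ i
     = n%:R * y ^+ p.-1 + P * u.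
    elim: n => [|n IHn] np; first by exists 0; rewrite big_ord0; ring.
    have [u1 h1] := IHn (ltnW np); have [u2 h2] := hpow (p.-1 - n)%N.
    exists (u1 + u2 * y ^+ n); rewrite big_ord_recr /= h1 h2 -natr1.
    have hy : y ^+ (p.-1 - n) * y ^+ n = y ^+ p.-1 by rewrite -exprD subnK //; lia.
    by apply: (lincomb1 (c1 := 1) hy); ring.
  exact: aux.
exists (z * u); have := subrXX (y + P ^+ e.+1 * z) y p.
rewrite -/S hS => h.
by apply: (lincomb1 (c1 := 1) h); rewrite [P ^+ e.+2]exprS; ring.
Qed.

Lemma congP_expp2 x y : congP 1 x y -> x ^+ (p ^ 2) = y ^+ (p ^ 2).
Proof.
move=> /congP_expp /congP_expp [z]; rewrite -!exprM => ->.
by rewrite P3 mul0r addr0.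
Qed.

Lemma congP_nat a b : a%:R = b%:R :> 'F_p -> congP 1 a%:R b%:R.
Proof.
move=> h; have {h} : a = b %[mod p] by rewrite -!val_Fp_nat // h.
rewrite {2}(divn_eq a p) {2}(divn_eq b p) => h; exists ((a %/ p)%:R - (b %/ p)%:R).
by rewrite !natrD h !natrM; ring.
Qed.

Lemma congP_unit x y : congP 1 x y -> y \is a GRing.unit -> x \is a GRing.unit.
Proof.
case=> z -> uy; apply/unitrP; exists (y^-1 * (1 - P * z * y^-1 + (P * z * y^-1) ^+ 2)).
have hv := mulrV uy; move: (y^-1) hv => u hu.
have key : (y + P ^+ 1 * z) * (u * (1 - P * z * u + (P * z * u) ^+ 2)) = 1.
  by apply: (lincomb1 (c1 := 1 - P * z * u + (P * z * u) ^+ 2) hu); ring: P3.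
by split=> //; rewrite mulrC.
Qed.

(* The Teichmüller lift, as a^(p^2) only depends on a modulo p in Z/p^3. *)
Definition teich (x : 'F_p) : R := (x : nat)%:R ^+ (p ^ 2).

Lemma natr_Fp (x : 'F_p) : (x : nat)%:R = x.
Proof. exact: natr_Zp. Qed.

Lemma teich0 : teich 0 = 0.
Proof. by rewrite /teich expr0n expn_eq0 /= eqn0Ngt prime_gt0. Qed.

Lemma teich1 : teich 1 = 1.
Proof. exact: expr1n. Qed.

Lemma teichM x y : teich (x * y) = teich x * teich y.
Proof.
rewrite /teich -exprMn -natrM; apply: congP_expp2; apply: congP_nat.
by rewrite natrM !natr_Fp.
Qed.

Lemma teichX x n : teich (x ^+ n) = teich x ^+ n.
Proof.
elim: n => [|n IHn]; first by rewrite !expr0 teich1.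
by rewrite !exprS teichM IHn.
Qed.

Lemma teichN1 : teich (-1) = -1.
Proof.
have -> : -1 = (-1) ^+ (p ^ 2) :> R.
  have po : odd p by case: (even_prime p_prime) => // p2; move: p_gt3; rewrite p2.
  by rewrite -signr_odd oddX po.
apply: congP_expp2.
have : congP 1 (nat_of_ord (- 1 : 'F_p)%R)%:R p.-1%:R.
  apply: congP_nat; rewrite natr_Fp.
  have p1 : p.-1%:R + 1 = 0 :> 'F_p by rewrite natr1 prednK ?prime_gt0 // pchar_Fp_0 //.
  by apply/esym/eqP; rewrite -addr_eq0 p1.
case=> z ->; exists (1 + z); have hP : P = p.-1%:R + 1 by rewrite natr1 prednK ?prime_gt0.
by rewrite mulrDr mulr1 expr1; apply: (lincomb1 (c1 := - 1) hP); ring.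
Qed.

Lemma teich_congr x : congP 1 (teich x) (x : nat)%:R.
Proof.
rewrite /teich -natrX; apply: congP_nat; rewrite natrX natr_Fp.
have h : x ^+ p = x by rewrite -[X in _ ^+ X](card_Fp p_prime) finfield.expf_card.
by rewrite expnS expn1 exprM !h.
Qed.

Lemma teich_unit x : x != 0 -> teich x \is a GRing.unit.
Proof.
move=> x0; apply: (congP_unit (teich_congr x)); apply: unitN; apply/negP => px.
by move/eqP: x0; apply; rewrite -[x]natr_Fp; apply/eqP; rewrite -(dvdn_pcharf (pchar_Fp p_prime)).
Qed.

Lemma teich_expp1 x : x != 0 -> teich x ^+ p.-1 = 1.
Proof.
move=> x0; rewrite -teichX -teich1; congr teich.
have h : x ^+ p = x by rewrite -[X in _ ^+ X](card_Fp p_prime) finfield.expf_card.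
by apply: (mulfI x0); rewrite -exprS prednK ?prime_gt0 // h mulr1.
Qed.

Lemma congP_1B_teich x : congP 1 (1 - teich x) (teich (1 - x)).
Proof.
have [z hz] := teich_congr x; have [u hu] := teich_congr (1 - x).
have [z' hz'] : congP 1 (nat_of_ord (1 - x)%R + x)%:R 1%:R.
  by apply: congP_nat; rewrite natrD !natr_Fp subrK.
exists (- z - z' - u); rewrite hz hu; apply: (lincomb1 (c1 := - 1) hz').
by rewrite natrD; ring.
Qed.

Lemma teich_1B x : teich (1 - x) = (1 - teich x) ^+ (p ^ 2).
Proof.
rewrite (congP_expp2 (congP_1B_teich x)) -teichX; congr teich.
have h y : y ^+ p = y :> 'F_p by rewrite -[X in _ ^+ X](card_Fp p_prime) finfield.expf_card.
by rewrite expnS expn1 exprM !h.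
Qed.

Lemma teich_neq1 x : x != 1 -> 1 - teich x \is a GRing.unit.
Proof.
move=> x1; have p0 : (0 < p ^ 2)%N by rewrite expn_gt0 prime_gt0.
by rewrite -(unitrX_pos _ p0) -teich_1B teich_unit // subr_eq0 eq_sym.
Qed.

Lemma card_Fp_neq0 : #|[pred x : 'F_p | x != 0]| = p.-1.
Proof.
have := cardC1 (0 : 'F_p); rewrite (card_Fp p_prime) => <-.
by apply: eq_card => x; rewrite !inE.
Qed.

(** Otherwise all p - 1 nonzero residues would be roots of unity of order k mod (p-1), a positive
    number below p - 1. *)
Lemma exists_expf_neq1 k : ~~ (p.-1 %| k)%N -> exists2 x : 'F_p, x != 0 & x ^+ k != 1.
Proof.
move=> hk; apply/exists_inP; apply: contraT.
rewrite negb_exists_in => /forall_inP h; exfalso.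
have m0 : (0 < k %% p.-1)%N by rewrite lt0n.
have := @max_unity_roots _ _ (enum [pred x : 'F_p | x != 0]) m0.
have -> : all (k %% p.-1).-unity_root (enum [pred x : 'F_p | x != 0]).
  apply/allP => x; rewrite mem_enum inE => x0; apply/unity_rootP.
  have := h x x0; rewrite negbK => /eqP; rewrite {1}(divn_eq k p.-1) exprD mulnC exprM.
  have hx : x ^+ p = x by rewrite -[X in _ ^+ X](card_Fp p_prime) finfield.expf_card.
  have -> : x ^+ p.-1 = 1 by apply: (mulfI x0); rewrite -exprS prednK ?prime_gt0 // hx mulr1.
  by rewrite expr1n mul1r.
move=> /(_ isT (enum_uniq _)); rewrite -cardE.
by rewrite card_Fp_neq0 leqNgt ltn_pmod //; have := p_gt3; lia.
Qed.

(** Orthogonality by the substitution x -> gx. As R has zero divisors, cancelling 1 -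
    [teich (g ^+ k)] relies on [teich_neq1]. *)
Lemma sum_teichX k : (0 < k)%N ->
  \sum_(x : 'F_p) teich x ^+ k = if (p.-1 %| k)%N then P - 1 else 0.
Proof.
move=> k0; case: ifPn => hk.
  rewrite (bigD1 0) //= teich0 expr0n (gtn_eqF k0) add0r.
  rewrite (eq_bigr (fun _ => 1)) => [|x x0]; last first.
    by case/dvdnP: hk => j ->; rewrite mulnC exprM teich_expp1 // expr1n.
  rewrite sumr_const card_Fp_neq0 -[in RHS](prednK (prime_gt0 p_prime)) -natr1.
  by rewrite addrK.
have [g g0 gk] := exists_expf_neq1 hk.
have u : 1 - teich (g ^+ k) \is a GRing.unit by apply: teich_neq1.
apply: (mulrI u); rewrite mulr0 mulrBl mul1r mulr_sumr.
rewrite [X in X - _](reindex_inj (mulfI g0)) /= -sumrB big1 // => x _.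
by rewrite teichM teichX exprMn subrr.
Qed.

Lemma sum_teich_bin (e n : nat) : (0 < e)%N ->
  \sum_(x : 'F_p) teich x ^+ e * (1 - teich x) ^+ n =
  (P - 1) * \sum_(i < n.+1 | (p.-1 %| e + i)%N) (-1) ^+ i * 'C(n, i)%:R.
Proof.
move=> e0.
transitivity (\sum_(i < n.+1) (-1) ^+ i * 'C(n, i)%:R * \sum_(x : 'F_p) teich x ^+ (e + i)).
  rewrite [RHS](eq_bigr (fun i : 'I_n.+1 =>
    \sum_(x : 'F_p) (-1) ^+ i * 'C(n, i)%:R * teich x ^+ (e + i))) => [|i _];
      last by rewrite mulr_sumr.
  rewrite exchange_big /=; apply: eq_bigr => x _; rewrite exprBn mulr_sumr.
  apply: eq_bigr => i _; rewrite expr1n mulr1 -mulr_natr exprD; ring.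
rewrite mulr_sumr [RHS]big_mkcond /=; apply: eq_bigr => i _; rewrite sum_teichX ?addn_gt0 ?e0 //.
by case: ifP => _; rewrite ?mulr0 // mulrC.
Qed.

Lemma expr_1DP z t : (1 + P * z) ^+ t = 1 + t%:R * (P * z) + 'C(t, 2)%:R * (P * z) ^+ 2.
Proof.
elim: t => [|t IHt]; first by rewrite expr0 bin0n mulr0n !mul0r !addr0.
by rewrite exprS IHt binS bin1 -natr1 natrD; ring: P3.
Qed.

(* Quadratic Lagrange interpolation of y^t from t = 0, 1, 2, exact since P^3 = 0. *)
Lemma expr_1DP_interpolation (y : R) (t : nat) : (exists z, y = 1 + P * z) ->
  y ^+ t = (1 - t%:R + 'C(t, 2)%:R) + (t%:R - 2 * 'C(t, 2)%:R) * y + 'C(t, 2)%:R * y ^+ 2.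
Proof. by case=> z ->; rewrite expr_1DP; ring. Qed.

Variables (r : nat) (q : R).
Hypotheses (hp : p = (6 * r + 1)%N) (hq : 2 ^+ p.-1 = 1 + P * q).

Let r0 : (0 < r)%N. Proof. by have := p_gt3; lia. Qed.

Let p1 : p.-1 = (6 * r)%N. Proof. by lia. Qed.

(** Since p - 1 = 6r, the condition says that i = 2r modulo 6r. *)
Lemma sum_residue (F : nat -> R) m :
  \sum_(i < (3 * r + 6 * r * m).+1 | (p.-1 %| 4 * r + i)%N) F i =
  \sum_(j < m.+1) F (2 * r + 6 * r * j)%N.
Proof.
have r_gt0 := r0; rewrite p1; elim: m => [|m IHm].
  have hi : (2 * r < (3 * r + 6 * r * 0).+1)%N by lia.
  rewrite (bigD1 (Ordinal hi)) /=; last by apply/dvdnP; exists 1%N; lia.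
  rewrite big_ord1 [X in _ + X]big1 => [|i /andP[/dvdnP[d hd] /eqP]].
    by rewrite addr0 muln0 addn0.
  case; apply: val_inj => /=; have := ltn_ord i.
  by case: d hd => [|[|d]]; rewrite ?mulSn ?mul0n; lia.
rewrite big_ord_recr /= -IHm (_ : (3 * r + 6 * r * m.+1).+1 = (3 * r + 6 * r * m).+1 +
  6 * r)%N; last by lia.
rewrite big_mkcond big_split_ord /= -!big_mkcond /=; congr (_ + _).
have hi : (5 * r - 1 < 6 * r)%N by lia.
rewrite (bigD1 (Ordinal hi)) /=; last by apply/dvdnP; exists (m + 2)%N; nia.
rewrite [X in _ + X]big1 ?addr0 => [|i /andP[hd /eqP]].
  by congr F; lia.
case; apply: val_inj => /=; have := ltn_ord i; move: hd.
have -> : (4 * r + ((3 * r + 6 * r * m).+1 + i) = 6 * r * m.+1 + (r + i).+1)%N by lia.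
rewrite dvdn_addr; last exact: dvdn_mulr.
move=> /dvdnP[d]; by case: d => [|[|d]]; rewrite ?mulSn ?mul0n; lia.
Qed.

(** The exponent 3r = (p-1)/2 gives the quadratic character; e = 2r and e = 4r give the two cubic
    characters, inverse to each other. *)
Definition jacobi (e : nat) : R := \sum_(x : 'F_p) teich x ^+ e * teich (1 - x) ^+ (3 * r).

(* teich (1 - x)^(3r) = (1 - teich x)^(3r p^2) and 3r p^2 = 3r + 6r t, where
   (1 - teich x)^(6r) = 1 modulo p unless x = 1: interpolate in t. *)
Lemma jacobi_interpolation (t : nat) : t = (3 * r * (p + 1))%N ->
  jacobi (4 * r) = (P - 1) * ((1 - t%:R + 'C(t, 2)%:R) * 'C(3 * r, 2 * r)%:R
    + (t%:R - 2 * 'C(t, 2)%:R) * ('C(9 * r, 2 * r)%:R + 'C(9 * r, 8 * r)%:R)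
    + 'C(t, 2)%:R * ('C(15 * r, 2 * r)%:R + 'C(15 * r, 8 * r)%:R + 'C(15 * r, 14 * r)%:R)).
Proof.
move=> ht; have r_gt0 := r0.
pose S n := \sum_(x : 'F_p) teich x ^+ (4 * r) * (1 - teich x) ^+ n.
have hJ : jacobi (4 * r) = (1 - t%:R + 'C(t, 2)%:R) * S (3 * r)%N
   + (t%:R - 2 * 'C(t, 2)%:R) * S (9 * r)%N + 'C(t, 2)%:R * S (15 * r)%N.
  rewrite /S !mulr_sumr -!big_split /=; apply: eq_bigr => x _.
  have -> : teich (1 - x) ^+ (3 * r) =
    (1 - teich x) ^+ (p ^ 2 * (3 * r)) by rewrite teich_1B [RHS]exprM.
  have -> : (p ^ 2 * (3 * r) = 3 * r + 6 * r * t)%N by rewrite ht hp; ring.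
  have [->|x1] := eqVneq x 1.
    by rewrite teich1 subrr !expr0n !addn_eq0 !muln_eq0 (gtn_eqF r_gt0) /= !mulr0 !addr0.
  rewrite exprD [_ ^+ (6 * r * t)]exprM (@expr_1DP_interpolation _ t).
    have -> : (9 * r = 3 * r + 6 * r)%N by lia.
    have -> : (15 * r = 3 * r + 6 * r + 6 * r)%N by lia.
    by rewrite !exprD; ring.
  have [z hz] := congP_exp (6 * r) (congP_1B_teich x); exists z.
  by rewrite hz -p1 teich_expp1 // subr_eq0 eq_sym.
have hS m : S (3 * r + 6 * r * m)%N =
    (P - 1) * \sum_(j < m.+1) 'C(3 * r + 6 * r * m, 2 * r + 6 * r * j)%:R.
  rewrite /S sum_teich_bin; last by lia.
  rewrite (sum_residue (fun i => (-1) ^+ i * 'C(3 * r + 6 * r * m, i)%:R)).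
  congr (_ * _); apply: eq_bigr => j _.
  by rewrite -signr_odd oddD !oddM /= mul1r.
have := hS 0%N; have := hS 1%N; have := hS 2; rewrite !big_ord_recr !big_ord0 /= !add0r.
have -> : (3 * r + 6 * r * 0 = 3 * r)%N by lia.
have -> : (3 * r + 6 * r * 1 = 9 * r)%N by lia.
have -> : (3 * r + 6 * r * 2 = 15 * r)%N by lia.
have -> : (2 * r + 6 * r * 0 = 2 * r)%N by lia.
have -> : (2 * r + 6 * r * 1 = 8 * r)%N by lia.
have -> : (2 * r + 6 * r * 2 = 14 * r)%N by lia.
by rewrite hJ => -> -> ->; ring.
Qed.

Lemma jacobi_jac : jacobi (4 * r) = - jac r q.
Proof.
rewrite (jacobi_interpolation erefl).
exact: (jac_interpolation hp hq erefl).
Qed.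

(** * The quadratic character and the product of conjugate Jacobi sums *)

Let eta (x : 'F_p) : R := teich x ^+ (3 * r).

Lemma etaM x y : eta (x * y) = eta x * eta y.
Proof. by rewrite /eta teichM exprMn. Qed.

Lemma eta0 : eta 0 = 0.
Proof. by rewrite /eta teich0 expr0n muln_eq0 (gtn_eqF r0). Qed.

Lemma eta1 : eta 1 = 1.
Proof. by rewrite /eta teich1 expr1n. Qed.

Lemma eta_sq x : x != 0 -> eta x * eta x = 1.
Proof. by move=> x0; rewrite -exprD (_ : (_ + _ = p.-1)%N) ?teich_expp1 //; lia. Qed.

Lemma sum_teichX0 (c d : nat) : (0 < c < 6)%N -> (c + 6 * d > 0)%N ->
  \sum_(x : 'F_p) teich x ^+ ((c + 6 * d) * r) = 0.
Proof.
move=> hc hd; have r_gt0 := r0; rewrite sum_teichX ?muln_gt0 ?hd ?r_gt0 // p1 ifN //.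
rewrite dvdn_pmul2r // dvdn_addl ?dvdn_mulr // gtnNdvd; lia.
Qed.

Lemma sum_eta : \sum_(x : 'F_p) eta x = 0.
Proof. by have := @sum_teichX0 3 0 isT isT. Qed.

(** With y = 1 - u the argument is u^2 times (1-z)/u + z, and [eta] ignores the square. For z != 1
    this runs over everything except z, so the full sum is -[eta z]; removing y = 0 subtracts 1. *)
Lemma sum_eta_quad (z : 'F_p) :
  \sum_(y : 'F_p | y != 0) eta ((1 - y * z) * (1 - y)) =
  if z == 1 then P - 2 else - eta z - 1.
Proof.
have subr_bij : injective (fun u : 'F_p => 1 - u) by move=> u u' /addrI/oppr_inj.
have hfull : \sum_(y : 'F_p) eta ((1 - y * z) * (1 - y)) =
    \sum_(u : 'F_p | u != 0) eta ((1 - z) * u^-1 + z).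
  rewrite (reindex_inj subr_bij) (bigD1 0) //= subr0 subrr mulr0 eta0 add0r.
  apply: eq_bigr => u u0.
  have -> : (1 - (1 - u) * z) * (1 - (1 - u)) = ((1 - z) * u^-1 + z) * (u * u).
    by field.
  by rewrite etaM [eta (u * u)]etaM eta_sq // mulr1.
transitivity (\sum_(u : 'F_p | u != 0) eta ((1 - z) * u^-1 + z) - 1).
  by rewrite -hfull [in RHS](bigD1 0) //= mul0r subr0 mul1r eta1 addrAC subrr add0r.
have [->|z1] := eqVneq z 1.
  rewrite (eq_bigr (fun=> 1)) => [|u u0]; last by rewrite subrr mul0r add0r eta1.
  rewrite sumr_const card_Fp_neq0; have hP : P = p.-1%:R + 1 by rewrite natr1 prednK ?prime_gt0.
  by rewrite hP; ring.
have inj : injective (fun u : 'F_p => (1 - z) * u^-1 + z).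
  have z1' : 1 - z != 0 by rewrite subr_eq0 eq_sym.
  by move=> u u' /addIr/(mulfI z1')/invr_inj.
have := sum_eta; rewrite (reindex_inj inj) (bigD1 0) //= invr0 mulr0 add0r.
by move/eqP; rewrite addrC addr_eq0 => /eqP ->.
Qed.

(** Substituting yz for the variable of the sum with exponent 4r cancels the cubic characters of y,
    and [sum_eta_quad] sums over y. The characters [chi] and [chi * eta] are nontrivial and sum to
    0, so only z = 1 contributes: (P - 2) + 2. *)
Lemma jacobi_mul : jacobi (4 * r) * jacobi (2 * r) = P.
Proof.
have r_gt0 := r0; pose chi (x : 'F_p) := teich x ^+ (4 * r).
transitivity (\sum_(y : 'F_p | y != 0) \sum_(z : 'F_p) chi z * eta ((1 - y * z) * (1 - y))).
  rewrite mulrC /jacobi mulr_suml (bigD1 0) //= teich0 expr0n muln_eq0 (gtn_eqF r_gt0) !mul0r add0r.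
  apply: eq_bigr => y y0; rewrite mulr_sumr (reindex_inj (mulfI y0)) /=.
  apply: eq_bigr => z _; rewrite /chi etaM -!/(eta _) teichM exprMn.
  have h : teich y ^+ (2 * r) * teich y ^+ (4 * r) = 1.
    by rewrite -exprD (_ : (_ + _ = p.-1)%N) ?teich_expp1 //; lia.
  by apply: (lincomb1 (c1 := eta (1 - y) * teich z ^+ (4 * r) * eta (1 - y * z)) h); ring.
rewrite exchange_big /=.
transitivity (\sum_(z : 'F_p) chi z * (if z == 1 then P - 2 else - eta z - 1)).
  by apply: eq_bigr => z _; rewrite -sum_eta_quad mulr_sumr.
have hchi : \sum_(z : 'F_p) chi z = 0 by have := @sum_teichX0 4 0 isT isT.
have hce : \sum_(z : 'F_p) chi z * eta z = 0.
  rewrite -[RHS](@sum_teichX0 1 1 isT isT); apply: eq_bigr => z _.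
  by rewrite -exprD; congr (_ ^+ _); lia.
have hsum : \sum_(z : 'F_p) chi z * (- eta z - 1) = 0.
  transitivity (- \sum_(z : 'F_p) chi z * eta z - \sum_(z : 'F_p) chi z).
    by rewrite -sumrN -sumrB; apply: eq_bigr => z _; ring.
  by rewrite hce hchi oppr0 addr0.
rewrite (bigD1 1) //= (eq_bigr (fun z => chi z * (- eta z - 1))); last first.
  by move=> z /negPf->.
move: hsum; rewrite (bigD1 1) //= eta1.
have -> : chi 1 = 1 by rewrite /chi teich1 expr1n.
move: (\sum_(i | _) _) => s hs; apply: (lincomb1 (c1 := 1) hs); ring.
Qed.

(** * The Jacobi sum as an integer combination of cube roots of unity *)

Definition quad_sign (x : 'F_p) : int :=
  if x == 0 then 0 else if x ^+ (3 * r) == 1 then 1 else -1.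

Lemma eta_sign x : eta x = (quad_sign x)%:~R.
Proof.
rewrite /quad_sign; have [->|x0] := eqVneq x 0; first by rewrite eta0.
have xp : x ^+ p.-1 = 1.
  have h : x ^+ p = x by rewrite -[X in _ ^+ X](card_Fp p_prime) finfield.expf_card.
  by apply: (mulfI x0); rewrite -exprS prednK ?prime_gt0 // h mulr1.
have [x1|x1] := eqVneq (x ^+ (3 * r)) 1; first by rewrite /eta -teichX x1 teich1.
have : (x ^+ (3 * r)) ^+ 2 == 1 by rewrite -exprM (_ : (_ * 2 = p.-1)%N) ?xp //; lia.
rewrite sqrf_eq1 (negPf x1) /= => /eqP h.
by rewrite /eta -teichX h teichN1 rmorphN1.
Qed.

Lemma quad_sign_odd x : x != 0 -> exists k, quad_sign x = 2 * k + 1.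
Proof.
by rewrite /quad_sign => /negPf->; case: ifP => _; [exists 0|exists (-1)].
Qed.

Lemma quad_sign_le1 x : `|quad_sign x| <= 1.
Proof. by rewrite /quad_sign; do 2?case: ifP. Qed.

(* Integer coordinates of the Jacobi sum on the cubic roots of unity. *)
Definition class_sum (c : 'F_p) : int := \sum_(x : 'F_p | x ^+ (2 * r) == c) quad_sign (1 - x).

Lemma class_sum_le c : `|class_sum c| <= p%:Z.
Proof.
apply: (le_trans (ler_norm_sum _ _ _)).
apply: (@le_trans _ _ (\sum_(x : 'F_p) 1));
  last by rewrite sumr_const card_Fp // -mulr_natr mul1r natz.
rewrite big_mkcond /=; apply: ler_sum => x _; case: ifP => _ //; exact: quad_sign_le1.
Qed.

Lemma cubic_root_unity : exists2 o : 'F_p, 1 + o + o ^+ 2 = 0 & o != 1.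
Proof.
have r_gt0 := r0.
have [|g g0 g1] := @exists_expf_neq1 (2 * r).
  by rewrite p1 gtnNdvd //; lia.
exists (g ^+ (2 * r)) => //; apply: (mulfI (_ : g ^+ (2 * r) - 1 != 0)); first by rewrite subr_eq0.
have gp : g ^+ p.-1 = 1.
  have h : g ^+ p = g by rewrite -[X in _ ^+ X](card_Fp p_prime) finfield.expf_card.
  by apply: (mulfI g0); rewrite -exprS prednK ?prime_gt0 // h mulr1.
rewrite mulr0; transitivity ((g ^+ (2 * r)) ^+ 3 - 1); first by ring.
by rewrite -exprM (_ : (_ * 3 = p.-1)%N) ?gp ?subrr //; lia.
Qed.

(** Nonzero x are grouped by the cube root of unity x^(2r); the exponent 4r squares it and so
    exchanges t and t^2. The relation 1 + t + t^2 = 0 follows from t^3 = 1 because 1 - t is a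
    unit. *)
Lemma jacobi_class_sum (o : 'F_p) (t : R) : 1 + o + o ^+ 2 = 0 -> o != 1 -> t = teich o ->
  [/\ 1 + t + t ^+ 2 = 0,
   jacobi (2 * r) = (class_sum 1)%:~R + t * (class_sum o)%:~R + t ^+ 2 * (class_sum (o ^+ 2))%:~R &
   jacobi (4 * r) = (class_sum 1)%:~R + t ^+ 2 * (class_sum o)%:~R + t * (class_sum (o ^+ 2))%:~R].
Proof.
move=> ho o1 ht; have r_gt0 := r0.
have o3 : o ^+ 3 = 1 by apply: (lincomb1 (c1 := o - 1) ho); ring.
have t3 : t ^+ 3 = 1 by rewrite ht -teichX o3 teich1.
have hT : 1 + t + t ^+ 2 = 0.
  apply: (mulrI (teich_neq1 o1)); rewrite mulr0 -ht.
  by apply: (lincomb1 (c1 := -1) t3); ring.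
have o0 : o != 0 by apply: contra_eqN o3 => /eqP->; rewrite expr0n eq_sym oner_eq0.
have o2 : o ^+ 2 != 1.
  by apply: contraNneq o1 => h; rewrite -o3 exprS h mulr1.
have o2o : o ^+ 2 != o.
  by apply: contraNneq o1 => h; apply/eqP; apply: (mulfI o0); rewrite mulr1 -expr2.
have o20 : o ^+ 2 != 0 by rewrite expf_neq0.
have z0 : 0 ^+ (2 * r) = 0 :> 'F_p by rewrite expr0n muln_eq0 (gtn_eqF r_gt0).
have split (x : 'F_p) : [\/ x = 0, x ^+ (2 * r) = 1, x ^+ (2 * r) = o | x ^+ (2 * r) = o ^+ 2].
  have [->|x0] := eqVneq x 0; first by constructor 1.
  have xp : x ^+ p.-1 = 1.
    have h : x ^+ p = x by rewrite -[X in _ ^+ X](card_Fp p_prime) finfield.expf_card.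
    by apply: (mulfI x0); rewrite -exprS prednK ?prime_gt0 // h mulr1.
  have : (x ^+ (2 * r) - 1) * (x ^+ (2 * r) - o) * (x ^+ (2 * r) - o ^+ 2) = 0.
    have : (x ^+ (2 * r)) ^+ 3 = 1 by rewrite -exprM (_ : (_ * 3 = p.-1)%N) //; lia.
    move: (x ^+ _) => y y3; apply: (lincomb3 (c1 := 1) (c2 := - y ^+ 2 +
      o * y) (c3 := - 1) y3 ho o3).
    by ring.
  move/eqP; rewrite !mulf_eq0 !subr_eq0 => /orP[/orP[]|] /eqP h.
  - by constructor 2.
  - by constructor 3.
  by constructor 4.
have class_sumE c : (class_sum c)%:~R = \sum_(x : 'F_p) (x ^+ (2 * r) == c)%:R * eta (1 - x) :> R.
  rewrite /class_sum rmorph_sum big_mkcond /=; apply: eq_bigr => x _.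
  by rewrite eta_sign; case: eqP; rewrite ?mul1r ?mul0r.
have hx (x : 'F_p) : teich x ^+ (2 * r) = (x ^+ (2 * r) == 1)%:R + t * (x ^+ (2 * r) == o)%:R
     + t ^+ 2 * (x ^+ (2 * r) == o ^+ 2)%:R.
  rewrite -teichX; case: (split x) => ->.
  - rewrite z0 teich0 ![0 == _]eq_sym oner_eq0.
    by rewrite (negPf o0) (negPf o20) /=; ring.
  - by rewrite teich1 eqxx ![1 == _]eq_sym (negPf o1) (negPf o2) /=; ring.
  - by rewrite -ht (negPf o1) eqxx [o == _]eq_sym (negPf o2o) /=; ring.
  by rewrite teichX -ht (negPf o2) (negPf o2o) eqxx /=; ring.
have hx2 (x : 'F_p) : teich x ^+ (4 * r) = (x ^+ (2 * r) == 1)%:R + t ^+ 2 * (x ^+ (2 * r) == o)%:R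
     + t * (x ^+ (2 * r) == o ^+ 2)%:R.
  rewrite (_ : (4 * r = 2 * r * 2)%N); last by lia.
  rewrite exprM hx; case: (split x) => ->.
  - rewrite z0 ![0 == _]eq_sym oner_eq0.
    by rewrite (negPf o0) (negPf o20) /=; ring.
  - by rewrite eqxx ![1 == _]eq_sym (negPf o1) (negPf o2) /=; ring.
  - by rewrite (negPf o1) eqxx [o == _]eq_sym (negPf o2o) /=; ring.
  by rewrite (negPf o2) (negPf o2o) eqxx /=; apply: (lincomb1 (c1 := t) t3); ring.
split=> //; rewrite /jacobi !class_sumE !mulr_sumr -!big_split; apply: eq_bigr => x _ /=.
  by rewrite hx /eta; ring.
by rewrite hx2 /eta; ring.
Qed.

(* Pair x with x^-1. *)
Lemma class_sum_even (o : 'F_p) : 1 + o + o ^+ 2 = 0 -> o != 1 ->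
  exists k, class_sum o = class_sum (o ^+ 2) + 2 * k.
Proof.
move=> ho o1; have o3 : o ^+ 3 = 1 by apply: (lincomb1 (c1 := o - 1) ho); ring.
have o0 : o != 0 by apply: contra_eqN o3 => /eqP->; rewrite expr0n eq_sym oner_eq0.
have -> : class_sum (o ^+ 2) = \sum_(x : 'F_p | x ^+ (2 * r) == o) quad_sign (1 - x^-1).
  rewrite /class_sum (reindex_inj invr_inj) /=; apply: eq_bigl => x.
  rewrite exprVn; apply/eqP/eqP => h.
    by apply: invr_inj; rewrite h; apply: (mulfI o0); rewrite divff // -exprS o3.
  by rewrite h; apply: (mulfI o0); rewrite divff // -exprS o3.
suff [k hk] : exists k, \sum_(x : 'F_p | x ^+ (2 * r) == o)
  (quad_sign (1 - x) - quad_sign (1 - x^-1)) = 2 * k.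
  by exists k; rewrite -hk sumrB addrC subrK.
apply: (big_ind (fun s : int => exists k, s = 2 * k)) => [|s s' [k ->] [k' ->]|x /eqP hx].
- by exists 0.
- by exists (k + k'); ring.
have x1 : x != 1 by apply: contra_eqN hx => /eqP->; rewrite expr1n eq_sym.
have [|k hk] := @quad_sign_odd (1 - x); first by rewrite subr_eq0 eq_sym.
have [|k' hk'] := @quad_sign_odd (1 - x^-1).
  by rewrite subr_eq0 eq_sym; apply: contraNneq x1 => h; apply/eqP/invr_inj; rewrite h invr1.
by exists (k - k'); rewrite hk hk'; ring.
Qed.


(* The norm of the Jacobi sum is p modulo p^3 and is an integer less than p^3 in absolute
   value, hence equals p; evenness puts it in the form a^2 + 3b^2. *)
Lemma jacobi_int : exists a b : int,
  jacobi (4 * r) + jacobi (2 * r) = 2 * a%:~R /\ p%:Z = a ^+ 2 + 3 * b ^+ 2.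
Proof.
have [o ho o1] := cubic_root_unity.
have [ht h2 h4] := jacobi_class_sum ho o1 erefl.
have [k hk] := class_sum_even ho o1.
have hJ := jacobi_mul; move: h2 h4 hJ ht.
have := class_sum_le 1; have := class_sum_le o; have := class_sum_le (o ^+ 2).
move: (teich o) (class_sum 1) (class_sum o) (class_sum (o ^+ 2)) hk =>
  t n0 n1 n2 hk b2 b1 b0 h2 h4 hJ ht.
(* As t^2 = -1 - t and n1 = n2 + 2k, the sum n0 + n1 t + n2 t^2 is (n0 - n2 - k) + k(1 + 2t), where
   (1 + 2t)^2 = -3. *)
exists (n0 - n2 - k), k; split.
  rewrite h2 h4 hk !(rmorphB, rmorphD, rmorphM) /=.
  by apply: (lincomb1 (c1 := n1%:~R + n2%:~R) ht); rewrite hk !(rmorphB, rmorphD, rmorphM) /=; ring.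
pose f := (n0 - n2 - k) ^+ 2 + 3 * k ^+ 2.
have hf : (f - p%:Z)%:~R = 0 :> R.
  have hP : P = (n0%:~R + t ^+ 2 * n1%:~R + t * n2%:~R) * (n0%:~R + t * n1%:~R + t ^+ 2 * n2%:~R).
    by rewrite -hJ h2 h4.
  rewrite rmorphB /f !(rmorphB, rmorphD, rmorphM) /=; move: hP.
  rewrite hk !(rmorphB, rmorphD, rmorphM) /=; move: (n0%:~R : R) (n2%:~R : R) (k%:~R : R) => x z y.
  move=> hP; apply: (lincomb2 (c1 := - 1) (c2 := - (x * (z + 2 * y) + x * z)
    + (1 - t) * ((z + 2 * y) ^+ 2 + z ^+ 2) - (z + 2 * y) * z * (1 - t + t ^+ 2)) hP ht).
  by ring.
have pZ : p%:Z >= 7 by rewrite lez_nat; have := r0; lia.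
have f0 : 0 <= f by apply: addr_ge0; [exact: sqr_ge0 | apply: mulr_ge0 => //; exact: sqr_ge0].
have sq_le (a b : int) : `|a| <= p%:Z -> `|b| <= p%:Z -> (a - b) ^+ 2 <= 4 * p%:Z ^+ 2.
  move=> ha hb; have -> : 4 * p%:Z ^+ 2 = (2 * p%:Z) ^+ 2 by ring.
  rewrite -[leLHS]real_normK ?num_real // ler_sqr ?nnegrE ?mulr_ge0 //.
  by rewrite (le_trans (ler_normB _ _)) // (_ : 2 * p%:Z = p%:Z + p%:Z) ?lerD //; ring.
(* 2f is a sum of three squared differences, each at most (2p)^2. Since p = 6r + 1 is at least 7,
   6p^2 stays below p^3. *)
have f1 : f <= 6 * p%:Z ^+ 2.
  have hf2 : 2 * f = (n0 - n1) ^+ 2 + (n1 - n2) ^+ 2 + (n0 - n2) ^+ 2 by rewrite /f hk; ring.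
  have := sq_le _ _ b0 b1; have := sq_le _ _ b1 b2; have := sq_le _ _ b0 b2.
  move: hf2; move: ((n0 - n1) ^+ 2) ((n1 - n2) ^+ 2) ((n0 - n2) ^+ 2) (p%:Z ^+ 2) f {hf f0}.
  by move=> a b c d e; lia.
have f2 : 7 * p%:Z ^+ 2 <= p%:Z ^+ 3 by rewrite [leRHS]exprS ler_wpM2r ?sqr_ge0.
have f3 : 7 * p%:Z <= p%:Z ^+ 2 by rewrite expr2 ler_wpM2r.
have /dvdzP[c hc] := injR hf.
suff hc0 : c = 0 by apply/esym/eqP; rewrite -subr_eq0 -/f hc hc0 mul0r.
move: f2 f3 f1 f0 hc; move: (p%:Z ^+ 3) (p%:Z ^+ 2) f pZ {hf} => P3' P2 g; move: (p%:Z) => P1.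
move=> h7 h8 h9 g1 g0 hc.
have [h|h|//] := ltgtP c 0; nia.
Qed.

End Teichmuller.

Lemma tsum_1mod6_eval r (x y : int) : p = (6 * r + 1)%N -> p%:Z = x ^+ 2 + 3 * y ^+ 2 ->
  tsum (- 3^-1) = 4 * x%:~R ^+ 2 - 2 * P.
Proof.
move=> hp hxy; have [|q hq] := fermat_pred (a := 2); first by rewrite gtnNdvd //; lia.
have {}hq : 2 ^+ p.-1 = 1 + P * q%:R by rewrite -natrX hq natrD natrM.
have [uj ->] := tsum_1mod6_jac hp hq.
have hj := jacobi_jac hp hq.
have hm := jacobi_mul hp.
have [a [b' [hs hab]]] := jacobi_int hp.
have hax : a%:~R ^+ 2 = x%:~R ^+ 2 :> R.
  by rewrite -!rmorphXn /= (sum_sq_3sq_unique p_prime hab hxy).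
rewrite hj in hm hs; move: (jacobi _ _) (a%:~R) hm hs hax => j' z hm hs hax.
have -> : P ^+ 2 / jac r q%:R ^+ 2 = j' ^+ 2.
  by apply: (mulIr (unitrX 2 uj)); rewrite divrK ?unitrX // -hm; ring.
move: (jac _ _) hm hs {hj uj} => j hm hs.
by apply: (lincomb3 (c1 := - j + j' + 2 * z) (c2 := - 2) (c3 := 4) hs hm hax); ring.
Qed.

(** * From p-integral rationals to residues *)

(* u is the residue of the p-integral rational x. *)
Definition rat_red (x : rat) (u : R) := exists n d : int,
  [/\ ~~ (p%:Z %| d)%Z, x * d%:~R = n%:~R & u * d%:~R = n%:~R].

Lemma prime_dvdzM (m n : int) : (p%:Z %| m * n)%Z = (p%:Z %| m)%Z || (p%:Z %| n)%Z.
Proof. by rewrite !dvdzE abszM Euclid_dvdM. Qed.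

Lemma int_unit (d : int) : ~~ (p%:Z %| d)%Z -> (d%:~R : R) \is a GRing.unit.
Proof.
rewrite dvdzE /= => hd; rewrite (intEsign d) rmorphM rmorph_sign unitrM unitrX ?unitrN1 //=.
by rewrite -pmulrn unitN.
Qed.

Lemma rat_red_int (n : int) : rat_red n%:~R n%:~R.
Proof.
exists n, 1; rewrite !mulr1; split=> //.
by rewrite dvdzE /= dvdn1; apply: contraTneq p_prime => ->.
Qed.

Lemma rat_red_nat (n : nat) : rat_red n%:R n%:R.
Proof. by have := rat_red_int n; rewrite -!pmulrn. Qed.

Lemma rat_redD x y u z : rat_red x u -> rat_red y z -> rat_red (x + y) (u + z).
Proof.
move=> [n [d [hd hx hu]]] [m [e [he hy hz]]]; exists (n * e + m * d), (d * e).
split; first by rewrite prime_dvdzM negb_or hd.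
  by rewrite rmorphD !rmorphM /= -hx -hy; ring.
by rewrite rmorphD !rmorphM /= -hu -hz; ring.
Qed.

Lemma rat_redM x y u z : rat_red x u -> rat_red y z -> rat_red (x * y) (u * z).
Proof.
move=> [n [d [hd hx hu]]] [m [e [he hy hz]]]; exists (n * m), (d * e).
split; first by rewrite prime_dvdzM negb_or hd.
  by rewrite !rmorphM /= -hx -hy; ring.
by rewrite !rmorphM /= -hu -hz; ring.
Qed.

Lemma rat_redN x u : rat_red x u -> rat_red (- x) (- u).
Proof.
by move=> [n [d [hd hx hu]]]; exists (- n), d; rewrite !mulNr hx hu !rmorphN.
Qed.

Lemma rat_redB x y u z : rat_red x u -> rat_red y z -> rat_red (x - y) (u - z).
Proof. by move=> hx /rat_redN; apply: rat_redD. Qed.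

Lemma rat_redX x u n : rat_red x u -> rat_red (x ^+ n) (u ^+ n).
Proof.
move=> hx; elim: n => [|n IHn]; first exact: (rat_red_int 1).
by rewrite !exprS; apply: rat_redM.
Qed.

Lemma rat_redV x u : u \is a GRing.unit -> rat_red x u -> rat_red x^-1 u^-1.
Proof.
move=> hu [n [d [hd hx hud]]]; have ud := int_unit hd.
(* If p divided [n], the unit [u * d] would have cube 0. *)
have hn : ~~ (p%:Z %| n)%Z.
  apply/negP => /dvdzP[m hm]; have : (u * d%:~R) ^+ 3 \is a GRing.unit by rewrite unitrX
    ?unitrM ?hu.
  by rewrite hud hm rmorphM /= -pmulrn exprMn P3 mulr0 unitr0.
have un := int_unit hn; exists d, n; split=> //; last first.
  by apply: (mulrI hu); rewrite mulrA divrr // mul1r hud.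
have n0 : n%:~R != 0 :> rat by rewrite intr_eq0; apply: contraNneq hn => ->; rewrite dvdz0.
have x0 : x != 0 by apply: contraNneq n0 => x0; rewrite -hx x0 mul0r.
by rewrite -hx mulrA mulVf ?mul1r.
Qed.

Lemma rat_red_div x y u z : z \is a GRing.unit -> rat_red x u -> rat_red y z ->
  rat_red (x / y) (u / z).
Proof. by move=> uz hx /(rat_redV uz); apply: rat_redM. Qed.

Lemma rat_red_sum n (F : 'I_n -> rat) (G : 'I_n -> R) :
  (forall k, rat_red (F k) (G k)) -> rat_red (\sum_k F k) (\sum_k G k).
Proof.
by move=> h; apply: (big_ind2 rat_red) => // [|x u y z]; [exact: (rat_red_int 0)|exact: rat_redD].
Qed.

Lemma rat_red_integral x u : rat_red x u -> p_integral p x.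
Proof.
move=> [n [d [hd hx _]]]; apply: contraNN hd => hp; apply: (dvdz_trans hp).
have h : numq x * d = n * denq x.
  by apply: (@intr_inj rat); rewrite !rmorphM /= -hx numqE; ring.
by rewrite -(@Gauss_dvdzr _ (numq x)) ?h ?dvdz_mull // coprimez_sym /coprimez;
  apply: coprime_num_den.
Qed.

(** Equal residues make the numerator of x - y vanish in R; by [injR] it is a multiple of p^3, and
    dividing by p^3 leaves a denominator prime to p. *)
Lemma rat_red_eqmod x y u : rat_red x u -> rat_red y u -> rat_eqmod p 3 x y.
Proof.
move=> hx hy; rewrite /rat_eqmod (rat_red_integral hx) (rat_red_integral hy) /=.
have [n [d [hd hxy]]] := rat_redB hx hy; rewrite subrr mul0r => /esym/injR/dvdzP[c hc].
apply: (@rat_red_integral _ (c%:~R / d%:~R)); exists c, d; split=> //; last first.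
  by rewrite divrK ?int_unit.
have p0 : p%:R != 0 :> rat by rewrite pnatr_eq0 -lt0n prime_gt0.
apply: (mulfI (expf_neq0 3 p0)); rewrite mulrC -mulrA mulrC -mulrA mulrC -!mulrA.
move: hxy; rewrite hc rmorphM rmorphXn /= -pmulrn => hxy.
by transitivity ((x - y) * d%:~R); [field|rewrite hxy; ring].
Qed.

(** * The sum of the theorem as a sum in R *)

Lemma central_bin_rec k : ('C(2 * k.+1, k.+1) * k.+1 = 'C(2 * k, k) * (2 * (2 * k + 1)))%N.
Proof.
have h n : ('C(2 * n, n) * (n`! * n`!) = (2 * n)`!)%N.
  by rewrite -[RHS](@bin_fact _ n) ?leq_pmull // mul2n -addnn addnK.
have := h k.+1; rewrite (_ : 2 * k.+1 = (2 * k).+2)%N; last by lia.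
rewrite !factS -h => e; have f0 := fact_gt0 k.
apply/eqP; rewrite -(eqn_pmul2r (_ : 0 < k`! * k`! * k.+1)%N) ?muln_gt0 ?f0 //; apply/eqP.
rewrite (_ : (2 * (2 * k + 1) = 2 * (2 * k).+1)%N) in e *; last by lia.
by transitivity ('C((2 * k).+2, k.+1) * (k.+1 * k`! * (k.+1 * k`!)))%N; [ring|rewrite e; ring].
Qed.

Lemma central_tri_rec k : ('C(2 * k.+1, k.+1) * 'C(3 * k.+1, k.+1) * k.+1 ^ 2 =
  'C(2 * k, k) * 'C(3 * k, k) * (3 * (3 * k + 1) * (3 * k + 2)))%N.
Proof.
have h n : ('C(2 * n, n) * 'C(3 * n, n) * (n`! * n`! * n`!) = (3 * n)`!)%N.
  rewrite -[RHS](@bin_fact _ n) ?leq_pmull // (_ : 3 * n - n = 2 * n)%N; last by lia.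
  rewrite -(@bin_fact (2 * n) n) ?leq_pmull // (_ : 2 * n - n = n)%N; last by lia.
  by ring.
have := h k.+1; rewrite [(3 * k.+1)`!](_ : _ = (3 * k).+3 `!)%N; last by congr _`!; lia.
rewrite !factS -h => e; have f0 := fact_gt0 k.
apply/eqP; rewrite -(eqn_pmul2r (_ : 0 < k`! * k`! * k`! * k.+1)%N) ?muln_gt0 ?f0 //; apply/eqP.
transitivity ('C(2 * k.+1, k.+1) * 'C(3 * k.+1, k.+1) * (k.+1 * k`! * (k.+1 * k`!) * (k.+1 *
  k`!)))%N; first by ring.
by rewrite e; ring.
Qed.

Lemma central_bin_cbin4 k : (k < p)%N -> 'C(2 * k, k)%:R = 4 ^+ k * cbin4 R k.
Proof.
elim: k => [|k IHk] kp; first by rewrite cbin40 mulr1.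
apply: (mulIr (unitS_lt kp)); rewrite -natrM central_bin_rec natrM IHk; last by lia.
rewrite !natrM natrD natrM exprS.
by apply: (lincomb1 (c1 := - 2 * 4 ^+ k) (cbin4_rec kp)); ring.
Qed.

Lemma central_tri_legc k : (k < p)%N ->
  ('C(2 * k, k) * 'C(3 * k, k))%:R = 27 ^+ k * legc (- 3^-1 : R) k.
Proof.
elim: k => [|k IHk] kp; first by rewrite legc0 mulr1.
apply: (mulIr (unitrX 2 (unitS_lt kp)));
  rewrite -[k.+1%:R ^+ 2]natrX -[LHS]natrM central_tri_rec natrM IHk; last by lia.
rewrite legcS [27 ^+ k.+1]exprS. rewrite -[RHS]mulrA natrX divrK ?unitrX ?unitS_lt //.
have h3 : 3 * - 3^-1 = - 1 :> R by rewrite mulrN divrr ?unit3.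
move: (- 3^-1) (legc _ _) h3 => t l h3; rewrite !natrM !natrD ?natrM.
by apply: (lincomb1 (c1 := 27 ^+ k * l * (9 * t + 6)) h3); ring.
Qed.

Lemma tsum_term k : (k < p.-1)%N ->
  ('C(2 * k, k) ^ 2 * 'C(3 * k, k))%:R / (108 ^+ k * k.+1%:R) =
  cbin4 R k * legc (- 3^-1) k / k.+1%:R.
Proof.
move=> kp; rewrite (_ : _ * _ = 'C(2 * k, k) * ('C(2 * k, k) * 'C(3 * k, k)))%N; last by ring.
have kp' : (k < p)%N by lia.
rewrite natrM central_bin_cbin4 // central_tri_legc // (_ : 108 = 4 * 27); last by ring.
have uk : (k.+1%:R : R) \is a GRing.unit by rewrite unitS_lt; lia.
have u4 : (4 : R) \is a GRing.unit by rewrite (_ : 4 = 2 * 2) ?unitrM ?unit2 //; ring.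
have u27 : (27 : R) \is a GRing.unit by rewrite (_ : 27 = 3 * 3 * 3) ?unitrM ?unit3 //; ring.
apply: eq_divr; rewrite ?unitrM ?unitrX ?unitrM ?u4 //.
by rewrite exprMn; ring.
Qed.

Lemma rat_red_tsum : rat_red
  (\sum_(0 <= k < p - 1) ('C(2 * k, k) ^ 2 * 'C(3 * k, k))%:R / (108 ^+ k * k.+1%:R))
  (tsum (- 3^-1)).
Proof.
rewrite subn1 big_mkord; apply: rat_red_sum => k; have kp := ltn_ord k; rewrite -tsum_term //.
have u108 : (108 : R) \is a GRing.unit by rewrite (_ : 108 = 36 * 3) ?unitrM ?unit36 ?unit3 //;
  ring.
apply: rat_red_div; first by rewrite unitrM unitrX // unitS_lt //; lia.
  exact: rat_red_nat.
by apply: rat_redM; [apply: rat_redX|]; apply: rat_red_nat.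
Qed.

Lemma fermat_quotient_nat (a : nat) : ~~ (p %| a)%N -> exists q : nat,
  fermat_quotient p a = q%:R /\ (a%:R : R) ^+ p.-1 = 1 + P * q%:R.
Proof.
move=> /fermat_pred[q hq]; exists q; split; last by rewrite -natrX hq natrD natrM.
have p0 : p%:R != 0 :> rat by rewrite pnatr_eq0 -lt0n prime_gt0.
rewrite /fermat_quotient subn1 -pmulrn -natrX hq natrD natrM addrAC subrr add0r.
by rewrite mulrC mulKf.
Qed.

Lemma tsum_rat_1mod3 (x y : int) : p = 1 %[mod 3] -> p%:Z = x ^+ 2 + 3 * y ^+ 2 ->
  rat_red (4 * x%:~R ^+ 2 - 2 * p%:R) (tsum (- 3^-1)).
Proof.
move=> hp hxy; have hb := p_half; rewrite (@tsum_1mod6_eval (p %/ 6) x y) //; last by lia.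
have hx := rat_redX 2 (rat_red_int x); apply: rat_redB; apply: rat_redM => //; exact: rat_red_nat.
Qed.

Lemma tsum_rat_2mod3 (q2 q3 B : rat) : q2 = fermat_quotient p 2 -> q3 = fermat_quotient p 3 ->
    B = 'C((p - 1) %/ 2, (p - 5) %/ 6)%:R -> p = 2 %[mod 3] ->
  rat_red (- 2 * B ^+ 2 *
          (1 + p%:R * (2 + 4 / 3 * q2 - 3 / 2 * q3)
             + p%:R ^+ 2 * (1 + 8 / 3 * q2 + 2 / 9 * q2 ^+ 2 - 3 * q3
                         - 2 * q2 * q3 + 15 / 8 * q3 ^+ 2
                         + 3 / 4 * (U (p - 3))%:~R))
        - 1 / 2 * p%:R ^+ 2 * B ^- 2) (tsum (- 3^-1)).
Proof.
move=> -> -> -> hp {q2 q3 B}; have hb := p_half; pose r := (p %/ 6)%N.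
have [|z2 [-> h2]] := @fermat_quotient_nat 2; first by rewrite gtnNdvd //; lia.
have [|z3 [-> h3]] := @fermat_quotient_nat 3; first by rewrite gtnNdvd //; lia.
have hpr : p = (6 * r + 5)%N by lia.
have -> : ((p - 1) %/ 2 = b)%N by lia.
have -> : ((p - 5) %/ 6 = r)%N by lia.
have uB : ('C(b, r)%:R : R) \is a GRing.unit.
  have : (b`!%:R : R) \is a GRing.unit by rewrite fact_unit //; lia.
  by rewrite -(@bin_fact b r) ?natrM ?unitrM; [case/andP|lia].
set u := (U (p - 3))%:~R : R; set i2 := z2%:R : R; set i3 := z3%:R : R; set B := 'C(b, r)%:R : R.
have u4 : (4 : R) \is a GRing.unit by rewrite (_ : 4 = 2 * 2) ?unitrM ?unit2 //; ring.
have u8 : (8 : R) \is a GRing.unit by rewrite (_ : 8 = 4 * 2) ?unitrM ?unit2 ?u4 //; ring.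
have u9 : (9 : R) \is a GRing.unit by rewrite (_ : 9 = 3 * 3) ?unitrM ?unit3 //; ring.
have -> : tsum (- 3^-1) = - 2 * B ^+ 2 *
  (1 + P * (2 + 4 / 3 * i2 - 3 / 2 * i3)
     + P ^+ 2 * (1 + 8 / 3 * i2 + 2 / 9 * i2 ^+ 2 - 3 * i3
                 - 2 * i2 * i3 + 15 / 8 * i3 ^+ 2 + 3 / 4 * u))
  - 1 / 2 * P ^+ 2 * B ^- 2.
  have frac (n a d c : R) : d \is a GRing.unit -> n * a = c * d -> n * (a / d) = c.
    by move=> ud h; apply: (mulIr ud); rewrite mulrA divrK.
  (* The factors 36 and 1296 = 36^2 come from P = 36 w and turn the stated fractions into the
     integral coefficients of [tsum_5mod6_eval]. *)
  have f1 : 36 * (4 / 3) = 48 :> R by apply: frac; rewrite ?unit3 //; ring.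
  have f2 : 36 * (3 / 2) = 54 :> R by apply: frac; rewrite ?unit2 //; ring.
  have f3 : 1296 * (8 / 3) = 3456 :> R by apply: frac; rewrite ?unit3 //; ring.
  have f4 : 1296 * (2 / 9) = 288 :> R by apply: frac; rewrite ?u9 //; ring.
  have f5 : 1296 * (15 / 8) = 2430 :> R by apply: frac; rewrite ?u8 //; ring.
  have f6 : 1296 * (3 / 4) = 972 :> R by apply: frac; rewrite ?u4 //; ring.
  have f7 : 1296 * (1 / 2) = 648 :> R by apply: frac; rewrite ?unit2 //; ring.
  rewrite (tsum_5mod6_eval hpr h2 h3 erefl) Pw -/u -/i2 -/i3 -/B -f1 -f2 -f3 -f4 -f5 -f6 -f7.
  move: (4 / 3) (3 / 2) (8 / 3) (2 / 9) (15 / 8) (3 / 4) (1 / 2) => g1 g2 g3 g4 g5 g6 g7.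
  by ring.
have hd (a c : nat) : (c%:R : R) \is a GRing.unit -> rat_red (a%:R / c%:R) (a%:R / c%:R).
  by move=> uc; apply: rat_red_div => //; apply: rat_red_nat.
have h1 : rat_red 1 1 by exact: (rat_red_nat 1).
rewrite -[1 / 2]/(1%:R / 2).
repeat lazymatch goal with
| |- rat_red (_ - _) _ => apply: rat_redB
| |- rat_red (_ + _) _ => apply: rat_redD
| |- rat_red (- _) _ => apply: rat_redN
| |- rat_red (_%:R / 'C(_, _)%:R ^+ 2) _ => fail
| |- rat_red (_ / 'C(_, _)%:R ^+ 2) _ =>
    apply: rat_red_div; [by rewrite unitrX | | apply: rat_redX]
| |- rat_red (_ / _) _ => apply: hd
| |- rat_red (_ * _) _ => apply: rat_redM
| |- rat_red (_ ^+ _) _ => apply: rat_redX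
| |- rat_red 1 _ => exact: h1
| |- rat_red _%:R _ => exact: rat_red_nat
| |- rat_red _%:~R _ => exact: rat_red_int
end; rewrite ?unit2 ?unit3 ?u4 ?u8 ?u9 //.
Qed.

End ModPrimeCube.

(** * The ring of integers modulo p^3 *)

Lemma Zp_cube_unit p k : prime p -> ~~ (p %| k)%N -> (k%:R : 'Z_(p ^ 3)) \is a GRing.unit.
Proof.
move=> pp hk; rewrite unitZpE ?coprimeXl // ?prime_coprime //.
by rewrite -(exp1n 3) ltn_exp2r ?prime_gt1.
Qed.

Lemma Zp_int_eq0 m (z : int) : (1 < m)%N -> z%:~R = 0 :> 'Z_m -> (m%:Z %| z)%Z.
Proof.
move=> m1; have h n : n%:R = 0 :> 'Z_m -> (m %| n)%N.
  by move=> /(congr1 val); rewrite /= val_Zp_nat // /dvdn => ->.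
case: z => n; first by rewrite -pmulrn => /h.
by rewrite NegzE mulrNz -pmulrn => /eqP; rewrite oppr_eq0 => /eqP/h; rewrite dvdzE abszN.
Qed.

Theorem theorem3p3 (p : nat) (p_prime : prime p) (p_gt3 : (3 < p)%N) :
  let T : rat := \sum_(0 <= k < p - 1)
    ('C(2 * k, k) ^ 2 * 'C(3 * k, k))%:R / (108 ^+ k * k.+1%:R) in
  let q2 : rat := fermat_quotient p 2 in
  let q3 : rat := fermat_quotient p 3 in
  let B : rat := 'C((p - 1) %/ 2, (p - 5) %/ 6)%:R in
  let P : rat := p%:R in
  (p = 1 %[mod 3] ->
   forall x y : int, p%:Z = x ^+ 2 + 3 * y ^+ 2 ->
     rat_eqmod p 3 T (4 * x%:~R ^+ 2 - 2 * P))
  /\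
  (p = 2 %[mod 3] ->
     rat_eqmod p 3 T
       (- 2 * B ^+ 2 *
          (1 + P * (2 + 4 / 3 * q2 - 3 / 2 * q3)
             + P ^+ 2 * (1 + 8 / 3 * q2 + 2 / 9 * q2 ^+ 2 - 3 * q3
                         - 2 * q2 * q3 + 15 / 8 * q3 ^+ 2
                         + 3 / 4 * (U (p - 3))%:~R))
        - 1 / 2 * P ^+ 2 * B ^- 2)).
Proof.
move=> T q2 q3 B P; have p3 : (1 < p ^ 3)%N by rewrite -(exp1n 3) ltn_exp2r ?prime_gt1.
have P3 : (p%:R : 'Z_(p ^ 3)) ^+ 3 = 0 by rewrite -natrX pchar_Zp.
have unitN k : ~~ (p %| k)%N -> (k%:R : 'Z_(p ^ 3)) \is a GRing.unit by exact: Zp_cube_unit.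
have injR (z : int) : z%:~R = 0 :> 'Z_(p ^ 3) -> (p%:Z ^+ 3 %| z)%Z.
  by move=> /(Zp_int_eq0 p3); rewrite -!natz natrX.
have hT := rat_red_tsum p_prime p_gt3 P3 unitN.
split=> [hp x y hxy|hp]; apply: (rat_red_eqmod p_prime unitN injR hT).
  exact: (tsum_rat_1mod3 p_prime p_gt3 P3 unitN injR hp hxy).
exact: (tsum_rat_2mod3 p_prime p_gt3 P3 unitN erefl erefl erefl hp).
Qed.
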